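(* Let $a,b$ be coprime positive integers with $b\ge2$, let $1\le k\le a$, and let $X$ be the set of $(P,Q)\in NC(a,b)$ having $k$ blocks in total (blocks of $P$ together with the blocks of $Q$ of positive rank). Let $C=\mathbb{Z}_{b-1}$ act on $X$ by rotation and let $X(q)=\mathrm{Nar}_q(a,b,k)=\frac{1}{[a]_q}{a\brack k}_q{b-1\brack k-1}_q$. Then $(X,C,X(q))$ exhibits the cyclic sieving phenomenon.
   Context: An $a,b$-Dyck path is a lattice path from $(0,0)$ to $(b,a)$ with unit north steps $N$ and east steps $E$ staying above the line $y=\frac{a}{b}x$; write it as $D=N^{v_0}EN^{v_1}E\cdots N^{v_{b-1}}E$, $v_i\ge 0$. A vertical run of length $v$ is a $P$-rise if $v>a/b$ and a $Q$-rise if $v<a/b$. For $1\le i\le b-1$ the label $i$ is the point $(i,v_0+\dots+v_{i-1})$. If $v_i>0$, the laser $\ell(i)$ is the segment of slope $a/b$ from label $i$ going northeast until it next meets $D$ (in the interior of an east step). $\ell(D)$ is the set of pairs $(i,j)$ with $\ell(i)$ ending on the east step whose west endpoint has $x$-coordinate $j$. The labeled pair $\pi(D)=(P,Q)$ of set partitions of $[b-1]$: $i,j$ in the same block of $P$ iff labels $i,j$ are not separated by any laser (label $k$ lies strictly below $\ell(k)$), and a block $B\in P$ gets rank $v_{\min(B)-1}$; $Q$ is the equivalence relation generated by $i\sim j$ whenever $\ell(i),\ell(j)$ end on the same east step immediately following a $Q$-rise, or $(i,j)\in\ell(D)$, or $(j,i)\in\ell(D)$, and a block $B\in Q$ gets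 rank $v_{\max(B)}$ (blocks of rank $0$ are called trivial and are not counted as blocks). $NC(a,b)=\{\pi(D)\}$ over all $a,b$-Dyck paths. The rotation (generator of $\mathbb{Z}_{b-1}$) acts by $i\mapsto i+1$ ($b-1\mapsto 1$) on every block of both partitions, ranks kept; it preserves $NC(a,b)$ and the number of blocks. Notation: $[n]_q=1+\dots+q^{n-1}$, $[n]!_q=\prod_{j\le n}[j]_q$, ${n\brack k}_q=\frac{[n]!_q}{[k]!_q[n-k]!_q}$. Cyclic sieving: for finite $X$, cyclic $C=\langle c\rangle$ acting on $X$, and $X(q)\in\mathbb{N}[q]$, the triple exhibits the cyclic sieving phenomenon if $X(\zeta^d)=|\{x: c^dx=x\}|$ for all $d\ge0$, where $\zeta$ has multiplicative order $|C|$. *)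

(* Defs.v *)
From mathcomp Require Import all_boot all_order all_algebra all_field.

Set Implicit Arguments.
Unset Strict Implicit.
Unset Printing Implicit Defensive.

Import Order.TTheory GRing.Theory Num.Theory.
Local Open Scope ring_scope.

(* The word N^{v_0} E N^{v_1} E ... N^{v_{b-1}} E is encoded by the tuple
   (v_0, ..., v_{b-1}).  Its entries sum to a, so each of them is at most a. *)
Definition vruns (a b : nat) := b.-tuple 'I_a.+1.

Definition vrun a b (D : vruns a b) (i : nat) : 'I_a.+1 := nth ord0 D i.

(* v_0 + ... + v_{i-1}: the height at which D reaches abscissa i.  It is the
   ordinate of label i, and the height of the east step whose west endpoint has
   abscissa j is height D j.+1. *)
Definition height a b (D : vruns a b) (i : nat) : nat :=
  (\sum_(m < i) vrun D m)%N.

(* At each abscissa i the point (i, height D i) is the lowest one of the path,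
   so it is enough to compare these points with the line y = (a / b) x. *)
Definition is_dyck a b (D : vruns a b) : bool :=
  (height D b == a) && [forall i : 'I_b.+1, a * i <= b * height D i]%N.

Definition slope (a b : nat) : rat := a%:R / b%:R.

Definition q_rise a b (D : vruns a b) (i : nat) : bool :=
  (vrun D i)%:R < slope a b.

(* The set [b-1] = {1, ..., b-1}; the element 0 of 'I_b is not a label. *)
Definition labels (b : nat) : {set 'I_b} := [set i : 'I_b | 0 < i]%N.

(* Ordinate at abscissa x of the line of slope a/b through label i. *)
Definition laser_line a b (D : vruns a b) (i x : nat) : rat :=
  (height D i)%:R + slope a b * (x%:R - i%:R).

(* The ray of slope a/b going northeast from label i meets the interior of the
   east step from (j, height D j.+1) to (j.+1, height D j.+1). *)
Definition ray_meets a b (D : vruns a b) (i j : nat) : bool :=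
  (i <= j)%N && (laser_line D i j < (height D j.+1)%:R < laser_line D i j.+1).

(* laser D i j means (i, j) \in l(D).  The ray starts below and to the right of
   the path, hence it can only hit an east step, and by coprimality of a and b
   it hits it in its interior; so the first hit is the least j which is met. *)
Definition laser a b (D : vruns a b) (i j : 'I_b) : bool :=
  [&& 0 < i, 0 < vrun D i & ray_meets D i j]%N
  && [forall m : 'I_b, (m < j)%N ==> ~~ ray_meets D i m].

(* Label i is strictly above the segment l(k).  If l(k) ends on the east step
   with west endpoint j, its right end has abscissa in ]j, j+1[, so i is in the
   range of abscissas of l(k) iff k <= i <= j.  Label k itself is on the line
   supporting l(k), and thus counts as below l(k). *)
Definition above_laser a b (D : vruns a b) (k i : 'I_b) : bool :=
  [exists j : 'I_b, laser D k j && (k <= i <= j)%N]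
  && (laser_line D k i < (height D i)%:R).

Definition separated a b (D : vruns a b) (i j : 'I_b) : bool :=
  [exists k : 'I_b, above_laser D k i != above_laser D k j].

Definition P_rel a b (D : vruns a b) : rel 'I_b :=
  fun i j => ~~ separated D i j.

Definition Q_step a b (D : vruns a b) : rel 'I_b := fun i j =>
  [|| [exists m : 'I_b, [&& q_rise D m, laser D i m & laser D j m]],
      laser D i j | laser D j i].

(* Q_step is symmetric, so its reflexive transitive closure is the equivalence
   relation it generates. *)
Definition Q_rel a b (D : vruns a b) : rel 'I_b := connect (Q_step D).

(* A labeled partition is the set of its blocks, each paired with its rank. *)
Notation labeled_block a b := ({set 'I_b} * 'I_a.+1)%type.

Notation labeled_partition a b := {set labeled_block a b}.

Notation labeled_pair a b := (labeled_partition a b * labeled_partition a b)%type.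

Definition min_label b (B : {set 'I_b}) : nat := \big[minn/b]_(i in B) (i : nat).
Definition max_label b (B : {set 'I_b}) : nat := (\max_(i in B) (i : nat))%N.

Definition pi_P a b (D : vruns a b) : labeled_partition a b :=
  [set (B, vrun D (min_label B).-1)
     | B in equivalence_partition (P_rel D) (labels b)].

Definition pi_Q a b (D : vruns a b) : labeled_partition a b :=
  [set (B, vrun D (max_label B))
     | B in equivalence_partition (Q_rel D) (labels b)].

Definition pi a b (D : vruns a b) : labeled_pair a b := (pi_P D, pi_Q D).

Definition NC (a b : nat) : {set labeled_pair a b} :=
  [set pi D | D : vruns a b & is_dyck D].

(* Q keeps its trivial blocks (those of rank 0), but they are not counted. *)
Definition num_blocks a b (PQ : labeled_pair a b) : nat :=
  (#|PQ.1| + #|[set Br : labeled_block a b in PQ.2 | 0 < Br.2]|)%N.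

Definition NCk (a b k : nat) : {set labeled_pair a b} :=
  [set PQ in NC a b | num_blocks PQ == k].

(* i |-> i + 1 and b - 1 |-> 1 on {1, ..., b-1}; the value at the non-label 0
   is irrelevant. *)
Definition rotate_label b (i : 'I_b) : 'I_b :=
  insubd i (if (i.+1 < b)%N then i.+1 else 1%N).

Definition rotate_partition a b (P : labeled_partition a b) :
    labeled_partition a b :=
  [set (@rotate_label b @: Br.1, Br.2) | Br : labeled_block a b in P].

Definition rotate_pair a b (PQ : labeled_pair a b) : labeled_pair a b :=
  (rotate_partition PQ.1, rotate_partition PQ.2).

Definition qint (n : nat) : {poly int} := \sum_(i < n) 'X^i.

Definition qfact (n : nat) : {poly int} := \prod_(1 <= j < n.+1) qint j.

(* The test is needed because n - k is truncated: the coefficient is 0 when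
   n < k. *)
Definition qbinom (n k : nat) : {fraction {poly int}} :=
  if (k <= n)%N then
    FracField.tofrac (qfact n)
      / (FracField.tofrac (qfact k) * FracField.tofrac (qfact (n - k)))
  else 0.

Definition qNar (a b k : nat) : {fraction {poly int}} :=
  (FracField.tofrac (qint a))^-1 * qbinom a k * qbinom b.-1 k.-1.

Definition poly_nat_frac (f : {poly nat}) : {fraction {poly int}} :=
  FracField.tofrac (map_poly (fun m : nat => m%:R) f).

(* The map c is the action of a generator of the cyclic group of order n. *)
Definition cyclic_action (T : finType) (X : {set T}) (n : nat) (c : T -> T) :=
  (forall x, x \in X -> c x \in X) /\ (forall x, x \in X -> iter n c x = x).

Definition cyclic_sieving (T : finType) (X : {set T}) (n : nat) (c : T -> T)
    (f : {poly nat}) : Prop :=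
  cyclic_action X n c /\
  forall (zeta : algC) (d : nat), n.-primitive_root zeta ->
    (map_poly (fun m : nat => m%:R) f).[zeta ^+ d]
      = #|[set x in X | iter d c x == x]|%:R.

(* Main.v *)
Require Import Defs.
From mathcomp Require Import all_boot all_order all_algebra all_field.
From mathcomp Require Import zify lra ring.

Set Implicit Arguments.
Unset Strict Implicit.
Unset Printing Implicit Defensive.

Import Order.TTheory GRing.Theory Num.Theory.

(** Put n = b - 1.  The vertical runs 0, ..., n of a Dyck path are the vertices
    of a plane tree whose edges are the labels 1, ..., n.  Let W x measure the
    height of label x above the line y = a x / b; then label x joins the vertex
    alpha x, the last k < x with W k < W x, to the vertex beta x, the first
    j >= x with W (j + 1) < W x.  The blocks of P and Q are the fibers of alpha
    and beta, and their ranks are the lengths of the runs, so that rotation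
    becomes a map rho on paths together with a bijection between the vertices.

    A path with a marked vertex is the same thing, equivariantly, as an
    arbitrary cyclic sequence of n ranks with sum at most a: this is a form of
    the cycle lemma, where the sequence lists the ranks of the other vertices.
    A path fixed by a nontrivial rotation has exactly one fixed vertex: two of
    them would cross, so the other vertices lie in orbits of full size, which
    divides n but not n + 1.  Hence the fixed paths correspond to periodic
    sequences, and by the q-Lucas theorem the q-Narayana polynomial evaluates
    to the number of these.

    The coefficients are nonnegative because [k] Nar is a product of two
    Gaussian binomials: such a product is unimodal, being the character of a
    representation of sl2, and Nar = F (1 - q) / (1 - q^k) with F unimodal. *)

(** The defining quotient by [a] cannot be evaluated at a root of unity where [a] vanishes. The same
    rational function satisfies the mirror identity [n+1] Nar = [n+1 choose k] [a-1 choose k-1] in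
    Gaussian binomials, and [n+1] takes the value 1 at a root of unity of order w > 1 dividing n,
    and n+1 at 1. These values are the numbers of marks that a path admits: one fixed vertex under a
    nontrivial rotation, n+1 vertices under the trivial one. So it is always [n+1] Nar that is
    compared with a number of periodic sequences.

    The correspondence with sequences is never written as a function. It is the relation [rooted],
    explicit only when the root is vertex 0 or n; rotation brings every root to one of these. It is
    single-valued because an injective renaming of vertices that carries the end maps of one path to
    those of another must be the identity.

    Coprimality makes the heights W 0, ..., W n distinct, which removes ties from the
    comparisons. *)

Lemma big_tupleS (V : nmodType) (T : finType) m (F : m.+1.-tuple T -> V) :
  (\sum_u F u = \sum_x \sum_(t : m.-tuple T) F (cons_tuple x t))%R.
Proof.
rewrite pair_big_dep (reindex (fun q : T * m.-tuple T => cons_tuple q.1 q.2)) //=.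
exists (fun u => (thead u, behead_tuple u)) => [[x t] _|u _].
  by congr (_, _); apply: val_inj.
by apply: val_inj; rewrite [in RHS](tuple_eta u).
Qed.

(** * The two ends of a label *)

Section Walk.

Implicit Types (W : nat -> int) (x k j n i : nat).

Definition is_alpha W x k :=
  [/\ k < x, (W k < W x)%R & forall y, k < y < x -> (W x <= W y)%R].

Definition is_beta W x j :=
  [/\ x <= j, (W j.+1 < W x)%R & forall y, x <= y <= j -> (W x <= W y)%R].

Lemma is_alpha_uniq W x k k' : is_alpha W x k -> is_alpha W x k' -> k = k'.
Proof.
move=> [kx Wk Hk] [kx' Wk' Hk'].
have := Hk k'; have := Hk' k; lia.
Qed.

Lemma is_beta_uniq W x j j' : is_beta W x j -> is_beta W x j' -> j = j'.
Proof.
move=> [kx Wk Hk] [kx' Wk' Hk'].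
have := Hk j'.+1; have := Hk' j.+1; lia.
Qed.

Fixpoint last_below W (c : int) k :=
  if k is k'.+1 then if (W k' < c)%R then k' else last_below W c k' else 0.

Definition alpha W x := last_below W (W x) x.

Definition beta W n x := x + find (fun j => W j.+1 < W x)%R (iota x (n.+1 - x)).

Definition dyck W n :=
  [/\ W 0 = 0%R, W n.+1 = 0%R & forall x, 0 < x <= n -> (0 < W x)%R].

Lemma alpha_spec W n x : dyck W n -> 0 < x <= n -> is_alpha W x (alpha W x).
Proof.
move=> [W0 _ Wp] Hx; rewrite /alpha.
have : (W 0%N < W x)%R by rewrite W0 Wp.
have : 0 < x by lia.
rewrite /is_alpha; move: (W x) => c x0 Hc.
suff S : forall k, 0 < k <= x -> (forall y, k <= y < x -> (c <= W y)%R) ->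
    [/\ last_below W c k < x, (W (last_below W c k) < c)%R &
     forall y, last_below W c k < y < x -> (c <= W y)%R].
  by apply: S; lia.
elim=> [|k IH] // Hk Hy /=; case: ltP => Wk; first by split => //; lia.
apply: IH; first by case: k Hk Hy Wk => [|k] Hk Hy Wk; lia.
by move=> y Hy'; have [->|?] := eqVneq y k; last by apply: Hy; lia.
Qed.

Lemma beta_le W n x : dyck W n -> 0 < x <= n -> beta W n x <= n.
Proof.
move=> [_ Wn Wp] Hx; rewrite /beta.
set p := (fun j => _); have: has p (iota x (n.+1 - x)).
  apply/hasP; exists n; first by rewrite mem_iota; lia.
  by rewrite /p Wn Wp.
by rewrite has_find size_iota; lia.
Qed.

Lemma beta_spec W n x : dyck W n -> 0 < x <= n -> is_beta W x (beta W n x).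
Proof.
move=> HW Hx; have := beta_le HW Hx; case: HW => [_ Wn Wp]; rewrite /beta.
set p := (fun j => _) => Hle; have Hp: has p (iota x (n.+1 - x)).
  apply/hasP; exists n; first by rewrite mem_iota; lia.
  by rewrite /p Wn Wp.
have Hsz : find p (iota x (n.+1 - x)) < n.+1 - x.
  by move: Hp; rewrite has_find size_iota.
split; first by lia.
  by have := nth_find 0 Hp; rewrite nth_iota.
move=> y Hy; have [->//|Hne] := eqVneq y x.
have /(before_find 0): y.-1 - x < find p (iota x (n.+1 - x)) by lia.
rewrite nth_iota; last by lia.
rewrite (_ : x + (y.-1 - x) = y.-1); last by lia.
by rewrite /p prednK; [case: ltP | lia].
Qed.

Lemma alpha_eq W n x k : dyck W n -> 0 < x <= n -> is_alpha W x k -> alpha W x = k.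
Proof. by move=> HW Hx; apply: is_alpha_uniq; apply: alpha_spec HW Hx. Qed.

Lemma beta_eq W n x k : dyck W n -> 0 < x <= n -> is_beta W x k -> beta W n x = k.
Proof. by move=> HW Hx; apply: is_beta_uniq; apply: beta_spec HW Hx. Qed.

Lemma alpha1 W n : dyck W n -> 0 < n -> alpha W 1 = 0.
Proof.
move=> HW n0; have [|H _ _] := @alpha_spec W n 1 HW; lia.
Qed.

Lemma beta_n W n : dyck W n -> 0 < n -> beta W n n = n.
Proof.
move=> HW n0; have Hn : 0 < n <= n by lia.
have [H _ _] := beta_spec HW Hn; have := beta_le HW Hn; lia.
Qed.

Lemma alpha_lt W n x : dyck W n -> 0 < x <= n -> alpha W x < x.
Proof. by move=> HW Hx; case: (alpha_spec HW Hx). Qed.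

Lemma beta_ge W n x : dyck W n -> 0 < x <= n -> x <= beta W n x.
Proof. by move=> HW Hx; case: (beta_spec HW Hx). Qed.

Lemma alpha_ascent W n k : dyck W n -> k < n -> (W k < W k.+1)%R -> alpha W k.+1 = k.
Proof. move=> HW kn Hk; apply: (alpha_eq HW) => //; split => //; lia. Qed.

Lemma beta_descent W n k : dyck W n -> 0 < k <= n -> (W k.+1 < W k)%R ->
  beta W n k = k.
Proof.
move=> HW kn Hk; apply: (beta_eq HW) => //; split => // y Hy.
by have -> : y = k by lia.
Qed.

(** Here [W (alpha W x) < W x <= W (alpha W x).+1]. Together with [alpha_ascent], the alpha-ends are
    exactly the ascents, which for the walk of a path are the P-rises; dually the beta-ends are the
    descents, the Q-rises. *)
Lemma alpha_is_ascent W n x : dyck W n -> 0 < x <= n ->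
  (W (alpha W x) < W (alpha W x).+1)%R.
Proof.
move=> HW Hx; have [H1 H2 H3] := alpha_spec HW Hx.
have [<-//|Hn] := eqVneq x (alpha W x).+1; apply: lt_le_trans H2 _; apply: H3; lia.
Qed.

Lemma beta_is_descent W n x : dyck W n -> 0 < x <= n ->
  (W (beta W n x).+1 < W (beta W n x))%R.
Proof.
move=> HW Hx; have [H1 H2 H3] := beta_spec HW Hx.
apply: lt_le_trans H2 _; apply: H3; lia.
Qed.

Lemma ascent_or_descent W n k : dyck W n -> k <= n -> (W k.+1 != W k)%R ->
  (k < n /\ (W k < W k.+1)%R) \/ (0 < k /\ (W k.+1 < W k)%R).
Proof.
move=> [W0 Wn Wp] kn; rewrite neq_lt => /orP[] H; [right|left]; split=> //.
  case: k kn H => // _; rewrite W0 => H.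
  by case: n Wn Wp => [|m] Wn Wp; [rewrite Wn in H|have := Wp 1; lia].
have [E|?] := eqVneq k n; last by lia.
rewrite E Wn in H; case: n W0 Wn Wp H {E kn} => [|m] W0 Wn Wp; first by rewrite W0.
have := Wp m.+1; lia.
Qed.

(** An ascent [k] is the alpha-end of label [k.+1], so [theta k] is the end of that label in [W']
    and [theta k <= k]. Conversely [theta k] is the end of label [(theta k).+1] in [W'], so by
    injectivity [k] is its end in [W], and [k <= theta k]. Descents are treated in the same way with
    beta. *)
Lemma alpha_beta_rigid W W' n (theta : nat -> nat) :
  dyck W n -> dyck W' n -> (forall k, k <= n -> W k.+1 != W k) ->
  (forall x y, x <= n -> y <= n -> theta x = theta y -> x = y) ->
  (forall x, 0 < x <= n -> alpha W' x = theta (alpha W x)) ->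
  (forall x, 0 < x <= n -> beta W' n x = theta (beta W n x)) ->
  forall k, k <= n -> theta k = k.
Proof.
move=> HW HW' Hne inj Ha Hb k kn.
have [[kn' Wk]|[k0 Wk]] := ascent_or_descent HW kn (Hne k kn).
  have Hk : 0 < k.+1 <= n by lia.
  have Ek := alpha_ascent HW kn' Wk.
  have Et : alpha W' k.+1 = theta k by rewrite Ha // Ek.
  have L1 := alpha_lt HW' Hk; rewrite Et in L1.
  have A := alpha_is_ascent HW' Hk; rewrite Et in A.
  have Ht : 0 < (theta k).+1 <= n by lia.
  have := alpha_ascent HW' (k := theta k) ltac:(lia) A; rewrite Ha // => /inj E.
  have L2 := alpha_lt HW Ht; have Ekk : alpha W (theta k).+1 = k by apply: E; lia.
  lia.
have Hk : 0 < k <= n by lia.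
have Ek := beta_descent HW Hk Wk.
have Et : beta W' n k = theta k by rewrite Hb // Ek.
have L1 := beta_ge HW' Hk; rewrite Et in L1.
have L1' := beta_le HW' Hk; rewrite Et in L1'.
have A := beta_is_descent HW' Hk; rewrite Et in A.
have Ht : 0 < (theta k) <= n by lia.
have := beta_descent HW' (k := theta k) ltac:(lia) A; rewrite Hb // => /inj E.
have L2 := beta_ge HW Ht; have L3 := beta_le HW Ht.
have Ekk : beta W n (theta k) = k by apply: E; lia.
lia.
Qed.

(* The image of vertex [k] under rotation, where [i] is the [alpha]-end of the
   last label [n]: since that label becomes the first one, its two ends [i] and
   [n] do not follow the rule [k |-> k.+1]. *)
Definition shift_vertex n i k :=
  if k == i then 0 else if k == n then i.+1 else k.+1.

Lemma shift_vertexS n i k : k != i -> k != n -> shift_vertex n i k = k.+1.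
Proof. by rewrite /shift_vertex => /negPf-> /negPf->. Qed.

(** * Rotation and the ends of labels *)

Section Rotation.

Variables (W W' : nat -> int) (n i : nat).
Hypothesis n0 : 0 < n.
Hypothesis HW : dyck W n.
Hypothesis Hi : is_alpha W n i.
Hypothesis W'0 : W' 0 = 0%R.
(** Run [i] goes to the front, run [n] takes its place, and the rest is delayed by one. Up to [i]
    the walk is raised by the step at [i]; beyond, the net change is the step
    [W n.+1 - W n = - W n]. *)
Hypothesis W'le : forall x, x <= i -> W' x.+1 = (W x + (W i.+1 - W i))%R.
Hypothesis W'gt : forall x, i < x <= n -> W' x.+1 = (W x - W n)%R.

Let Hin : i < n. Proof. by case: Hi. Qed.
Let Win : (W i < W n)%R. Proof. by case: Hi. Qed.
Let Wgt y : i < y <= n -> (W n <= W y)%R.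
Proof. case: Hi => _ _ H Hy; have [->//|?] := eqVneq y n; apply: H; lia. Qed.
Let Wi : (W i < W i.+1)%R.
Proof. have := Wgt (y := i.+1); have := Win; lia. Qed.
Let Wge0 y : y <= n -> (0 <= W y)%R.
Proof.
  case: HW => W0 _ Wp Hy.
  have [->|?] := eqVneq y 0; [by rewrite W0|apply: ltW; apply: Wp; lia].
Qed.
Hypothesis Wninj : forall y, y < n -> W y != W n.

Lemma rotation_dyck : dyck W' n.
Proof.
split=> //; first by rewrite W'gt ?subrr //; lia.
move=> [//|x] Hx; have Hx' : x <= n by lia.
have [xi|xi] := leqP x i.
  by rewrite W'le //; have := Wge0 Hx'; lia.
rewrite W'gt; last by lia.
have := Wgt (y := x) ltac:(lia); have := @Wninj x; lia.
Qed.

Let HW' := rotation_dyck.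

Lemma rotation_al_last : alpha W' 1 = shift_vertex n i (alpha W n).
Proof.
rewrite (alpha1 HW') // (alpha_eq HW _ Hi); last by lia.
by rewrite /shift_vertex eqxx.
Qed.

Lemma rotation_alpha x : 0 < x < n -> alpha W' x.+1 = shift_vertex n i (alpha W x).
Proof.
move=> Hx; apply: (alpha_eq HW'); first by lia.
have [] := @alpha_spec W n x HW; first by lia.
move: (alpha W x) => k kx Wk Hk.
have Wx : (W n < W x)%R \/ x <= i.
  have := Wgt (y := x); have := Wninj (y := x); lia.
have [xi|xi] := leqP x i.
  rewrite (shift_vertexS (k := k)); [|lia|lia].
  split; [lia|rewrite !W'le; lia|].
  move=> [//|y] Hy; rewrite !W'le; try lia.
  by have := Hk y; lia.
have [ki|ki] := ltnP i k.
  rewrite (shift_vertexS (k := k)); [|lia|lia].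
  split; [lia|rewrite !W'gt; lia|].
  move=> [//|y] Hy; rewrite !W'gt; try lia.
  by have := Hk y; lia.
(* [k < i] would give [W x <= W i < W n < W x]. *)
have Eki : k = i by have := Hk i; lia.
rewrite /shift_vertex Eki eqxx; split; [lia|rewrite W'0 W'gt; lia|].
move=> [//|y] Hy; rewrite (W'gt (x := x)); last by lia.
have [yi|yi] := leqP y i.
  rewrite W'le //; have := Wge0 (y := y); have := Hk i.+1.
  by have [->|?] := eqVneq x i.+1; lia.
rewrite W'gt; last by lia.
have := Hk y; lia.
Qed.

Lemma rotation_be_last : beta W' n 1 = shift_vertex n i (beta W n n).
Proof.
rewrite (beta_n HW) // /shift_vertex eqxx (_ : n == i = false); last by lia.
apply: (beta_eq HW'); first by lia.
split; [lia| rewrite W'gt ?W'le //; last by lia|].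
  by case: HW => -> _ _; lia.
move=> [//|y] Hy; rewrite !W'le //; try lia.
by have := Wge0 (y := y); case: HW => -> _ _; lia.
Qed.

Lemma rotation_beta x : 0 < x < n -> beta W' n x.+1 = shift_vertex n i (beta W n x).
Proof.
move=> Hx; apply: (beta_eq HW'); first by lia.
have [] := @beta_spec W n x HW; first by lia.
have := @beta_le W n x HW.
move: (beta W n x) => j jn kx Wk Hk.
have Wx : (W n < W x)%R \/ x <= i.
  have := Wgt (y := x); have := Wninj (y := x); lia.
have [xi|xi] := leqP x i; last first.
  have jn' : j < n by have := Hk n; lia.
  rewrite (shift_vertexS (k := j)); [|lia|lia].
  split; [lia|rewrite !W'gt; lia|].
  move=> [//|y] Hy; rewrite !W'gt; try lia.
  by have := Hk y; lia.
have [ji|ji] := ltnP j i.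
  rewrite (shift_vertexS (k := j)); [|lia|lia].
  split; [lia|rewrite !W'le; lia|].
  move=> [//|y] Hy; rewrite !W'le; try lia.
  by have := Hk y; lia.
have Wix : (W x <= W i)%R by apply: Hk; lia.
(* [j = i] contradicts the ascent at [i], and [i < j < n] gives
   [W n <= W j.+1 < W x <= W i < W n]. *)
have Ej : j = n.
  have [E|Hne] := eqVneq j i; first by move: Wk; rewrite E; lia.
  by have := Wgt (y := j.+1); lia.
rewrite /shift_vertex Ej eqxx ifF; last by lia.
have := Wge0 (y := x); split; [lia|rewrite W'gt ?W'le; lia|].
move=> [//|y] Hy; rewrite !W'le; try lia.
by have := Hk y; lia.
Qed.

End Rotation.

(** * Crossings between fibers of the end maps *)

Section Crossing.

Variables (W : nat -> int) (n : nat).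
Hypothesis HW : dyck W n.
Hypothesis Winj : forall x y, x <= n -> y <= n -> W x = W y -> x = y.

(** Common ends give [W y' <= W x' <= W y]. If the two ends differ, the larger one lies between the
    smaller one and a label attached to the smaller one, so it is too high to be an end itself. *)
Lemma alpha_noncrossing x y x' y' : 0 < x -> x < y -> y < x' -> x' < y' -> y' <= n ->
  alpha W x = alpha W x' -> alpha W y = alpha W y' -> alpha W x = alpha W y.
Proof.
move=> x0 xy yx xy' yn Ex Ey.
have [|a1 a2 a3] := @alpha_spec W n x HW; [lia|].
have [|b1 b2 b3] := @alpha_spec W n x' HW; [lia|].
have [|c1 c2 c3] := @alpha_spec W n y HW; [lia|].
have [|d1 d2 d3] := @alpha_spec W n y' HW; [lia|].
rewrite -Ex -Ey in b1 b2 b3 d1 d2 d3 *.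
have H1 : (W x' <= W y)%R by apply: b3; lia.
have H2 : (W y' <= W x')%R by apply: d3; lia.
case: (ltngtP (alpha W x) (alpha W y)) => // H.
  by have := b3 (alpha W y) ltac:(lia); lia.
by have := c3 (alpha W x) ltac:(lia); lia.
Qed.

Lemma beta_noncrossing x y x' y' : 0 < x -> x < y -> y < x' -> x' < y' -> y' <= n ->
  beta W n x = beta W n x' -> beta W n y = beta W n y' -> beta W n x = beta W n y.
Proof.
move=> x0 xy yx xy' yn Ex Ey.
have [|a1 a2 a3] := @beta_spec W n x HW; [lia|].
have [|b1 b2 b3] := @beta_spec W n x' HW; [lia|].
have [|c1 c2 c3] := @beta_spec W n y HW; [lia|].
have [|d1 d2 d3] := @beta_spec W n y' HW; [lia|].
rewrite -Ex -Ey in b1 b2 b3 d1 d2 d3 *.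
have H1 : (W x <= W y)%R by apply: a3; lia.
have H2 : (W y <= W x')%R by apply: c3; lia.
case: (ltngtP (beta W n x) (beta W n y)) => // H.
  by have := c3 (beta W n x).+1 ltac:(lia); lia.
by have := b3 (beta W n y).+1 ltac:(lia); lia.
Qed.

(** Around the circle, label [x] of alpha comes just before label [x] of beta; hence the first
    alternative admits [x = y] and [x' = y']. A crossing forces two distinct labels to the same
    height, or closes a strict cycle of inequalities. *)
Lemma alpha_be_noncrossing x x' y y' : 0 < x -> x < x' <= n -> 0 < y -> y < y' <= n ->
  (x <= y < x') && (x' <= y') || (y < x < y') && (y' < x') ->
  alpha W x = alpha W x' -> beta W n y = beta W n y' -> False.
Proof.
move=> x0 xx y0 yy C Ex Ey.
have [|a1 a2 a3] := @alpha_spec W n x HW; [lia|].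
have [|b1 b2 b3] := @alpha_spec W n x' HW; [lia|].
have [|c1 c2 c3] := @beta_spec W n y HW; [lia|].
have [|d1 d2 d3] := @beta_spec W n y' HW; [lia|].
rewrite -Ex -Ey in b1 b2 b3 d1 d2 d3 *.
case/orP: C => C.
  have H1 : (W x' <= W y)%R by apply: b3; lia.
  have H2 : (W y <= W x')%R by apply: c3; lia.
  by have := Winj (x := y) (y := x') ltac:(lia) ltac:(lia); lia.
have Hx : (W y <= W x)%R by apply: c3; lia.
have Hy' : (W x' <= W y')%R by apply: b3; lia.
have [q|q] := leqP x' (beta W n y).
  have H1 : (W y' <= W x')%R by apply: d3; lia.
  by have := Winj (x := y') (y := x') ltac:(lia) ltac:(lia); lia.
have Hq : (W x' <= W (beta W n y).+1)%R.
  by have [->//|?] := eqVneq x' (beta W n y).+1; apply: b3; lia.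
have [p|p] := leqP y (alpha W x); first by have := c3 (alpha W x) ltac:(lia); lia.
have H1 : (W x <= W y)%R by apply: a3; lia.
by have := Winj (x := y) (y := x) ltac:(lia) ltac:(lia); lia.
Qed.

End Crossing.

End Walk.

(** * Paths *)

Section Paths.

Variables a n : nat.
Hypotheses (a0 : 0 < a) (n0 : 0 < n) (cop : coprime a n.+1).

Implicit Types (D : vruns a n.+1) (x y k i j : nat).

Definition walk D x : int := ((n.+1 * height D x)%N%:Z - (a * x)%N%:Z)%R.

Lemma heightS D x : height D x.+1 = height D x + vrun D x.
Proof. by rewrite /height big_ord_recr. Qed.

Lemma walkS D x : walk D x.+1 = (walk D x + (n.+1 * vrun D x)%N%:Z - a%:Z)%R.
Proof. rewrite /walk heightS; lia. Qed.

Lemma walk0 D : walk D 0 = 0%R.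
Proof. by rewrite /walk /height big_ord0 !muln0. Qed.

Lemma walk_eqmod D x y : walk D x = walk D y -> a * x = a * y %[mod n.+1].
Proof.
rewrite /walk => E.
have {E} : n.+1 * height D x + a * y = n.+1 * height D y + a * x by lia.
move/(congr1 (modn^~ n.+1)); rewrite ![n.+1 * _]mulnC !modnMDl => E.
by rewrite E.
Qed.

(** Modulo [n.+1] the walk is [- a x], and [a] is invertible. *)
Lemma walk_inj D x y : x <= n -> y <= n -> walk D x = walk D y -> x = y.
Proof.
wlog xy: x y / x <= y => [H xn yn E|].
  by case/orP: (leq_total x y) => ?; [exact: H | symmetry; apply: H].
move=> xn yn /walk_eqmod /esym/eqP; rewrite eqn_mod_dvd ?leq_mul2l ?xy ?orbT //.
rewrite -mulnBr Gauss_dvdr; last by rewrite coprime_sym.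
have [/dvdn_leq H /H|] := ltnP 0 (y - x); lia.
Qed.

(** Equality would mean a run of length exactly a/b. So every run is a P-rise or a Q-rise, and every
    vertex an ascent or a descent. *)
Lemma walkS_neq D k : walk D k.+1 != walk D k.
Proof.
apply/eqP; rewrite walkS => E.
have {E} E : n.+1 * vrun D k = a by lia.
have : n.+1 %| gcdn a n.+1 by rewrite dvdn_gcd -{1}E dvdn_mulr /=.
by rewrite (eqP cop) dvdn1; lia.
Qed.

Lemma is_dyckP D : reflect (dyck (walk D) n) (is_dyck D).
Proof.
apply: (iffP andP) => [[/eqP hb /forallP H]|[_ Wn Wp]]; last first.
  split; first by move: Wn; rewrite /walk; nia.
  apply/forallP => -[i /= Hi].
  have [->|i0] := eqVneq i 0; first by rewrite muln0.
  have [E|?] := eqVneq i n.+1.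
    by move: Wn; rewrite E /walk; lia.
  by have := Wp i; rewrite /walk; lia.
split; first exact: walk0.
  by rewrite /walk hb; lia.
move=> x Hx; have /= := H (@Ordinal n.+2 x ltac:(lia)).
have : walk D x <> walk D 0%N by move/walk_inj; lia.
rewrite walk0 /walk; lia.
Qed.

(** * Lasers, and blocks as fibers of the end maps *)

Section Dyck.

Variable D : vruns a n.+1.
Hypothesis HD : dyck (walk D) n.

Local Notation W := (walk D).

Lemma lt_line i x (h : nat) :
  (laser_line D i x < h%:R)%R = (W i < (n.+1 * h)%N%:Z - (a * x)%N%:Z)%R.
Proof.
have b0 : (0 < n.+1%:R :> rat)%R by rewrite ltr0n.
rewrite /laser_line /slope /walk -(ltr_pM2l b0) -(ltr_int rat).
have -> : (n.+1%:R * ((height D i)%:R + a%:R / n.+1%:R * (x%:R - i%:R))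
  = n.+1%:R * (height D i)%:R + a%:R * (x%:R - i%:R) :> rat)%R.
  by field; rewrite lt0r_neq0 //; lra.
rewrite !intrB -!pmulrn !natrM; apply/idP/idP; lra.
Qed.

Lemma line_lt i x (h : nat) :
  (h%:R < laser_line D i x)%R = ((n.+1 * h)%N%:Z - (a * x)%N%:Z < W i)%R.
Proof.
have b0 : (0 < n.+1%:R :> rat)%R by rewrite ltr0n.
rewrite /laser_line /slope /walk -(ltr_pM2l b0) -(ltr_int rat).
have -> : (n.+1%:R * ((height D i)%:R + a%:R / n.+1%:R * (x%:R - i%:R))
  = n.+1%:R * (height D i)%:R + a%:R * (x%:R - i%:R) :> rat)%R.
  by field; rewrite lt0r_neq0 //; lra.
rewrite !intrB -!pmulrn !natrM; apply/idP/idP; lra.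
Qed.

Lemma ray_meetsE i j :
  ray_meets D i j = [&& i <= j, (W i < W j.+1 + a%:Z)%R & (W j.+1 < W i)%R].
Proof.
rewrite /ray_meets lt_line line_lt /walk.
by congr [&& _, _ & _]; congr (_ < _)%R; lia.
Qed.

Lemma laserP (i j : 'I_n.+1) :
  reflect [/\ 0 < i, 0 < vrun D i & j = beta W n i :> nat] (laser D i j).
Proof.
rewrite /laser; have [i0|i0] := posnP i.
  by rewrite /=; apply: ReflectF => -[].
rewrite /=; have Hi : 0 < i <= n by have := ltn_ord i; lia.
have [b1 b2 b3] := beta_spec HD Hi; have bn := beta_le HD Hi.
have Hmeet m : ray_meets D i m -> beta W n i <= m.
  rewrite ray_meetsE => /and3P[im _ Wm]; rewrite leqNgt; apply/negP => Hm.
  by have := b3 m.+1 ltac:(lia); lia.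
(* The west end of the east step must be strictly above the ray. If [beta W n i = i], this is the
   positivity of the run at [i]; otherwise [W i <= W (beta W n i)], strictly by injectivity. *)
have Hbe : 0 < vrun D i -> ray_meets D i (beta W n i).
  move=> v0; rewrite ray_meetsE b1 b2 andbT /=.
  have := walkS D (beta W n i).
  have := b3 (beta W n i) ltac:(lia).
  have := walk_inj (D := D) (x := i) (y := beta W n i).
  have [<-|ne] := eqVneq (i : nat) (beta W n i); nia.
apply: (iffP andP) => [[/andP[v0 Hm] /forallP Hf]|[_ v0 E]].
  split=> //; apply/eqP; rewrite eqn_leq Hmeet // andbT leqNgt; apply/negP => H.
  have /implyP := Hf (@Ordinal n.+1 (beta W n i) ltac:(lia)).
  by move=> /(_ H); rewrite Hbe.
rewrite v0 E Hbe //; split=> //; apply/forallP => m; apply/implyP => Hm.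
by apply: contraL Hm => /Hmeet; rewrite -leqNgt.
Qed.

Lemma above_laserP (k i : 'I_n.+1) :
  reflect [/\ 0 < k, k <= i <= beta W n k & (W k < W i)%R] (above_laser D k i).
Proof.
rewrite /above_laser lt_line -/(walk D i).
apply: (iffP andP) => [[/existsP[j /andP[/laserP[k0 v0 ->]]] Hi Wk]|[k0 Hi Wk]].
  by [].
split=> //; apply/existsP.
have Hk : 0 < k <= n by have := ltn_ord k; lia.
exists (@Ordinal n.+1 (beta W n k) (beta_le HD Hk)); rewrite /= Hi andbT.
apply/laserP; split=> //=.
have [b1 b2 b3] := beta_spec HD Hk.
have := b3 k.+1; rewrite walkS; have : k != i :> nat.
  by apply: contraTneq Wk => ->; rewrite ltxx.
lia.
Qed.

(** The criterion involves [i] only through [alpha W i], which is why labels with the same alpha-end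
    are not separated by any laser. *)
Lemma above_laser_alphaP (k i : 'I_n.+1) : 0 < i ->
  reflect (0 < k <= alpha W i /\ forall y, k <= y <= alpha W i -> (W k <= W y)%R)
    (above_laser D k i).
Proof.
move=> i0; have Hi : 0 < i <= n by have := ltn_ord i; lia.
have [a1 a2 a3] := alpha_spec HD Hi.
apply: (iffP (above_laserP _ _)) => [[k0 Hk Wk]|[Hk Hy]].
  have Hk' : 0 < k <= n by have := ltn_ord k; lia.
  have [b1 b2 b3] := beta_spec HD Hk'.
  split; last by move=> y Hy; apply: b3; lia.
  rewrite k0 leqNgt; apply/negP => H.
  have : k != i :> nat by apply: contraTneq Wk => ->; rewrite ltxx.
  by have := a3 k; lia.
have Hk' : 0 < k <= n by have := ltn_ord k; lia.
have [b1 b2 b3] := beta_spec HD Hk'.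
have Wk : (W k <= W (alpha W i))%R by apply: Hy; lia.
split; [lia| |lia].
apply/andP; split; first by lia.
rewrite leqNgt; apply/negP => H.
have [H'|H'] := leqP (beta W n k).+1 (alpha W i).
  by have := Hy (beta W n k).+1 ltac:(lia); lia.
by have [E|?] := eqVneq (beta W n k).+1 i; [rewrite E in b2|have := a3 (beta W n k).+1]; lia.
Qed.

Lemma P_relE (i j : 'I_n.+1) : 0 < i -> 0 < j -> P_rel D i j = (alpha W i == alpha W j).
Proof.
move=> i0 j0; apply/negP/eqP => [H|E].
  wlog lt : i j i0 j0 H / alpha W j < alpha W i => [Hw|].
    case: (ltngtP (alpha W i) (alpha W j)) => // L; last exact: Hw.
    symmetry; apply: Hw => // -[/existsP[k Hk]]; apply: H; apply/existsP; exists k.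
    by rewrite eq_sym.
  case: H; apply/existsP.
  have Hi : 0 < i <= n by have := ltn_ord i; lia.
  have L := alpha_lt HD Hi.
  (* The laser from label [alpha W i] passes below label [i], but not below label [j], because it
     starts after [alpha W j]. *)
  exists (@Ordinal n.+1 (alpha W i) ltac:(lia)).
  have -> : above_laser D (@Ordinal n.+1 (alpha W i) ltac:(lia)) i.
    apply/above_laser_alphaP => //=; split; first by lia.
    by move=> y Hy; have -> : y = alpha W i by lia.
  by apply/eqP => /esym H; have /= := elimT (above_laser_alphaP _ j0) H; lia.
case/existsP => k /eqP; apply.
by apply/(sameP (above_laser_alphaP _ i0)); rewrite E; apply: above_laser_alphaP.
Qed.

Lemma Q_step_beta (i j : 'I_n.+1) : Q_step D i j -> beta W n i = beta W n j.
Proof.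
have laser_beta (x y : 'I_n.+1) : laser D x y -> beta W n x = beta W n y.
  case/laserP => x0 v0 Ey.
  have Hx : 0 < x <= n by have := ltn_ord x; lia.
  have L := beta_ge HD Hx; rewrite -Ey; symmetry; apply: (beta_descent HD).
    by have := ltn_ord y; lia.
  by rewrite Ey beta_is_descent.
case/or3P => [/existsP[m /and3P[_ /laserP[_ _ <-] /laserP[_ _ <-]]]|/laser_beta|/laser_beta] //.
Qed.

Lemma Q_relE (i j : 'I_n.+1) : 0 < i -> 0 < j -> Q_rel D i j = (beta W n i == beta W n j).
Proof.
have Qsym : connect_sym (Q_step D).
  apply: sym_connect_sym => x y; rewrite /Q_step; congr (_ || _); last exact: orbC.
  by apply: eq_existsb => m; rewrite [laser D x m && _]andbC.
(* A label is joined by its laser to the label [beta W n x], or equals it when its run is empty. *)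
have Qbe (x : 'I_n.+1) (x0 : 0 < x) (Hb : beta W n x < n.+1) :
    connect (Q_step D) x (Ordinal Hb).
  have Hx : 0 < x <= n by have := ltn_ord x; lia.
  have [v0|v0] := posnP (vrun D x); last first.
    apply: connect1; apply/or3P/Or32; exact/laserP.
  suff -> : Ordinal Hb = x by [].
  apply: val_inj; rewrite /= beta_descent // walkS v0; lia.
move=> i0 j0; have Hi : 0 < i <= n by have := ltn_ord i; lia.
have Hj : 0 < j <= n by have := ltn_ord j; lia.
apply/idP/eqP => [/connectP[p]|E].
  elim: p i {i0 Hi} => [|k p IH] i /=; first by move=> _ ->.
  by case/andP => /Q_step_beta -> Hp Hl; apply: IH.
have L : beta W n i < n.+1 by have := beta_le HD Hi.
apply: (connect_trans (Qbe _ i0 L)); rewrite Qsym.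
have L' : beta W n j < n.+1 by rewrite -E.
suff -> : Ordinal L = Ordinal L' by exact: Qbe.
exact: val_inj.
Qed.

End Dyck.

Definition fiber (f : nat -> nat) k : {set 'I_n.+1} :=
  [set y in labels n.+1 | f y == k].

Definition fibers (f : nat -> nat) (v : nat -> 'I_a.+1) : labeled_partition a n.+1 :=
  [set (fiber f (f x), v (f x)) | x : 'I_n.+1 in labels n.+1].

Lemma in_labels (x : 'I_n.+1) : (x \in labels n.+1) = (0 < x).
Proof. by rewrite inE. Qed.

Lemma in_fiber f k (y : 'I_n.+1) : (y \in fiber f k) = (0 < y) && (f y == k).
Proof. by rewrite !inE. Qed.

Lemma bigmin_leq (T : eqType) (b : nat) (P : pred T) (F : T -> nat) (s : seq T) (j : T) :
  P j -> j \in s -> \big[minn/b]_(i <- s | P i) F i <= F j.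
Proof.
move=> Pj; elim: s => // i s IH; rewrite inE big_cons => /orP[/eqP<-|/IH H].
  by rewrite Pj geq_minl.
by case: ifP => // _; rewrite geq_min H orbT.
Qed.

(** The least label with alpha-end [k] is [k.+1]; hence the rank of a block of P is the run at its
    vertex. *)
Lemma min_fiber_alpha D x : dyck (walk D) n -> 0 < x <= n ->
  (min_label (fiber (alpha (walk D)) (alpha (walk D) x))).-1 = alpha (walk D) x.
Proof.
move=> HD Hx; set k := alpha _ _; have L := alpha_lt HD Hx; rewrite -/k in L.
suff -> : min_label (fiber (alpha (walk D)) k) = k.+1 by [].
have kn : k.+1 < n.+1 by lia.
have Hk : Ordinal kn \in fiber (alpha (walk D)) k.
  by rewrite in_fiber /= (alpha_ascent HD) ?eqxx //; apply: alpha_is_ascent HD Hx.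
apply/eqP; rewrite eqn_leq /min_label; apply/andP; split.
  apply: (@bigmin_leq _ _ _ (fun i : 'I_n.+1 => i : nat) _ (Ordinal kn)) => //.
  by rewrite mem_index_enum.
elim/big_ind: _ => [|u w Hu Hw|y]; [lia|lia|].
rewrite in_fiber => /andP[y0 /eqP <-]; apply: (alpha_lt HD); have := ltn_ord y; lia.
Qed.

(** The greatest label with beta-end [k] is [k] itself; hence the rank of a block of Q is the run at
    its vertex. *)
Lemma max_fiber_beta D x : dyck (walk D) n -> 0 < x <= n ->
  max_label (fiber (beta (walk D) n) (beta (walk D) n x)) = beta (walk D) n x.
Proof.
move=> HD Hx; set k := beta _ _ _; have L := beta_ge HD Hx; have L' := beta_le HD Hx.
rewrite -/k in L L'.
have Hk : @Ordinal n.+1 k L' \in fiber (beta (walk D) n) k.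
  by rewrite in_fiber /= (beta_descent HD) ?eqxx; [lia|lia|apply: beta_is_descent HD Hx].
apply/eqP; rewrite eqn_leq /max_label; apply/andP; split; last first.
  by rewrite (bigD1 _ Hk) /=; exact: leq_maxl.
apply/bigmax_leqP => y; rewrite in_fiber => /andP[y0 /eqP <-].
apply: (beta_ge HD); have := ltn_ord y; lia.
Qed.

Lemma pi_PE D : dyck (walk D) n -> pi_P D = fibers (alpha (walk D)) (vrun D).
Proof.
move=> HD; rewrite /pi_P /equivalence_partition -imset_comp.
apply: eq_in_imset => x; rewrite in_labels => x0 /=.
have -> : [set y in labels n.+1 | P_rel D x y] = fiber (alpha (walk D)) (alpha (walk D) x).
  apply/setP => y; rewrite in_fiber inE in_labels; case: posnP => //= y0.
  by rewrite P_relE // eq_sym.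
by rewrite min_fiber_alpha //; have := ltn_ord x; lia.
Qed.

Lemma pi_QE D : dyck (walk D) n -> pi_Q D = fibers (beta (walk D) n) (vrun D).
Proof.
move=> HD; rewrite /pi_Q /equivalence_partition -imset_comp.
apply: eq_in_imset => x; rewrite in_labels => x0 /=.
have -> : [set y in labels n.+1 | Q_rel D x y] = fiber (beta (walk D) n) (beta (walk D) n x).
  apply/setP => y; rewrite in_fiber inE in_labels; case: posnP => //= y0.
  by rewrite Q_relE // eq_sym.
by rewrite max_fiber_beta //; have := ltn_ord x; lia.
Qed.

Lemma vruns_eq D D' : (forall k, k <= n -> vrun D k = vrun D' k) -> D = D'.
Proof.
move=> H; apply: eq_from_tnth => i; rewrite !(tnth_nth ord0).
by apply: H; have := ltn_ord i; lia.
Qed.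

Lemma fibers_inj f f' v v' (x : 'I_n.+1) : 0 < x -> fibers f v = fibers f' v' ->
  fiber f (f x) = fiber f' (f' x) /\ v (f x) = v' (f' x).
Proof.
move=> x0 E; have : (fiber f (f x), v (f x)) \in fibers f' v'.
  by rewrite -E; apply: imset_f; rewrite in_labels.
case/imsetP => y; rewrite in_labels => y0 [Ef Ev].
have : x \in fiber f' (f' y) by rewrite -Ef in_fiber x0 /=.
by rewrite in_fiber => /andP[_ /eqP E']; rewrite Ef Ev E'.
Qed.

(** The run at an ascent [k] is the rank of the block of P containing [k.+1], and at a descent [k]
    that of the block of Q containing [k]. The extreme label of this block shows that it belongs to
    vertex [k] in both paths. *)
Lemma pi_inj : {in [pred D | is_dyck D] &, injective (@Defs.pi a n.+1)}.
Proof.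
move=> D D' /is_dyckP HD /is_dyckP HD' [].
rewrite !pi_PE // !pi_QE // => EP EQ.
apply: vruns_eq => k kn.
have [[kn' Wk]|[k0 Wk]] := ascent_or_descent HD kn (walkS_neq D k).
  have Hk : 0 < k.+1 <= n by lia.
  have [] := @fibers_inj _ _ _ _ (@Ordinal n.+1 k.+1 ltac:(lia)) isT EP => /=.
  move=> /(congr1 (@min_label _)) /(congr1 predn).
  by rewrite !min_fiber_alpha // => <-; rewrite (alpha_ascent HD kn').
have Hk : 0 < k <= n by lia.
have [] := @fibers_inj _ _ _ _ (@Ordinal n.+1 k ltac:(lia)) k0 EQ => /=.
move=> /(congr1 (@max_label _)).
by rewrite !max_fiber_beta // => <-; rewrite beta_descent.
Qed.

Lemma val_rotate (x : 'I_n.+1) : rotate_label x = (if x < n then x.+1 else 1) :> nat.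
Proof.
rewrite /rotate_label val_insubd !(ltnS x.+1 n).
by case: (ltnP x n) => H; rewrite ltnS ?H ?n0.
Qed.

Definition unrotate (x : 'I_n.+1) : 'I_n.+1 := inord (if x == 1 :> nat then n else x.-1).

Lemma unrotate_gt0 (x : 'I_n.+1) : 0 < x -> 0 < unrotate x.
Proof. by move=> x0; have Hx := ltn_ord x; rewrite /unrotate inordK; case: eqP => /= ?; lia. Qed.

Lemma unrotateK (x : 'I_n.+1) : 0 < x -> rotate_label (unrotate x) = x.
Proof.
move=> x0; apply: val_inj; have Hx := ltn_ord x; rewrite /= val_rotate /unrotate.
have [E|E] := eqVneq (x : nat) 1; rewrite inordK; try lia; first by rewrite ltnn.
by rewrite ifT; lia.
Qed.

Lemma rotate_gt0 (x : 'I_n.+1) : 0 < rotate_label x.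
Proof. by rewrite val_rotate; case: ifP. Qed.

Lemma rotate_fibers (f f' s : nat -> nat) (v v' : nat -> 'I_a.+1) :
  (forall x y, 0 < x <= n -> 0 < y <= n -> s (f x) = s (f y) -> f x = f y) ->
  (forall x, 0 < x <= n -> v' (s (f x)) = v (f x)) ->
  (forall x : 'I_n.+1, 0 < x -> f' (rotate_label x) = s (f x)) ->
  rotate_partition (fibers f v) = fibers f' v'.
Proof.
move=> sinj sv sf.
have lab (x : 'I_n.+1) : 0 < x -> 0 < x <= n by have := ltn_ord x; lia.
rewrite /rotate_partition /fibers -imset_comp.
have E : labels n.+1 = [set rotate_label x | x in labels n.+1].
  apply/setP => x; rewrite in_labels; apply/idP/imsetP => [x0|[y _ ->]].
    by exists (unrotate x); rewrite ?unrotateK // in_labels unrotate_gt0.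
  exact: rotate_gt0.
rewrite [in RHS]E -[RHS]imset_comp; apply: eq_in_imset => x; rewrite in_labels => x0 /=.
rewrite sf // sv ?lab //; congr (_, _); apply/setP => y; rewrite in_fiber.
apply/imsetP/andP => [[z]|[y0 /eqP Ey]].
  by rewrite in_fiber => /andP[z0 /eqP Ez] ->; rewrite rotate_gt0 sf // Ez.
exists (unrotate y); last by rewrite unrotateK.
rewrite in_fiber unrotate_gt0 //=; apply/eqP/sinj; rewrite ?lab ?unrotate_gt0 //.
by rewrite -sf ?unrotateK ?unrotate_gt0.
Qed.

Lemma fibersE (f : nat -> nat) (v : nat -> 'I_a.+1) (K : {set 'I_n.+1}) :
  (forall x : 'I_n.+1, 0 < x -> exists2 k : 'I_n.+1, k \in K & f x = k) ->
  (forall k : 'I_n.+1, k \in K -> exists2 x : 'I_n.+1, 0 < x & f x = k) ->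
  fibers f v = [set (fiber f k, v k) | k : 'I_n.+1 in K]
  /\ {in K &, injective (fun k : 'I_n.+1 => (fiber f k, v k))}.
Proof.
move=> fK Kf; split.
  apply/setP => Br; apply/imsetP/imsetP => [[x]|[k kK ->]].
    rewrite in_labels => /fK[k kK Ek] ->; exists k => //; by rewrite Ek.
  by have [x x0 Ex] := Kf k kK; exists x; rewrite ?in_labels // Ex.
move=> k k' kK kK' [E _]; have [x x0 Ex] := Kf k kK.
have : x \in fiber f k' by rewrite -E in_fiber x0 Ex /=.
by rewrite in_fiber Ex => /andP[_ /eqP/val_inj].
Qed.

(** Blocks of P correspond to ascents, whose runs are positive; blocks of Q to descents, of which
    those with an empty run are the trivial ones. *)
Lemma num_blocks_pi D : dyck (walk D) n ->
  num_blocks (Defs.pi D) = #|[set k : 'I_n.+1 | 0 < vrun D k]|.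
Proof.
move=> HD; rewrite /num_blocks /= pi_PE // pi_QE //.
set A := [set k : 'I_n.+1 | (walk D k < walk D k.+1)%R].
set B := [set k : 'I_n.+1 | (walk D k.+1 < walk D k)%R].
have lab (x : 'I_n.+1) : 0 < x -> 0 < x <= n by have := ltn_ord x; lia.
have dich (k : 'I_n.+1) := ascent_or_descent HD (leq_ord k) (walkS_neq D k).
have [||-> injA] := @fibersE (alpha (walk D)) (vrun D) A.
- move=> x /lab Hx; have L := alpha_lt HD Hx.
  exists (@Ordinal n.+1 (alpha (walk D) x) ltac:(lia)) => //.
  by rewrite inE /= (alpha_is_ascent HD).
- move=> k; rewrite inE => Hk; have [[kn _]|[_ ?]] := dich k; last by lia.
  by exists (@Ordinal n.+1 k.+1 kn) => //=; rewrite (alpha_ascent HD).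
have [||-> injB] := @fibersE (beta (walk D) n) (vrun D) B.
- move=> x /lab Hx; have L := beta_le HD Hx.
  exists (@Ordinal n.+1 (beta (walk D) n x) L) => //.
  by rewrite inE /= (beta_is_descent HD).
- move=> k; rewrite inE => Hk; have [[_ ?]|[k1 _]] := dich k; first by lia.
  by exists k => //=; rewrite (beta_descent HD) //; exact: lab.
rewrite card_in_imset //.
have -> : [set Br in [set (fiber (beta (walk D) n) k, vrun D k) | k : 'I_n.+1 in B] | 0 < Br.2]
  = [set (fiber (beta (walk D) n) k, vrun D k) | k : 'I_n.+1 in [set k in B | 0 < vrun D k]].
  apply/setP => Br; rewrite inE; apply/andP/imsetP => [[/imsetP[k kB ->] /= v0]|[k]].
    by exists k => //; rewrite inE kB v0.
  by rewrite inE => /andP[kB v0] ->; split => //; apply: imset_f.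
rewrite card_in_imset => [|k k']; last first.
  by rewrite !inE => /andP[kB _] /andP[kB' _]; apply: injB; rewrite inE.
rewrite -cardsUI [X in _ + X](_ : _ = 0) ?addn0.
  apply: eq_card => k; rewrite !inE; have := walkS D k.
  by have := walkS_neq D k; case: posnP; lia.
by apply: eq_card0 => k; rewrite !inE; lia.
Qed.

Definition rho D : vruns a n.+1 :=
  let i := alpha (walk D) n in
  [tuple vrun D (if j == 0 :> nat then i else if j == i.+1 :> nat then n else j.-1) | j < n.+1].

Lemma vrun_rho D k : k <= n ->
  vrun (rho D) k =
    vrun D (if k == 0 then alpha (walk D) n else if k == (alpha (walk D) n).+1 then n else k.-1).
Proof.
by move=> kn; rewrite {1}/vrun (nth_mktuple _ _ (@Ordinal n.+1 k kn)).
Qed.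

Section RhoDyck.

Variable D : vruns a n.+1.
Hypothesis HD : dyck (walk D) n.

Let i := alpha (walk D) n.

Let Hi : is_alpha (walk D) n i.
Proof. by apply: (alpha_spec HD); lia. Qed.

Let Hin : i < n. Proof. by case: Hi. Qed.

Lemma height_rho_le x : x <= i -> height (rho D) x.+1 = height D x + vrun D i.
Proof.
elim: x => [|x IH] xi; first by rewrite heightS vrun_rho // /height !big_ord0.
rewrite heightS IH; last by lia.
rewrite vrun_rho ?heightS /=; last by lia.
by rewrite ifF -/i /=; lia.
Qed.

Lemma height_rho_gt x : i < x <= n -> height (rho D) x.+1 = height D x + vrun D n.
Proof.
elim: x => [|x IH] // Hx; rewrite heightS vrun_rho /= -/i; last by lia.
have [E|ne] := eqVneq x.+1 i.+1.
  by rewrite height_rho_le; last lia; case: E => ->; rewrite heightS.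
by rewrite IH ?heightS; lia.
Qed.

Lemma walk_rho_le x : x <= i ->
  walk (rho D) x.+1 = (walk D x + (walk D i.+1 - walk D i))%R.
Proof. move=> xi; have := walkS D i; have := height_rho_le xi; rewrite /walk; lia. Qed.

Lemma walk_rho_gt x : i < x <= n ->
  walk (rho D) x.+1 = (walk D x - walk D n)%R.
Proof.
move=> xi; have := walkS D n; have := height_rho_gt xi; case: HD => _ -> _.
rewrite /walk; lia.
Qed.

Let Wninj y : y < n -> walk D y != walk D n.
Proof.
move=> yn; apply/eqP => /walk_inj; lia.
Qed.

Lemma rho_dyck : dyck (walk (rho D)) n.
Proof.
exact: (rotation_dyck n0 HD Hi (walk0 _) walk_rho_le walk_rho_gt Wninj).
Qed.

Definition sigma k := shift_vertex n (alpha (walk D) n) k.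

Lemma sigma_le k : k <= n -> sigma k <= n.
Proof. by rewrite /sigma /shift_vertex -/i; case: eqP => // _; case: eqP => //; lia. Qed.

Lemma sigma_inj k k' : k <= n -> k' <= n -> sigma k = sigma k' -> k = k'.
Proof.
rewrite /sigma /shift_vertex -/i => ? ?; case: (eqVneq k i) => ?; case: (eqVneq k' i) => ?;
  case: (eqVneq k n) => ?; case: (eqVneq k' n) => ? /=; lia.
Qed.

Lemma vrun_sigma k : k <= n -> vrun (rho D) (sigma k) = vrun D k.
Proof.
move=> kn; rewrite vrun_rho ?sigma_le // /sigma /shift_vertex -/i.
have [->|ki] //= := eqVneq k i; have [->|kn'] /= := eqVneq k n; first by rewrite eqxx.
by rewrite eqSS (negPf ki).
Qed.

Lemma alpha_rho (x : 'I_n.+1) : 0 < x ->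
  alpha (walk (rho D)) (rotate_label x) = sigma (alpha (walk D) x).
Proof.
move=> x0; rewrite val_rotate; case: ltnP => xn.
  by apply: (rotation_alpha n0 HD Hi (walk0 _) walk_rho_le walk_rho_gt Wninj); lia.
have -> : x = n :> nat by have := ltn_ord x; lia.
exact: (rotation_al_last n0 HD Hi (walk0 _) walk_rho_le walk_rho_gt Wninj).
Qed.

Lemma beta_rho (x : 'I_n.+1) : 0 < x ->
  beta (walk (rho D)) n (rotate_label x) = sigma (beta (walk D) n x).
Proof.
move=> x0; rewrite val_rotate; case: ltnP => xn.
  by apply: (rotation_beta n0 HD Hi (walk0 _) walk_rho_le walk_rho_gt Wninj); lia.
have -> : x = n :> nat by have := ltn_ord x; lia.
exact: (rotation_be_last n0 HD Hi (walk0 _) walk_rho_le walk_rho_gt Wninj).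
Qed.

Lemma pi_rho : Defs.pi (rho D) = rotate_pair (Defs.pi D).
Proof.
have HD' := rho_dyck.
rewrite /Defs.pi /rotate_pair /= !pi_PE // !pi_QE //; congr (_, _); symmetry.
  apply: (rotate_fibers (s := sigma)) => [x y Hx Hy|x Hx|]; last exact: alpha_rho.
    by apply: sigma_inj; [have := alpha_lt HD Hx|have := alpha_lt HD Hy]; lia.
  by apply: vrun_sigma; have := alpha_lt HD Hx; lia.
apply: (rotate_fibers (s := sigma)) => [x y Hx Hy|x Hx|]; last exact: beta_rho.
  by apply: sigma_inj; apply: (beta_le HD).
by apply: vrun_sigma; apply: (beta_le HD).
Qed.

End RhoDyck.

End Paths.

(** * Paths with a marked vertex and cyclic sequences *)

Section Rooted.

Variables a n : nat.
Hypotheses (a0 : 0 < a) (n0 : 0 < n) (cop : coprime a n.+1).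

Implicit Types (D : vruns a n.+1) (x y k i j : nat) (z : nat -> nat).

Definition pwalk z x : int := ((n.+1 * \sum_(m < x) z m)%N%:Z - (a * x)%N%:Z)%R.

Lemma pwalkS z x : pwalk z x.+1 = (pwalk z x + (n.+1 * z x)%N%:Z - a%:Z)%R.
Proof. rewrite /pwalk big_ord_recr /=; lia. Qed.

(* For a periodic sequence the walk drifts, and looking one period back (or
   ahead) is enough to decide whether a label has an end other than the root. *)
Definition win_alpha (E : nat -> int) x k := x <= k + n /\ is_alpha E x k.
Definition win_beta (E : nat -> int) x j := j < x + n /\ is_beta E x j.
Definition no_alpha (E : nat -> int) x := forall k, k < x <= k + n -> (E x <= E k)%R.
Definition no_beta (E : nat -> int) x := forall j, x <= j < x + n -> (E x <= E j.+1)%R.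

Lemma win_alpha_or E x : 0 < x -> (exists k, win_alpha E x k) \/ no_alpha E x.
Proof.
move=> x0; rewrite /no_alpha; set c := E x.
have {x0} : forall m, m <= x ->
    (exists k, [/\ k + m >= x, k < x, (E k < c)%R & forall y, k < y < x -> (c <= E y)%R])
    \/ forall k, k < x <= k + m -> (c <= E k)%R.
  elim=> [|m IH] mx; first by right => k; lia.
  have [[k [h1 h2 h3 h4]]|H] := IH ltac:(lia); first by left; exists k; split=> //; lia.
  have [Hc|Hc] := ltrP (E (x - m.+1)) c.
    left; exists (x - m.+1); split=> //; try lia.
    by move=> y Hy; apply: H; lia.
  by right=> k Hk; have [->//|?] := eqVneq k (x - m.+1); apply: H; lia.
move=> H; have [nx|xn] := leqP n x; have := H (minn n x) (geq_minr _ _).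
  rewrite (minn_idPl nx) => -[[k [h1 h2 h3 h4]]|H']; [left; exists k|by right].
  by split=> //; lia.
rewrite (minn_idPr (ltnW xn)) => -[[k [h1 h2 h3 h4]]|H']; [left; exists k|right => k Hk].
  by split=> //; lia.
by apply: H'; lia.
Qed.

Lemma win_beta_or E x : (exists k, win_beta E x k) \/ no_beta E x.
Proof.
rewrite /no_beta; set c := E x.
have H m : (exists k, [/\ x <= k < x + m, (E k.+1 < c)%R & forall y, x <= y <= k -> (c <= E y)%R])
    \/ forall k, x <= k < x + m -> (c <= E k.+1)%R.
  elim: m => [|m IH]; first by right => k; lia.
  have [[k [h1 h2 h3]]|H] := IH; first by left; exists k; split=> //; lia.
  have [Hc|Hc] := ltrP (E (x + m).+1) c.
    left; exists (x + m); split=> //; try lia.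
    move=> y Hy; have [->|?] := eqVneq y x; first exact: lexx.
    by have := H y.-1; rewrite prednK; lia.
  by right=> k Hk; have [->//|?] := eqVneq k (x + m); apply: H; lia.
have [[k [h1 h2 h3]]|H'] := H n; [left; exists k|by right].
by split; [lia|split=> //; lia].
Qed.

Section Shift.

Variables (E E' : nat -> int) (s : nat) (c : int).
Hypothesis shift : forall x, E' x = (E (x + s)%N - c)%R.

Lemma win_alpha_shift x k : win_alpha E' x k -> win_alpha E (x + s) (k + s).
Proof.
case=> xk [kx Ek H]; split; [lia|split; [lia|by move: Ek; rewrite !shift; lia|]].
move=> y Hy; have := H (y - s); rewrite !shift subnK; lia.
Qed.

(** The bound [n <= x] keeps the window of length [n] before [x] among the natural numbers;
    otherwise it would be truncated at 0 on one side only. *)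
Lemma no_alpha_shift x : n <= x -> no_alpha E' x <-> no_alpha E (x + s).
Proof.
move=> nx; split=> H k Hk.
  by have := H (k - s); rewrite !shift subnK; lia.
by have := H (k + s); rewrite !shift; lia.
Qed.

Lemma win_beta_shift x j : win_beta E' x j -> win_beta E (x + s) (j + s).
Proof.
case=> xk [kx Ek H]; split; [lia|split; [lia|by move: Ek; rewrite !shift addSn; lia|]].
move=> y Hy; have := H (y - s); rewrite !shift subnK; lia.
Qed.

Lemma no_beta_shift x : no_beta E' x <-> no_beta E (x + s).
Proof.
split=> H k Hk.
  by have := H (k - s); rewrite !shift addSn subnK; lia.
by have := H (k + s); rewrite !shift addSn; lia.
Qed.

End Shift.

(** The representative of [x] modulo [n] in 1..n; adding [n.-1] replaces a truncated subtraction of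
    1. *)
Definition lab x := ((x + n.-1) %% n).+1.

Lemma lab_bound x : 0 < lab x <= n.
Proof. by rewrite /lab /= ltn_pmod. Qed.

Lemma labD x : lab (x + n) = lab x.
Proof. by rewrite /lab -addnA [n + _]addnC addnA modnDr. Qed.

Lemma labMD x q : lab (x + q * n) = lab x.
Proof. by rewrite /lab addnAC addnC modnMDl. Qed.

Lemma lab_id x : 0 < x <= n -> lab x = x.
Proof.
move=> Hx; rewrite /lab (_ : x + n.-1 = x.-1 + n); last by lia.
rewrite modnDr modn_small; lia.
Qed.

Lemma labP x : exists q, x + n = q * n + lab x.
Proof.
exists ((x + n.-1) %/ n); rewrite /lab.
have := divn_eq (x + n.-1) n; lia.
Qed.

(* [z] lists the ranks of the vertices other than the root [p], in the cyclic
   order of the labels; [tau] sends the indices of [z] to the vertices of [D]. *)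
Record rooted z D p (tau : nat -> nat) : Prop := Rooted {
  tau_per : forall k, tau (k + n) = tau k;
  tau_le : forall k, tau k <= n;
  tau_root : forall k, tau k != p;
  tau_inj : forall k k', tau k = tau k' -> k = k' %[mod n];
  root_le : p <= n;
  rooted_dyck : dyck (walk D) n;
  vrun_tau : forall k, vrun D (tau k) = z k :> nat;
  vrun_root : vrun D p + \sum_(m < n) z m = a;
  alpha_tau : forall x k, n < x -> win_alpha (pwalk z) x k -> alpha (walk D) (lab x) = tau k;
  alpha_root : forall x, n < x -> no_alpha (pwalk z) x -> alpha (walk D) (lab x) = p;
  beta_tau : forall x k, n < x -> win_beta (pwalk z) x k -> beta (walk D) n (lab x) = tau k;
  beta_root : forall x, n < x -> no_beta (pwalk z) x -> beta (walk D) n (lab x) = p }.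

Lemma rooted_per z D p tau : rooted z D p tau -> forall k, z (k + n) = z k.
Proof. by move=> H k; rewrite -!(vrun_tau H) (tau_per H). Qed.

Lemma tau_mod z D p tau : rooted z D p tau ->
  forall k k', k = k' %[mod n] -> tau k = tau k'.
Proof.
move=> H k k' E; have T q u : tau (q * n + u) = tau u.
  by elim: q => // q IH; rewrite mulSn -addnA addnC (tau_per H).
by rewrite (divn_eq k n) (divn_eq k' n) !T E.
Qed.

Lemma rooted_label z D p tau x : rooted z D p tau -> 0 < x <= n ->
  ((exists2 k, win_alpha (pwalk z) (x + n) k & alpha (walk D) x = tau k) \/
    no_alpha (pwalk z) (x + n) /\ alpha (walk D) x = p) /\
  ((exists2 k, win_beta (pwalk z) (x + n) k & beta (walk D) n x = tau k) \/
    no_beta (pwalk z) (x + n) /\ beta (walk D) n x = p).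
Proof.
move=> H Hx; have nx : n < x + n by lia.
have L : lab (x + n) = x by rewrite labD lab_id.
split.
  have [|[k Hk]|Hk] := @win_alpha_or (pwalk z) (x + n); first by lia.
    by left; exists k => //; rewrite -(alpha_tau H nx Hk) L.
  by right; rewrite -{2}L (alpha_root H nx Hk).
have [[k Hk]|Hk] := @win_beta_or (pwalk z) (x + n).
  by left; exists k => //; rewrite -(beta_tau H nx Hk) L.
by right; rewrite -{2}L (beta_root H nx Hk).
Qed.

(** Every vertex is an end of some label, and such an end is the root or a value of [tau]. *)
Lemma tau_surj z D p tau y : rooted z D p tau -> y <= n -> y != p ->
  exists2 k, k < n & tau k = y.
Proof.
move=> H yn yp.
suff [k Ek] : exists k, tau k = y.
  exists (k %% n); first by rewrite ltn_pmod.
  by rewrite -Ek; apply: (tau_mod H); rewrite modn_mod.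
have HD := rooted_dyck H.
have [[yn' Wy]|[y0 Wy]] := ascent_or_descent HD yn (walkS_neq a0 n0 cop D y).
  have [+ _] := rooted_label H (x := y.+1) ltac:(lia).
  by rewrite (alpha_ascent HD yn' Wy) => -[[k _ ->]|[_ E]]; [exists k|rewrite E eqxx in yp].
have [_] := rooted_label H (x := y) ltac:(lia).
rewrite (beta_descent HD _ Wy); last by lia.
by case=> [[k _ ->]|[_ E]]; [exists k|rewrite E eqxx in yp].
Qed.

(** The map [theta], sending [p] to [p'] and [tau k] to [tau' k], intertwines the end maps of [D]
    and [D'], because [z] alone decides the end of each label. By [alpha_beta_rigid] it is the
    identity, and the runs then agree vertex by vertex. *)
Lemma rooted_functional z D D' p p' tau tau' :
  rooted z D p tau -> rooted z D' p' tau' -> D = D' /\ p = p'.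
Proof.
move=> H H'.
pose theta y := if y == p then p' else tau' (find (fun m => tau m == y) (iota 0 n)).
have theta_tau k : theta (tau k) = tau' k.
  rewrite /theta (negPf (tau_root H k)); apply: (tau_mod H').
  set P := (fun m => _); have Hk : tau (k %% n) = tau k by apply: (tau_mod H); rewrite modn_mod.
  have hP : has P (iota 0 n).
    by apply/hasP; exists (k %% n); rewrite ?mem_iota /= ?ltn_pmod // /P Hk.
  have := nth_find 0 hP; move: hP; rewrite has_find size_iota => L.
  by rewrite nth_iota // add0n => /eqP /(tau_inj H).
have theta_p : theta p = p' by rewrite /theta eqxx.
have Id : forall y, y <= n -> theta y = y.
  apply: (alpha_beta_rigid (rooted_dyck H) (rooted_dyck H')).
  - by move=> k _; apply: walkS_neq.
  - move=> x y xn yn.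
    have [->|xp] := eqVneq x p; have [->|yp] := eqVneq y p => //.
    + have [k _ <-] := tau_surj H yn yp; rewrite theta_p theta_tau => E.
      by have := tau_root H' k; rewrite E eqxx.
    + have [k _ <-] := tau_surj H xn xp; rewrite theta_p theta_tau => E.
      by have := tau_root H' k; rewrite E eqxx.
    have [k _ <-] := tau_surj H xn xp; have [k' _ <-] := tau_surj H yn yp.
    by rewrite !theta_tau => /(tau_inj H')/(tau_mod H).
  - move=> x Hx; have nx : n < x + n by lia.
    have L : lab (x + n) = x by rewrite labD lab_id.
    have [[[k Hk ->]|[Hk ->]] _] := rooted_label H Hx.
      by rewrite theta_tau -{1}L (alpha_tau H' nx Hk).
    by rewrite theta_p -{1}L (alpha_root H' nx Hk).
  move=> x Hx; have nx : n < x + n by lia.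
  have L : lab (x + n) = x by rewrite labD lab_id.
  have [_ [[k Hk ->]|[Hk ->]]] := rooted_label H Hx.
    by rewrite theta_tau -{1}L (beta_tau H' nx Hk).
  by rewrite theta_p -{1}L (beta_root H' nx Hk).
have Ep : p = p' by rewrite -theta_p Id ?(root_le H).
split=> //; apply: (vruns_eq a0 n0 cop) => y yn; apply: val_inj => /=.
have [->|yp] := eqVneq y p.
  have := vrun_root H; have := vrun_root H'; rewrite -Ep; lia.
have [k _ Ek] := tau_surj H yn yp.
by rewrite -{2}(Id y yn) -Ek theta_tau (vrun_tau H) (vrun_tau H').
Qed.

(** On an [n]-periodic sequence the index [x + n.-1] stands for [x - 1]. *)
Definition rotseq z x := z (x + n.-1).

Lemma pwalkD z x s :
  pwalk z (x + s) = (pwalk (fun y => z (y + s)%N) x + pwalk z s)%R.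
Proof.
elim: x => [|x IH]; first by rewrite add0n {2}/pwalk big_ord0 !muln0 subrr add0r.
by rewrite addSn !pwalkS IH; ring.
Qed.

Lemma pwalk_rotseq z x : pwalk (rotseq z) x = (pwalk z (x + n.-1)%N - pwalk z n.-1)%R.
Proof. by rewrite pwalkD addrK. Qed.

Definition rotn x := if x < n then x.+1 else 1.

Lemma lab_rotn x : lab x = rotn (lab (x + n.-1)).
Proof.
rewrite /rotn; have [q Hq] := labP x; have [q' Hq'] := labP (x + n.-1).
have B := lab_bound x; have B' := lab_bound (x + n.-1).
have E : q.+1 * n + lab x = q' * n + (lab (x + n.-1)).+1 by lia.
move: (lab x) (lab (x + n.-1)) B B' E => l l' B B' E {Hq Hq'}.
case: (ltngtP q.+1 q') => C.
- have := leq_mul C (leqnn n); rewrite mulSn; case: ltnP; lia.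
- have := leq_mul C (leqnn n); rewrite (mulSn q'); case: ltnP; lia.
by rewrite -C in E; case: ltnP; lia.
Qed.

Lemma alpha_rhon D x : dyck (walk D) n -> 0 < x <= n ->
  alpha (walk (rho D)) (rotn x) = sigma D (alpha (walk D) x).
Proof.
move=> HD Hx; have := @alpha_rho a n a0 n0 cop D HD (@Ordinal n.+1 x ltac:(lia)).
by rewrite val_rotate //=; apply; lia.
Qed.

Lemma beta_rhon D x : dyck (walk D) n -> 0 < x <= n ->
  beta (walk (rho D)) n (rotn x) = sigma D (beta (walk D) n x).
Proof.
move=> HD Hx; have := @beta_rho a n a0 n0 cop D HD (@Ordinal n.+1 x ltac:(lia)).
by rewrite val_rotate //=; apply; lia.
Qed.

Lemma sum_per z s : (forall k, z (k + n) = z k) ->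
  \sum_(m < n) z (m + s) = \sum_(m < n) z m.
Proof.
move=> per; elim: s => [|s IH]; first by apply: eq_bigr => m _; rewrite addn0.
rewrite -IH; case: n n0 per => // n' _ per.
rewrite big_ord_recr [RHS]big_ord_recl /= addnC; congr (_ + _).
  by rewrite -[RHS]per /=; congr z; lia.
by apply: eq_bigr => m _; congr z; rewrite /bump /=; lia.
Qed.

Lemma rooted_rotseq z D p tau : rooted z D p tau ->
  rooted (rotseq z) (rho D) (sigma D p) (fun k => sigma D (tau (k + n.-1))).
Proof.
move=> H; have HD := rooted_dyck H; have per := rooted_per H.
have nl x : n < x -> n < x + n.-1 by lia.
split.
- by move=> k; rewrite addnAC (tau_per H).
- by move=> k; apply: (sigma_le a0 n0 cop HD); rewrite ?(tau_le H).
- move=> k; apply/eqP => /(sigma_inj a0 n0 cop HD (tau_le H _) (root_le H)) E.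
  by have := tau_root H (k + n.-1); rewrite E eqxx.
- move=> k k' /(sigma_inj a0 n0 cop HD (tau_le H _) (tau_le H _)) /(tau_inj H)/eqP.
  by rewrite eqn_modDr => /eqP.
- by apply: (sigma_le a0 n0 cop HD); rewrite ?(root_le H).
- exact: (rho_dyck a0 n0 cop HD).
- by move=> k; rewrite (vrun_sigma a0 n0 cop HD) ?(tau_le H) // (vrun_tau H).
- by rewrite (vrun_sigma a0 n0 cop HD) ?(root_le H) // sum_per // (vrun_root H).
- move=> x k xn /(win_alpha_shift (pwalk_rotseq z)) Hk.
  by rewrite lab_rotn alpha_rhon ?lab_bound // (alpha_tau H (nl _ xn) Hk).
- move=> x xn /(no_alpha_shift (pwalk_rotseq z) (ltnW xn)) Hk.
  by rewrite lab_rotn alpha_rhon ?lab_bound // (alpha_root H (nl _ xn) Hk).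
- move=> x k xn /(win_beta_shift (pwalk_rotseq z)) Hk.
  by rewrite lab_rotn beta_rhon ?lab_bound // (beta_tau H (nl _ xn) Hk).
- move=> x xn /(no_beta_shift (pwalk_rotseq z)) Hk.
  by rewrite lab_rotn beta_rhon ?lab_bound // (beta_root H (nl _ xn) Hk).
Qed.

Lemma lab_split x : n < x -> exists2 q, x = q.+1 * n + lab x & 0 < lab x <= n.
Proof.
move=> nx; have [[|[|q]] Hq] := labP x; have B := lab_bound x; try lia.
by exists q => //; lia.
Qed.

Lemma eqmod_lab k k' : lab k = lab k' -> k = k' %[mod n].
Proof. by rewrite /lab => -[] /eqP; rewrite eqn_modDr => /eqP. Qed.

Lemma height_dyck D : dyck (walk D) n -> height D n.+1 = a.
Proof. by case=> _ + _; rewrite /walk; nia. Qed.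

(** Each period of [pwalk] copies the walk on the labels ([anchor]), and the next period is lower by
    [walk D 1 > 0] ([step]). Beta-ends and nonzero alpha-ends are thus found within the period; a
    label with alpha-end 0 finds nothing lower, as the period before it is higher. *)
Lemma rooted_first D : dyck (walk D) n -> rooted (fun k => vrun D (lab k)) D 0 lab.
Proof.
move=> HD; set z := (fun k => _ : nat); set E := pwalk z.
have Wpos x : 0 < x <= n -> (0 < (walk D) x)%R by case: HD => _ _; apply.
have Wend : (walk D) n.+1 = 0%R by case: HD.
have anchor q d : d <= n -> E (q * n + d.+1) = (E (q * n)%N.+1 + (walk D) d.+1 - (walk D) 1%N)%R.
  elim: d => [|d IH] dn; first by rewrite addn1; lia.
  have Ez : z (q * n + d.+1) = vrun D d.+1 by rewrite /z addnC labMD lab_id //; lia.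
  by rewrite addnS /E pwalkS -/E IH ?Ez; [rewrite [walk D d.+2]walkS; lia|lia].
have step q : E (q.+1 * n)%N.+1 = (E (q * n)%N.+1 - (walk D) 1%N)%R.
  by have := anchor q n (leqnn n); rewrite addnS addnC -mulSn Wend; lia.
have alE x q : x = q.+1 * n + lab x -> 0 < alpha (walk D) (lab x) -> 0 < lab x <= n ->
    win_alpha E x (q.+1 * n + alpha (walk D) (lab x)).
  move=> Ex m0 Hl; have := alpha_spec HD Hl; move: (lab x) Ex Hl m0 => l Ex Hl.
  move: (alpha (walk D) l) => m m0 [ml Wm Hm].
  have An d : 0 < d <= n -> E (q.+1 * n + d) = (E (q.+1 * n)%N.+1 + (walk D) d - (walk D) 1%N)%R.
    by move=> Hd; rewrite -[d in LHS]prednK ?anchor; [rewrite prednK; lia|lia|lia].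
  split; first by lia.
  rewrite Ex; split; [by lia|by rewrite !An; lia|].
  move=> y Hy; have Ey : y = q.+1 * n + (y - q.+1 * n) by lia.
  by rewrite Ey !An; [have := Hm (y - q.+1 * n)| |]; lia.
have beE x q : x = q.+1 * n + lab x -> 0 < lab x <= n ->
    win_beta E x (q.+1 * n + beta (walk D) n (lab x)).
  move=> Ex Hl; have := beta_spec HD Hl; have := beta_le HD Hl.
  move: (lab x) Ex Hl => l Ex Hl; move: (beta (walk D) n l) => m mn [ml Wm Hm].
  have An d : 0 < d <= n.+1 -> E (q.+1 * n + d) = (E (q.+1 * n)%N.+1 + (walk D) d - (walk D) 1%N)%R.
    by move=> Hd; rewrite -[d in LHS]prednK ?anchor; [rewrite prednK; lia|lia|lia].
  split; first by lia.
  rewrite Ex; split; [by lia|by rewrite -addnS !An; lia|].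
  move=> y Hy; have Ey : y = q.+1 * n + (y - q.+1 * n) by lia.
  by rewrite Ey !An; [have := Hm (y - q.+1 * n)| |]; lia.
split.
- exact: labD.
- by move=> k; case/andP: (lab_bound k).
- by move=> k; rewrite -lt0n; case/andP: (lab_bound k).
- exact: eqmod_lab.
- by [].
- by [].
- by [].
- rewrite -(sum_per 1) => [|k]; last by rewrite /z labD.
  rewrite -[RHS](height_dyck HD) /height big_ord_recl /=; congr (_ + _).
  apply: eq_bigr => m _; rewrite /z lab_id /bump /=; last by have := ltn_ord m; lia.
  by congr (nat_of_ord (vrun D _)); lia.
- move=> x k nx; have [q Ex Hl] := lab_split nx.
  have [m0|m0] := posnP (alpha (walk D) (lab x)); last first.
    have [_ H'] := alE x q Ex m0 Hl; case=> _ H; rewrite (is_alpha_uniq H H').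
    rewrite addnC labMD [RHS]lab_id //; have := alpha_lt HD Hl; lia.
  case=> xk [kx Ek _]; have := alpha_spec HD Hl; rewrite m0 => -[_ _ Hm].
  have W1 : (walk D (lab x) <= walk D 1%N)%R.
    by have [->//|?] := eqVneq (lab x) 1; apply: Hm; lia.
  have El : E x = (E (q.+1 * n)%N.+1 + (walk D) (lab x) - (walk D) 1%N)%R.
    by have := anchor q.+1 (lab x).-1; rewrite !prednK -?Ex; lia.
  have [ks|ks] := ltnP (q.+1 * n) k.
    have Hk := Hm (k - q.+1 * n) ltac:(lia).
    have A := anchor q.+1 (k - q.+1 * n).-1 ltac:(lia).
    rewrite prednK ?subnKC in A; [|lia|lia].
    by rewrite -/E in Ek; lia.
  have Wk := Wpos (k - q * n) ltac:(lia).
  have A := anchor q (k - q * n).-1 ltac:(lia).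
  rewrite prednK ?subnKC in A; [|lia|lia].
  by rewrite -/E in Ek; have := step q; lia.
- move=> x nx H; have [q Ex Hl] := lab_split nx; have [//|m0] := posnP (alpha (walk D) (lab x)).
  have [h1 [h2 h3 _]] := alE x q Ex m0 Hl.
  by have := H (q.+1 * n + alpha (walk D) (lab x)) ltac:(lia); rewrite -/E; lia.
- move=> x k nx; have [q Ex Hl] := lab_split nx; have [_ H'] := beE x q Ex Hl.
  case=> _ H; rewrite (is_beta_uniq H H') addnC labMD [RHS]lab_id //.
  by have := beta_le HD Hl; have := beta_ge HD Hl; lia.
move=> x nx H; have [q Ex Hl] := lab_split nx.
have [h1 [h2 h3 _]] := beE x q Ex Hl.
by have := H (q.+1 * n + beta (walk D) n (lab x)) ltac:(lia); rewrite -/E; lia.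
Qed.

(** Now the periods climb by [walk D n > 0], so alpha-ends stay within the period, while a label
    with beta-end [n] finds nothing lower in the next one. *)
Lemma rooted_last D : dyck (walk D) n ->
  rooted (fun k => vrun D (k %% n)) D n (fun k => k %% n).
Proof.
move=> HD; set z := (fun k => _ : nat); set E := pwalk z.
have anchor q d : d <= n -> E (q * n + d) = (E (q * n)%N + walk D d)%R.
  elim: d => [|d IH] dn; first by rewrite addn0 walk0; lia.
  have Ez : z (q * n + d) = vrun D d by rewrite /z modnMDl modn_small.
  by rewrite addnS /E pwalkS -/E IH ?Ez; [rewrite (walkS a0 n0 cop D d); lia|lia].
have step q : E (q.+1 * n) = (E (q * n)%N + walk D n)%R by rewrite mulSn addnC anchor.
have Wpos x : 0 < x <= n -> (0 < walk D x)%R by case: HD => _ _; apply.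
have Mod q m : m < n -> (q * n + m) %% n = m by move=> mn; rewrite modnMDl modn_small.
have alE x q : x = q.+1 * n + lab x -> 0 < lab x <= n ->
    win_alpha E x (q.+1 * n + alpha (walk D) (lab x)).
  move=> Ex Hl; have := alpha_spec HD Hl; move: (lab x) Ex Hl => l Ex Hl.
  move: (alpha (walk D) l) => m [ml Wm Hm].
  split; first by lia.
  rewrite Ex; split; [by lia|by rewrite !anchor; lia|].
  move=> y Hy; have Ey : y = q.+1 * n + (y - q.+1 * n) by lia.
  by rewrite Ey !anchor; [have := Hm (y - q.+1 * n)| |]; lia.
have beE x q : x = q.+1 * n + lab x -> 0 < lab x <= n -> beta (walk D) n (lab x) < n ->
    win_beta E x (q.+1 * n + beta (walk D) n (lab x)).
  move=> Ex Hl; have := beta_spec HD Hl; move: (lab x) Ex Hl => l Ex Hl.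
  move: (beta (walk D) n l) => m [ml Wm Hm] mn.
  split; first by lia.
  rewrite Ex; split; [by lia|by rewrite -addnS !anchor; lia|].
  move=> y Hy; have Ey : y = q.+1 * n + (y - q.+1 * n) by lia.
  by rewrite Ey !anchor; [have := Hm (y - q.+1 * n)| |]; lia.
split.
- by move=> k; rewrite modnDr.
- by move=> k; rewrite ltnW // ltn_pmod.
- by move=> k; rewrite ltn_eqF // ltn_pmod.
- by [].
- by [].
- by [].
- by [].
- rewrite -[RHS](height_dyck HD) heightS addnC; congr (_ + _).
  by apply: eq_bigr => m _; rewrite /z modn_small.
- move=> x k nx; have [q Ex Hl] := lab_split nx; have [_ H'] := alE x q Ex Hl.
  case=> _ H; rewrite (is_alpha_uniq H H') Mod //.
  by have := alpha_lt HD Hl; lia.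
- move=> x nx H; have [q Ex Hl] := lab_split nx.
  have [h1 [h2 h3 _]] := alE x q Ex Hl.
  by have := H (q.+1 * n + alpha (walk D) (lab x)) ltac:(lia); rewrite -/E; lia.
- move=> x k nx; have [q Ex Hl] := lab_split nx; have bn := beta_le HD Hl.
  have [bn'|bn'] := ltnP (beta (walk D) n (lab x)) n.
    by have [_ H'] := beE x q Ex Hl bn'; case=> _ H; rewrite (is_beta_uniq H H') Mod.
  case=> kx [xk Ek _]; have [_ _ Hb] := beta_spec HD Hl.
  have Ex' := anchor q.+1 (lab x) ltac:(lia); rewrite -Ex -/E in Ek Ex'.
  have Hn := Hb n ltac:(lia); have [kn|kn] := leqP k.+1 (q.+1 * n + n).
    have A := anchor q.+1 (k.+1 - q.+1 * n) ltac:(lia); rewrite subnKC in A; last by lia.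
    by have := Hb (k.+1 - q.+1 * n) ltac:(lia); lia.
  have A := anchor q.+2 (k.+1 - q.+2 * n) ltac:(lia); rewrite subnKC in A; last by lia.
  by have := Wpos (k.+1 - q.+2 * n) ltac:(lia); have := step q.+1; lia.
move=> x nx H; have [q Ex Hl] := lab_split nx; have bn := beta_le HD Hl.
have [bn'|bn'] := ltnP (beta (walk D) n (lab x)) n; last by lia.
have [h1 [h2 h3 _]] := beE x q Ex Hl bn'.
by have := H (q.+1 * n + beta (walk D) n (lab x)) ltac:(lia); rewrite -/E; lia.
Qed.

Lemma pwalk_ext z z' : z =1 z' -> pwalk z =1 pwalk z'.
Proof. by move=> E x; rewrite /pwalk; congr ((_ * _)%N%:Z - _)%R; apply: eq_bigr. Qed.

Lemma rooted_ext z z' D p tau : z =1 z' -> rooted z D p tau -> rooted z' D p tau.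
Proof.
move=> E H; have sh x : pwalk z' x = (pwalk z (x + 0)%N - 0)%R.
  by rewrite addn0 subr0 (pwalk_ext E).
case: H => h1 h2 h3 h4 h5 h6 h7 h8 h9 h10 h11 h12; split => //.
- by move=> k; rewrite h7 E.
- by apply: etrans h8; congr (_ + _); apply: eq_bigr => m _; rewrite E.
- by move=> x k nx /(win_alpha_shift sh); rewrite !addn0; apply: h9.
- by move=> x nx /(no_alpha_shift sh (ltnW nx)); rewrite !addn0; apply: h10.
- by move=> x k nx /(win_beta_shift sh); rewrite !addn0; apply: h11.
by move=> x nx /(no_beta_shift sh); rewrite !addn0; apply: h12.
Qed.

Lemma per_MD z : (forall k, z (k + n) = z k) -> forall q x, z (x + q * n) = z x.
Proof. by move=> per; elim=> [|q IH] x; rewrite ?addn0 // mulSnr addnA per. Qed.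

Lemma per_mod z : (forall k, z (k + n) = z k) -> forall x, z (x %% n) = z x.
Proof. by move=> per x; rewrite {2}(divn_eq x n) addnC per_MD. Qed.

Lemma iter_rotseq t z x : iter t rotseq z x = z (x + t * n.-1).
Proof.
elim: t x => [|t IH] x; first by rewrite addn0.
by rewrite iterS /rotseq IH mulSn addnA.
Qed.

Lemma iter_rotseq_per t z : (forall k, z (k + n) = z k) ->
  forall k, iter t rotseq z (k + n) = iter t rotseq z k.
Proof. by move=> per k; rewrite !iter_rotseq addnAC per. Qed.

Lemma iter_rotseq_n t z : (forall k, z (k + n) = z k) -> iter (t * n) rotseq z =1 z.
Proof. by move=> per x; rewrite iter_rotseq mulnAC per_MD. Qed.

Lemma iter_rotseq_inj t z z' : (forall k, z (k + n) = z k) -> (forall k, z' (k + n) = z' k) ->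
  iter t rotseq z =1 iter t rotseq z' -> z =1 z'.
Proof.
move=> per per' E x; have := E (x + t); rewrite !iter_rotseq.
have -> : x + t + t * n.-1 = x + t * n by rewrite -[in RHS](prednK n0); lia.
by rewrite !per_MD.
Qed.

Lemma pwalk_drift z x : (forall k, z (k + n) = z k) ->
  pwalk z (x + n) =
    (pwalk z x + (n.+1 * \sum_(m < n) z m)%N%:Z - (a * n)%N%:Z)%R.
Proof.
move=> per; have E : pwalk (fun y => z (y + x)) n =
    ((n.+1 * \sum_(m < n) z m)%N%:Z - (a * n)%N%:Z)%R by rewrite /pwalk /= sum_per.
by rewrite [x + n]addnC pwalkD E; ring.
Qed.

Lemma pwalk_sum_iter t z : (forall k, z (k + n) = z k) ->
  \sum_(m < n) iter t rotseq z m = \sum_(m < n) z m.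
Proof.
move=> per; rewrite -(sum_per (t * n.-1) per).
by apply: eq_bigr => m _; rewrite iter_rotseq.
Qed.

Definition path_of (f : nat -> nat) : vruns a n.+1 := [tuple inord (f j) | j < n.+1].

Lemma vrun_path_of f k : k <= n -> f k <= a -> vrun (path_of f) k = f k :> nat.
Proof.
move=> kn fa; rewrite /vrun (nth_mktuple _ _ (@Ordinal n.+1 k kn)) /= inordK //.
Qed.

Lemma le_sum z k : k < n -> z k <= \sum_(m < n) z m.
Proof. by move=> kn; rewrite (bigD1 (Ordinal kn)) //= leq_addr. Qed.

(** The remaining rank [r] is put in front. [no_alpha] at label 1, seen at index [n.+1], says that
    the walk does not go below its final value 0; injectivity of the walk makes this strict. *)
Lemma first_path z r : (forall k, z (k + n) = z k) -> r + \sum_(m < n) z m = a ->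
  no_alpha (pwalk z) n.+1 ->
  exists2 D : vruns a n.+1, dyck (walk D) n & forall k, vrun D (lab k) = z k :> nat.
Proof.
move=> per sz Hn; pose f k := if k is k'.+1 then z k else r.
have za k : z k <= a.
  by have := le_sum z (ltn_pmod k n0); rewrite per_mod //; lia.
have fa k : f k <= a by case: k => [|k] //=; lia.
pose D := path_of f; have vD k : k <= n -> vrun D k = f k :> nat by move=> ?; rewrite vrun_path_of.
have WE d : d <= n -> walk D d.+1 = ((n.+1 * r)%N%:Z - a%:Z + pwalk z d.+1 - pwalk z 1%N)%R.
  elim: d => [|d IH] dn.
    by rewrite (walkS a0 n0 cop) walk0 vD //=; lia.
  by rewrite (walkS a0 n0 cop) IH ?(pwalkS z d.+1) ?vD //=; lia.
have Wend : walk D n.+1 = 0%R.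
  by rewrite WE //; have := pwalk_drift 1 per; rewrite add1n => ->; lia.
exists D; last first.
  move=> k; rewrite vD; last by case/andP: (lab_bound k).
  rewrite /f /lab -[RHS](per_mod per) -[in RHS](modnDr k n).
  rewrite -(per_mod per (_ %% _).+1) -addn1 modnDml.
  by congr (z (_ %% _)); lia.
split => //; first by rewrite walk0.
case=> [//|d] Hd; rewrite lt_neqAle; apply/andP; split.
  rewrite eq_sym; apply/eqP => E; have := @walk_inj a n a0 n0 cop D d.+1 0.
  by rewrite E walk0; lia.
have := Hn d.+1 ltac:(lia); rewrite -Wend !WE; lia.
Qed.

(** The remaining rank [r] is put at the end. [no_beta] at label [n], seen at index [n + n] and
    moved back by two periods, says that the walk does not go below its initial value 0. *)
Lemma last_path z r : (forall k, z (k + n) = z k) -> r + \sum_(m < n) z m = a ->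
  no_beta (pwalk z) (n + n) ->
  exists2 D : vruns a n.+1, dyck (walk D) n & forall k, vrun D (k %% n) = z k :> nat.
Proof.
move=> per sz Hn; pose f k := if k < n then z k else r.
have za k : z k <= a.
  by have := le_sum z (ltn_pmod k n0); rewrite per_mod //; lia.
have fa k : f k <= a by rewrite /f; case: ifP => // _; lia.
pose D := path_of f; have vD k : k <= n -> vrun D k = f k :> nat by move=> ?; rewrite vrun_path_of.
have p0 : pwalk z 0 = 0%R by rewrite /pwalk big_ord0 !muln0.
have WE d : d <= n -> walk D d = pwalk z d.
  elim: d => [|d IH] dn; first by rewrite walk0 p0.
  by rewrite (walkS a0 n0 cop) IH ?(pwalkS z d) ?vD /f ?dn //=; lia.
have Wend : walk D n.+1 = 0%R.
  rewrite (walkS a0 n0 cop) WE // vD // /f ltnn.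
  by have := pwalk_drift 0 per; rewrite p0 add0n => ->; lia.
exists D; last first.
  move=> k; rewrite vD; last by rewrite ltnW // ltn_pmod.
  by rewrite /f ltn_pmod // per_mod.
split => //; first by rewrite walk0.
move=> d Hd; rewrite lt_neqAle; apply/andP; split.
  rewrite eq_sym; apply/eqP => E; have := @walk_inj a n a0 n0 cop D d 0.
  by rewrite E walk0; lia.
have := Hn (n + n + d.-1) ltac:(lia); rewrite WE; last by lia.
have -> : (n + n + d.-1).+1 = d + n + n by lia.
have := pwalk_drift n per; have := pwalk_drift 0 per.
have := pwalk_drift (d + n) per; have := pwalk_drift d per.
rewrite p0 add0n; lia.
Qed.

(** Label 1 has alpha-end 0, the root, so [no_alpha] holds there and [first_path] builds a path out
    of [z]. By [rooted_functional] this path is [D], from which [z] can be read off. *)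
Lemma rooted_at_first z D tau : rooted z D 0 tau -> forall k, z k = vrun D (lab k).
Proof.
move=> H; have per := rooted_per H; have HD := rooted_dyck H.
have [+ _] := rooted_label H (x := 1) ltac:(lia).
rewrite (alpha1 HD n0) add1n; case=> [[k _ E]|[Hn _]].
  by have := tau_root H k; rewrite -E.
have [D1 HD1 Ez] := first_path per (vrun_root H) Hn.
have [<- _] := rooted_functional (rooted_ext Ez (rooted_first HD1)) H.
by move=> k; rewrite Ez.
Qed.

Lemma rooted_at_last z D tau : rooted z D n tau -> forall k, z k = vrun D (k %% n).
Proof.
move=> H; have per := rooted_per H; have HD := rooted_dyck H.
have [_] := rooted_label H (x := n) ltac:(lia).
rewrite (beta_n HD n0); case=> [[k _ E]|[Hn _]].
  by have := tau_root H k; rewrite -E eqxx.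
have [D1 HD1 Ez] := last_path per (vrun_root H) Hn.
have [<- _] := rooted_functional (rooted_ext Ez (rooted_last HD1)) H.
by move=> k; rewrite Ez.
Qed.

(** * Rotating a marked path until its root is 0 or n *)

Definition rho2 (y : vruns a n.+1 * nat) := (rho y.1, sigma y.1 y.2).

Lemma rooted_iter m z (y : vruns a n.+1 * nat) tau : rooted z y.1 y.2 tau ->
  exists tau', rooted (iter m rotseq z) (iter m rho2 y).1 (iter m rho2 y).2 tau'.
Proof.
move=> H; elim: m => [|m [tau' IH]]; first by exists tau.
by eexists; rewrite !iterS /rho2 /=; apply: rooted_rotseq IH.
Qed.

Lemma iter_rho2_fst m D y : (iter m rho2 (D, y)).1 = iter m (@rho a n) D.
Proof. by elim: m => //= m ->. Qed.

Lemma labS x : lab x.+1 = rotn (lab x).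
Proof. by rewrite lab_rotn addSnnS prednK // labD. Qed.

Lemma iter_rho_dyck m D : dyck (walk D) n -> dyck (walk (iter m (@rho a n) D)) n.
Proof. by move=> HD; elim: m => //= m IH; apply: rho_dyck. Qed.

(** A vertex is followed as the end of a label, since labels move uniformly under rotation and
    vertices do not. *)
Lemma rho2_alpha m D x : dyck (walk D) n -> 0 < x <= n ->
  iter m rho2 (D, alpha (walk D) x) =
    (iter m (@rho a n) D, alpha (walk (iter m (@rho a n) D)) (lab (x + m))).
Proof.
move=> HD Hx; elim: m => [|m IH]; first by rewrite addn0 lab_id.
rewrite iterS IH /rho2 /= addnS labS alpha_rhon ?lab_bound //.
exact: iter_rho_dyck.
Qed.

Lemma rho2_beta m D x : dyck (walk D) n -> 0 < x <= n ->
  iter m rho2 (D, beta (walk D) n x) =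
    (iter m (@rho a n) D, beta (walk (iter m (@rho a n) D)) n (lab (x + m))).
Proof.
move=> HD Hx; elim: m => [|m IH]; first by rewrite addn0 lab_id.
rewrite iterS IH /rho2 /= addnS labS beta_rhon ?lab_bound //.
exact: iter_rho_dyck.
Qed.

Lemma vertex_label D y : dyck (walk D) n -> y <= n ->
  exists2 x, 0 < x <= n & (y = alpha (walk D) x \/ y = beta (walk D) n x).
Proof.
move=> HD yn.
have [[yn' Wy]|[y0 Wy]] := ascent_or_descent HD yn (walkS_neq a0 n0 cop D y).
  by exists y.+1; [lia|left; rewrite (alpha_ascent HD yn' Wy)].
by exists y; [lia|right; rewrite (beta_descent HD _ Wy); lia].
Qed.

(** Once the label attached to [y] has moved to 1, its alpha-end is vertex 0; once it has moved to
    [n], its beta-end is vertex [n]. *)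
Lemma rho2_root D y : dyck (walk D) n -> y <= n ->
  exists2 t, t <= n & exists D', iter t rho2 (D, y) = (D', 0) \/ iter t rho2 (D, y) = (D', n).
Proof.
move=> HD yn; have [x Hx Ey] := vertex_label HD yn.
case: Ey => ->.
  exists (n.+1 - x); [lia|exists (iter (n.+1 - x) (@rho a n) D); left].
  rewrite rho2_alpha // subnKC; last by lia.
  have -> : lab n.+1 = 1 by rewrite -add1n labD lab_id.
  by rewrite (alpha1 (iter_rho_dyck _ HD)).
exists (n - x); [lia|exists (iter (n - x) (@rho a n) D); right].
rewrite rho2_beta // subnKC; last by lia.
by rewrite lab_id ?(beta_n (iter_rho_dyck _ HD)) // n0 /=.
Qed.

Lemma iter_rho2_n D y : dyck (walk D) n -> y <= n -> iter n rho2 (D, y) = (D, y).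
Proof.
move=> HD yn.
have rD : iter n (@rho a n) D = D.
  have [tau H] := @rooted_iter n _ (D, 0) _ (rooted_first HD).
  have per k : vrun D (lab (k + n)) = vrun D (lab k) :> nat by rewrite labD.
  have Ez := @iter_rotseq_n 1 (fun k => vrun D (lab k)) per; rewrite mul1n in Ez.
  have [E _] := rooted_functional (rooted_ext Ez H) (rooted_first HD).
  by rewrite -[RHS]E iter_rho2_fst.
have [x Hx [->|->]] := vertex_label HD yn.
  by rewrite rho2_alpha // rD labD lab_id.
by rewrite rho2_beta // rD labD lab_id.
Qed.

Lemma rooted_injective z z' D y tau tau' :
  rooted z D y tau -> rooted z' D y tau' -> z =1 z'.
Proof.
move=> H H'; have [t _ [D' Et]] := rho2_root (rooted_dyck H) (root_le H).
have [u Hu] := @rooted_iter t _ (D, y) _ H.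
have [u' Hu'] := @rooted_iter t _ (D, y) _ H'.
apply: (iter_rotseq_inj (rooted_per H) (rooted_per H') (t := t)) => x.
case: Et => Et; rewrite Et /= in Hu Hu'.
  by rewrite (rooted_at_first Hu) (rooted_at_first Hu').
by rewrite (rooted_at_last Hu) (rooted_at_last Hu').
Qed.

(** The sequence is explicit once the root is 0 or [n]; the remaining [n - t] rotations then
    complete a full turn back to [(D, y)]. *)
Lemma rooted_surjective D y : dyck (walk D) n -> y <= n ->
  exists z, exists tau, rooted z D y tau.
Proof.
move=> HD yn; have [t tn [D' Et]] := rho2_root HD yn.
have HD' : dyck (walk D') n.
  by have := iter_rho_dyck t HD; rewrite -(iter_rho2_fst t D y); case: Et => ->.
have [z [tau H]] : exists z, exists tau,
    rooted z (iter t rho2 (D, y)).1 (iter t rho2 (D, y)).2 tau.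
  by case: Et => -> /=; do 2 eexists; [apply: rooted_first|apply: rooted_last].
have [tau' H'] := rooted_iter (n - t) H.
rewrite -iterD subnK // iter_rho2_n // in H'.
by do 2 eexists; apply: H'.
Qed.

(** The cycle lemma: take a lowest point [x] of a period. If the drift [c] is at most 0, nothing in
    the window before [x] is lower; if it is positive, nothing in the window after [x] is. *)
Lemma no_alpha_or_no_beta z : (forall k, z (k + n) = z k) ->
  exists2 x, n < x <= n + n & no_alpha (pwalk z) x \/ no_beta (pwalk z) x.
Proof.
move=> per; set E := pwalk z.
have [x Hx xmin] : exists2 x, n < x <= n + n & forall y, n < y <= n + n -> (E x <= E y)%R.
  have : forall m, exists2 x, n < x <= n + m.+1 & forall y, n < y <= n + m.+1 -> (E x <= E y)%R.
    elim=> [|m [x Hx IH]]; first by exists n.+1; [lia|move=> y Hy; have -> : y = n.+1 by lia].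
    have [Hl|Hl] := lerP (E x) (E (n + m.+2)).
      exists x; [lia|move=> y Hy]; have [->//|?] := eqVneq y (n + m.+2).
      by apply: IH; lia.
    exists (n + m.+2); [lia|move=> y Hy]; have [->//|?] := eqVneq y (n + m.+2).
    by apply: le_trans (ltW Hl) _; apply: IH; lia.
  by move=> /(_ n.-1); rewrite prednK.
have dr y : E (y + n) = (E y + ((n.+1 * \sum_(m < n) z m)%N%:Z - (a * n)%N%:Z))%R.
  by rewrite /E pwalk_drift // addrA.
move: ((n.+1 * _)%N%:Z - _)%R dr => c dr.
exists x => //; have [c0|c0] := lerP c 0; [left => k Hk|right => j Hj].
  have [kn|kn] := ltnP n k; first by apply: xmin; lia.
  by have := xmin (k + n) ltac:(lia); rewrite dr; lia.
have [jn|jn] := leqP j.+1 (n + n); first by apply: xmin; lia.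
have := xmin (j.+1 - n) ltac:(lia); have := dr (j.+1 - n).
rewrite subnK; lia.
Qed.

Lemma rooted_total z r : (forall k, z (k + n) = z k) -> r + \sum_(m < n) z m = a ->
  exists D, exists y, exists tau, rooted z D y tau.
Proof.
move=> per sz; have [x Hx Hno] := no_alpha_or_no_beta per.
have [t [D [y [tau H]]]] : exists t D y tau, rooted (iter t rotseq z) D y tau.
  have sh t y : pwalk (iter t rotseq z) y =
      (pwalk z (y + t * n.-1)%N - pwalk z (t * n.-1))%R.
    by rewrite pwalkD addrK; apply: pwalk_ext => v; rewrite iter_rotseq.
  have shn q y : pwalk z y = (pwalk z (y + q * n)%N - pwalk z (q * n))%R.
    by rewrite pwalkD addrK; apply: pwalk_ext => v; rewrite per_MD.
  have sz' t : r + \sum_(m < n) iter t rotseq z m = a by rewrite pwalk_sum_iter.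
  case: Hno => Hno.
    (* Rotation moves labels by one, so after [t] steps label [x] has become [n + n.+1], which is
       label 1. *)
    pose t := n + n.+1 - x.
    have Et : n.+1 + t * n.-1 = x + t.-1 * n.
      have t0 : 0 < t by rewrite /t; lia.
      have := mulSnr t.-1 n; have := mulnSr t n.-1; rewrite !prednK // /t; lia.
    have Hno' : no_alpha (pwalk (iter t rotseq z)) n.+1.
      have nx : n <= x by lia.
      by apply/(no_alpha_shift (sh t) (leqnSn n)); rewrite Et; apply/(proj1 (no_alpha_shift (shn _) nx)).
    have [D HD Ez] := first_path (iter_rotseq_per t per) (sz' t) Hno'.
    by exists t, D, 0, lab; apply: rooted_ext Ez (rooted_first HD).
  pose t := n + n - x.
  have Et : n + n + t * n.-1 = x + t * n.
    have Ht : t + x = n + n by rewrite /t; lia.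
    by have := mulnSr t n.-1; rewrite prednK //; lia.
  have Hno' : no_beta (pwalk (iter t rotseq z)) (n + n).
    by apply/(no_beta_shift (sh t)); rewrite Et; apply/(proj1 (no_beta_shift (shn t) _)).
  have [D HD Ez] := last_path (iter_rotseq_per t per) (sz' t) Hno'.
  by exists t, D, n, (fun k => k %% n); apply: rooted_ext Ez (rooted_last HD).
(* With the [t] rotations already made, [t * n.-1] more complete [t] full turns. *)
have [tau' H'] := @rooted_iter (t * n.-1) _ (D, y) _ H.
rewrite -iterD in H'; exists (iter (t * n.-1) rho2 (D, y)).1, (iter (t * n.-1) rho2 (D, y)).2, tau'.
apply: rooted_ext H'; rewrite -[X in _ + X]muln1 -mulnDr addn1 prednK //.
exact: iter_rotseq_n.
Qed.

End Rooted.

(** Counting along a relation suits [rooted], whose witness [tau] is existential and which comes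
    with no function computing the marked path. *)
Lemma leq_card_rel (A B : finType) (SA : {set A}) (SB : {set B}) (R : A -> B -> Prop) :
  (forall x, x \in SA -> exists2 y, y \in SB & R x y) ->
  (forall x x' y, R x y -> R x' y -> x = x') ->
  #|SA| <= #|SB|.
Proof.
move=> ex inj; have [f Hf] : exists f : {x | x \in SA} -> B,
    forall x, f x \in SB /\ R (val x) (f x).
  by apply: (@fin_all_exists _ (fun=> B) (fun x y => y \in SB /\ R (val x) y)) => -[x xA] /=;
    have [y yB Rxy] := ex x xA; exists y.
have injf : injective f.
  by move=> x x' E; apply: val_inj; apply: inj (proj2 (Hf x)) _; rewrite E; case: (Hf x').
have <- : #|codom f| = #|SA| by rewrite card_codom // card_sig.
by apply: subset_leq_card; apply/subsetP => _ /codomP[x ->]; case: (Hf x).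
Qed.

Lemma eq_card_rel (A B : finType) (SA : {set A}) (SB : {set B}) (R : A -> B -> Prop) :
  (forall x, x \in SA -> exists2 y, y \in SB & R x y) ->
  (forall y, y \in SB -> exists2 x, x \in SA & R x y) ->
  (forall x y y', R x y -> R x y' -> y = y') ->
  (forall x x' y, R x y -> R x' y -> x = x') ->
  #|SA| = #|SB|.
Proof.
move=> AB BA inj1 inj2; apply/eqP; rewrite eqn_leq (leq_card_rel AB inj2) /=.
by apply: (@leq_card_rel _ _ _ _ (fun y x => R x y)) BA _ => y y' x; apply: inj1.
Qed.

Section Marked.

Variables a n : nat.
Hypotheses (a0 : 0 < a) (n0 : 0 < n) (cop : coprime a n.+1).

Implicit Types (D : vruns a n.+1) (z : vruns a n) (y : vruns a n.+1 * 'I_n.+1).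

Definition ext z x : nat := vrun z (x %% n).

Definition rotz z : vruns a n := [tuple vrun z ((i + n.-1) %% n) | i < n].

Definition npos m (v : vruns a m) := \sum_(i < m) (0 < vrun v i).

Lemma ext_per z x : ext z (x + n) = ext z x.
Proof. by rewrite /ext modnDr. Qed.

Lemma ext_ord z (i : 'I_n) : ext z i = vrun z i.
Proof. by rewrite /ext modn_small. Qed.

Lemma ext_rotz z : ext (rotz z) =1 rotseq n (ext z).
Proof.
move=> x; rewrite /ext /rotseq {1}/vrun.
by rewrite (nth_mktuple _ _ (Ordinal (ltn_pmod x n0))) /= modnDml.
Qed.

Lemma ext_iter_rotz t z : ext (iter t rotz z) =1 iter t (rotseq n) (ext z).
Proof.
elim: t => [|t IH] x //; rewrite iterS ext_rotz /rotseq IH !iter_rotseq //.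
by rewrite mulSn addnA.
Qed.

Lemma ext_inj z z' : ext z =1 ext z' -> z = z'.
Proof.
move=> E; apply: eq_from_tnth => i; apply: val_inj; rewrite !(tnth_nth ord0) /=.
by have := E i; rewrite !ext_ord.
Qed.

Definition ystep y : vruns a n.+1 * 'I_n.+1 := (rho y.1, inord (sigma y.1 y.2)).

Lemma iter_ystep t y : dyck (walk y.1) n ->
  iter t (@rho2 a n) (y.1, y.2 : nat) = ((iter t ystep y).1, (iter t ystep y).2 : nat).
Proof.
move=> HD; have Dt s : (iter s ystep y).1 = iter s (@rho a n) y.1 by elim: s => //= s ->.
elim: t => //= t ->; rewrite /rho2 /= inordK // ltnS.
by apply: (sigma_le a0 n0 cop); rewrite ?Dt ?leq_ord //; apply: iter_rho_dyck.
Qed.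

Lemma iter_ystep_fst t y : (iter t ystep y).1 = iter t (@rho a n) y.1.
Proof. by elim: t => //= t ->. Qed.

Definition root_rel z y := exists tau, rooted (ext z) y.1 y.2 tau.

Lemma root_rel_iter t z y : root_rel z y -> root_rel (iter t rotz z) (iter t ystep y).
Proof.
case=> tau H; have [tau' H'] := @rooted_iter a n a0 n0 cop t _ (y.1, y.2 : nat) _ H.
rewrite (iter_ystep t (rooted_dyck H)) in H'; exists tau'.
by apply: (rooted_ext a0 n0 cop) H' => x; rewrite ext_iter_rotz.
Qed.

Lemma root_rel_fun z y y' : root_rel z y -> root_rel z y' -> y = y'.
Proof.
case: y y' => [D p] [D' p'] [tau H] [tau' H'] /=.
by have [/= -> /val_inj ->] := rooted_functional a0 n0 cop H H'.
Qed.

Lemma root_rel_inj z z' y : root_rel z y -> root_rel z' y -> z = z'.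
Proof.
move=> [tau H] [tau' H']; apply: ext_inj.
exact: (rooted_injective a0 n0 cop H H').
Qed.

(** [tau] enumerates the vertices other than the root, whose own run is [a] minus the sum of [z]. *)
Lemma root_rel_npos z y : root_rel z y ->
  npos y.1 = npos z + (\sum_(i < n) vrun z i < a).
Proof.
case=> tau H; have szE : \sum_(i < n) vrun z i = \sum_(m < n) ext z m.
  by apply: eq_bigr => i _; rewrite ext_ord.
rewrite szE; have := vrun_root H => vr.
have -> : (\sum_(m < n) ext z m < a) = (0 < vrun y.1 y.2) by lia.
rewrite /npos (bigD1 y.2) //= addnC; congr (_ + _).
have tl i : tau i < n.+1 by rewrite ltnS (tau_le H).
rewrite (reindex_onto (fun i : 'I_n => Ordinal (tl i))
  (fun k => odflt (Ordinal (ltn_pmod 0 n0)) [pick i : 'I_n | tau i == k])) /=; last first.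
  move=> k kp; apply: val_inj => /=.
  have [i ik E] := tau_surj a0 n0 cop H (leq_ord k) kp.
  by case: pickP => [j /eqP //|/(_ (Ordinal ik))]; rewrite /= E eqxx.
rewrite [RHS](eq_bigr (fun i : 'I_n => (0 < ext z i) : nat)) => [|i _]; last by rewrite ext_ord.
apply: eq_big => i; last by rewrite -(vrun_tau H).
rewrite -val_eqE /= (tau_root H) /=; apply/eqP.
case: pickP => [j /eqP /(tau_inj H) E|/(_ i)]; last by rewrite eqxx.
by apply: val_inj; rewrite /= !modn_small in E *.
Qed.

Lemma root_rel_total z : \sum_(i < n) vrun z i <= a ->
  exists2 y, is_dyck y.1 & root_rel z y.
Proof.
move=> sz; have szE : \sum_(i < n) vrun z i = \sum_(m < n) ext z m.
  by apply: eq_bigr => i _; rewrite ext_ord.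
rewrite szE in sz.
have [D [p [tau H]]] := rooted_total a0 n0 cop (ext_per z) (subnK sz).
have pn : p < n.+1 by rewrite ltnS (root_le H).
exists (D, Ordinal pn); last by exists tau.
by apply/(is_dyckP a0 n0 cop); apply: rooted_dyck H.
Qed.

Lemma root_rel_surj y : is_dyck y.1 ->
  exists2 z, \sum_(i < n) vrun z i <= a & root_rel z y.
Proof.
move/(is_dyckP a0 n0 cop) => HD.
have [f [tau H]] := rooted_surjective a0 n0 cop HD (leq_ord y.2).
have per := rooted_per H.
have fa k : f k <= a.
  have := vrun_root H; rewrite -(per_mod per).
  by have := le_sum f (ltn_pmod k n0); lia.
pose z : vruns a n := [tuple inord (f i) | i < n].
have Ez : f =1 ext z.
  move=> x; rewrite /ext /vrun (nth_mktuple _ _ (Ordinal (ltn_pmod x n0))) /= inordK ?ltnS //.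
  by rewrite (per_mod per).
exists z; last by exists tau; apply: (rooted_ext a0 n0 cop) H.
have -> : \sum_(i < n) vrun z i = \sum_(i < n) f i.
  by apply: eq_bigr => i _; rewrite -ext_ord Ez.
by have := vrun_root H; lia.
Qed.

Lemma card_marked m k :
  #|[set z | [&& \sum_(i < n) vrun z i <= a, iter m rotz z == z
             & npos z + (\sum_(i < n) vrun z i < a) == k]]|
  = #|[set y | [&& is_dyck y.1, iter m ystep y == y & npos y.1 == k]]|.
Proof.
apply: (@eq_card_rel _ _ _ _ root_rel); [| |exact: root_rel_fun|exact: root_rel_inj].
  move=> z; rewrite inE => /and3P[sz /eqP fz nz].
  have [y Dy R] := root_rel_total sz; exists y => //.
  rewrite inE Dy (root_rel_npos R) nz andbT /=; apply/eqP.
  by apply: (root_rel_fun _ R); have := root_rel_iter m R; rewrite fz.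
move=> y; rewrite inE => /and3P[Dy /eqP fy ny].
have [z sz R] := root_rel_surj Dy; exists z => //.
rewrite inE sz -(root_rel_npos R) ny andbT /=; apply/eqP.
by apply: (root_rel_inj _ R); have := root_rel_iter m R; rewrite fy.
Qed.

(** * Fixed vertices *)

Section FixedVertex.

Variables (D : vruns a n.+1) (HD : dyck (walk D) n).

Lemma iter_fixed (T : Type) (f : T -> T) x g t : iter g f x = x -> iter (t * g) f x = x.
Proof. by move=> E; rewrite iterM; elim: t => //= t ->. Qed.

Lemma fixed_vertex_label g w p : g * w.+2 = n -> p <= n ->
  iter g (@rho2 a n) (D, p) = (D, p) ->
  exists2 x, 0 < x <= g & (alpha (walk D) x = p /\ alpha (walk D) (x + g) = p) \/
    (beta (walk D) n x = p /\ beta (walk D) n (x + g) = p).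
Proof.
move=> gw pn fp; have g0 : 0 < g by have := n0; rewrite -gw; lia.
have fD t : iter (t * g) (@rho a n) D = D.
  by rewrite -(iter_rho2_fst (t * g) D p) iter_fixed.
have [x0 Hx0 Ep] := vertex_label a0 n0 cop HD pn.
pose x := (x0.-1 %% g).+1; pose u := x0.-1 %/ g.
have Hx : 0 < x <= g by rewrite /x /= ltn_pmod.
have Ex : x0 = x + u * g by have := divn_eq x0.-1 g; rewrite -/u /x; lia.
(* As [x0 = x + u * g], adding [u * w.+1] times [g] gives [x] plus [u] full turns; one more [g]
   gives [x + g]. *)
have L1 : lab n (x0 + (u * w.+1) * g) = x.
  have -> : x0 + (u * w.+1) * g = x + u * n by rewrite -gw Ex; ring.
  by rewrite labMD (lab_id a0 n0 cop) //; move: gw; rewrite !mulnS; lia.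
have L2 : lab n (x0 + (u * w.+1).+1 * g) = x + g.
  have -> : x0 + (u * w.+1).+1 * g = x + g + u * n by rewrite -gw Ex; ring.
  by rewrite labMD (lab_id a0 n0 cop) //; move: gw; rewrite !mulnS; lia.
exists x => //; case: Ep => Ep; [left|right]; split.
- have := rho2_alpha a0 n0 cop (u * w.+1 * g) HD Hx0.
  by rewrite -Ep iter_fixed // fD L1 => -[].
- have := rho2_alpha a0 n0 cop ((u * w.+1).+1 * g) HD Hx0.
  by rewrite -Ep iter_fixed // fD L2 => -[].
- have := rho2_beta a0 n0 cop (u * w.+1 * g) HD Hx0.
  by rewrite -Ep iter_fixed // fD L1 => -[].
have := rho2_beta a0 n0 cop ((u * w.+1).+1 * g) HD Hx0.
by rewrite -Ep iter_fixed // fD L2 => -[].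
Qed.

(* The labels at a fixed vertex are invariant under [x |-> x + g], so the
   labels of two distinct fixed vertices would cross. *)
Lemma fixed_vertex_uniq g w p q : g * w.+2 = n -> p <= n -> q <= n ->
  iter g (@rho2 a n) (D, p) = (D, p) -> iter g (@rho2 a n) (D, q) = (D, q) -> p = q.
Proof.
move=> gw pn qn fp fq; have gn : g + g <= n by rewrite -gw !mulnS; lia.
have [x Hx Ep] := fixed_vertex_label gw pn fp.
have [y Hy Eq] := fixed_vertex_label gw qn fq.
have inj := @walk_inj a n a0 n0 cop D.
case: Ep Eq => [[E1 E2]|[E1 E2]] [[F1 F2]|[F1 F2]].
- case: (ltngtP x y) => [xy|yx|E]; last by rewrite -E1 -F1 E.
    by rewrite -E1 -F1; apply: (@alpha_noncrossing _ _ HD x y (x + g) (y + g));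
      rewrite ?E1 ?E2 ?F1 ?F2 //; lia.
  by rewrite -E1 -F1; symmetry; apply: (@alpha_noncrossing _ _ HD y x (y + g) (x + g));
    rewrite ?E1 ?E2 ?F1 ?F2 //; lia.
- by case: (@alpha_be_noncrossing _ _ HD inj x (x + g) y (y + g)); rewrite ?E1 ?E2 ?F1 ?F2 //; lia.
- by case: (@alpha_be_noncrossing _ _ HD inj y (y + g) x (x + g)); rewrite ?E1 ?E2 ?F1 ?F2 //; lia.
case: (ltngtP x y) => [xy|yx|E]; last by rewrite -E1 -F1 E.
  by rewrite -E1 -F1; apply: (@beta_noncrossing _ _ HD x y (x + g) (y + g));
      rewrite ?E1 ?E2 ?F1 ?F2 //; lia.
by rewrite -E1 -F1; symmetry; apply: (@beta_noncrossing _ _ HD y x (y + g) (x + g));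
    rewrite ?E1 ?E2 ?F1 ?F2 //; lia.
Qed.

Lemma order_dvd (T : finType) (f : T -> T) x w :
  injective f -> iter w f x = x -> order f x %| w.
Proof.
move=> injf Ew; have o0 := order_gt0 f x.
have E : iter (w %% order f x) f x = x.
  by move: Ew; rewrite {1}(divn_eq w (order f x)) addnC iterD iter_fixed // iter_order.
have := @findex_iter _ f x (w %% order f x) ltac:(by rewrite ltn_pmod).
by rewrite E findex0 => /esym/eqP.
Qed.

Lemma fixed_vertex_exists g w : g * w.+2 = n -> iter g (@rho a n) D = D ->
  exists p : 'I_n.+1, iter g ystep (D, p) = (D, p).
Proof.
move=> gw fD; pose theta p : 'I_n.+1 := (iter g ystep (D, p)).2.
have th p : iter g ystep (D, p) = (D, theta p).
  by rewrite [LHS]surjective_pairing iter_ystep_fst fD.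
have thM t p : iter (t * g) ystep (D, p) = (D, iter t theta p).
  by rewrite iterM; elim: t => //= t ->; rewrite th.
have rho2E t (p : 'I_n.+1) : iter (t * g) (@rho2 a n) (D, p : nat) = (D, iter t theta p : nat).
  by have := @iter_ystep (t * g) (D, p) HD; rewrite thM.
have th_n p : iter w.+2 theta p = p.
  apply: val_inj => /=; have := rho2E w.+2 p.
  by rewrite mulnC gw (iter_rho2_n a0 n0 cop HD) ?leq_ord // => -[].
have injth : injective theta.
  by move=> p q E; rewrite -(th_n p) -(th_n q) !iterSr E.
have [p /eqP fp|nofix] := pickP (fun p => theta p == p); first by exists p; rewrite th fp.
have ord p : order theta p = w.+2.
  have dv := order_dvd injth (th_n p); case/dvdnP: (dv) => -[|[|c]] Ec //.
    by rewrite Ec mul1n.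
  (* For an orbit shorter than [w.+2], the rotation by [order theta p * g] is still nontrivial and
     fixes both [p] and [theta p], so uniqueness makes them equal. *)
  have E1 := rho2E (order theta p) p; have E2 := rho2E (order theta p) (theta p).
  rewrite -iterSr iterS !iter_order // in E1 E2.
  have := @fixed_vertex_uniq (order theta p * g) c p (theta p) _ (leq_ord _) (leq_ord _) E1 E2.
  move=> /(_ ltac:(by apply: etrans gw; rewrite Ec; ring)) /val_inj /esym/eqP.
  by rewrite (nofix p).
have sub : predT \subset order_set theta w.+2.
  by apply/subsetP => p _; rewrite inE ord.
have dvd : w.+2 %| #|'I_n.+1|.
  by rewrite -(fcard_order_set injth sub) ?dvdn_mull // => x y.
have wn : w.+2 %| n by rewrite -gw dvdn_mull.
by rewrite card_ord -[n.+1]addn1 dvdn_addr ?dvdn1 // in dvd.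
Qed.

End FixedVertex.

(** A fixed path is marked by its only fixed vertex. *)
Lemma card_fixed_paths g w k : g * w.+2 = n ->
  #|[set D : vruns a n.+1 | [&& is_dyck D, iter g (@rho a n) D == D & npos D == k]]|
  = #|[set z | [&& \sum_(i < n) vrun z i <= a, iter g rotz z == z
             & npos z + (\sum_(i < n) vrun z i < a) == k]]|.
Proof.
move=> gw; rewrite card_marked.
apply: (@eq_card_rel _ _ _ _ (fun D y => [/\ dyck (walk D) n, y.1 = D & iter g ystep y = y])).
- move=> D; rewrite inE => /and3P[/(is_dyckP a0 n0 cop) HD /eqP fD nD].
  have [p fp] := fixed_vertex_exists HD gw fD; exists (D, p) => //.
  by rewrite inE fp eqxx nD !andbT /=; apply/(is_dyckP a0 n0 cop).
- move=> [D p]; rewrite inE => /and3P[/= Dy /eqP fp nD]; exists D.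
    by rewrite inE Dy nD andbT -(iter_ystep_fst g (D, p)) fp /=.
  by split=> //; apply: elimT (is_dyckP a0 n0 cop _) Dy.
- move=> D [D1 p] [D2 q] [HD /= -> fp] [_ /= -> fq].
  congr (_, _); apply: val_inj => /=.
  have := iter_ystep g (y := (D, p)) HD; have := iter_ystep g (y := (D, q)) HD.
  rewrite fp fq /= => E1 E2; apply: (fixed_vertex_uniq HD gw) E2 E1; exact: leq_ord.
by move=> D D' y [_ -> _] [_ -> _].
Qed.

Lemma card_paths k :
  #|[set D : vruns a n.+1 | is_dyck D && (npos D == k)]| * n.+1
  = #|[set z : vruns a n | (\sum_(i < n) vrun z i <= a)
             && (npos z + (\sum_(i < n) vrun z i < a) == k)]|.
Proof.
have := card_marked 0 k => /=.
have -> : [set z : vruns a n | [&& \sum_(i < n) vrun z i <= a, z == z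
    & npos z + (\sum_(i < n) vrun z i < a) == k]]
  = [set z : vruns a n | (\sum_(i < n) vrun z i <= a)
             && (npos z + (\sum_(i < n) vrun z i < a) == k)].
  by apply/setP => z; rewrite !inE eqxx.
move=> ->; rewrite -[X in _ * X]card_ord -cardsT -cardsX.
by apply: eq_card => -[D p]; rewrite !inE eqxx andbT.
Qed.

End Marked.

(** * Counting periodic sequences *)

Section Counting.

Variable a : nat.

Definition vsum m (u : vruns a m) := \sum_(i < m) vrun u i.

Lemma card_tupleS (T : finType) m (P : pred (m.+1.-tuple T)) :
  #|[set u | P u]| = \sum_x #|[set t : m.-tuple T | P (cons_tuple x t)]|.
Proof.
rewrite -sum1dep_card big_mkcond big_tupleS; apply: eq_bigr => x _.
by rewrite -sum1dep_card -big_mkcond.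
Qed.

Lemma vsum_cons m x (t : vruns a m) : vsum (cons_tuple x t : vruns a m.+1) = x + vsum t.
Proof. by rewrite /vsum big_ord_recl. Qed.

Lemma npos_cons m x (t : vruns a m) : npos (cons_tuple x t : vruns a m.+1) = (0 < x) + npos t.
Proof. by rewrite /npos big_ord_recl. Qed.

Lemma hockey_stick s c : \sum_(x < s) 'C(x, c) = 'C(s, c.+1).
Proof. by elim: s => [|s IH]; rewrite ?big_ord0 ?bin0n // big_ord_recr /= IH binS addnC. Qed.

(** Choose the [c] positive positions, then the [c] partial sums as a subset of 1..s. The bound
    [s <= a] ensures that the type ['I_a.+1] of the entries is no restriction. *)
Lemma card_npos_vsum_le m s c : s <= a ->
  #|[set u : vruns a m | (vsum u <= s) && (npos u == c)]| = 'C(m, c) * 'C(s, c).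
Proof.
elim: m s c => [|m IH] s c sa.
  rewrite (eq_card (B := [set u : vruns a 0 | c == 0])) => [|u]; last first.
    by rewrite !inE /vsum /npos !big_ord0 eq_sym.
  case: c => [|c] /=; last by rewrite bin0n; apply: eq_card0 => u; rewrite !inE.
  by rewrite !bin0; apply: etrans (card_tuple 0 'I_a.+1); apply: eq_card => u; rewrite !inE.
rewrite card_tupleS big_ord_recl /=.
rewrite (eq_card (B := [set u : vruns a m | (vsum u <= s) && (npos u == c)])) => [|u]; last first.
  by rewrite !inE vsum_cons npos_cons.
rewrite IH //; case: c => [|c].
  rewrite !bin0 muln1 big1 ?addn0 // => x _; apply: eq_card0 => u.
  by rewrite !inE npos_cons andbF.
rewrite binS mulnDl; congr (_ + _); rewrite -hockey_stick big_distrr /=.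
rewrite (eq_bigr (fun x : 'I_a => if x < s then 'C(m, c) * 'C(s - x.+1, c) else 0)); last first.
  move=> x _; case: ltnP => xs.
    rewrite -IH; last by lia.
    apply: eq_card => u; rewrite !inE vsum_cons npos_cons /= /bump /= !add1n eqSS.
    by congr (_ && _); lia.
  by apply: eq_card0 => u; rewrite !inE vsum_cons lift0; apply/negbTE; lia.
rewrite -big_mkcond /= -(big_ord_widen _ (fun x => 'C(m, c) * 'C(s - x.+1, c))) //.
rewrite (reindex_inj rev_ord_inj) /=; apply: eq_bigr => x _; congr (_ * 'C(_, _)).
by have := ltn_ord x; lia.
Qed.

Lemma card_npos_vsum_eq m s c : 0 < s <= a ->
  #|[set u : vruns a m | (vsum u == s) && (npos u == c.+1)]| = 'C(m, c.+1) * 'C(s.-1, c).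
Proof.
case: s => // s sa; have := @card_npos_vsum_le m s.+1 c.+1 sa.
rewrite binS mulnDr -(@card_npos_vsum_le m s c.+1); last by lia.
rewrite -(cardsID [set u : vruns a m | vsum u <= s]) => /= E.
apply: (@addnI #|[set u : vruns a m | (vsum u <= s) && (npos u == c.+1)]|).
rewrite -E; congr (_ + _); apply: eq_card => u; rewrite !inE; last by lia.
by case: eqP; lia.
Qed.

End Counting.

Section Periodic.

Variables a n : nat.
Hypotheses (a0 : 0 < a) (n0 : 0 < n).

Lemma vrun_mktuple m (F : 'I_m -> 'I_a.+1) k (km : k < m) :
  vrun [tuple F i | i < m] k = F (Ordinal km).
Proof. by rewrite /vrun (nth_mktuple _ _ (Ordinal km)). Qed.

Lemma sum_modn g w (F : nat -> nat) : \sum_(i < w * g) F (i %% g) = w * \sum_(i < g) F i.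
Proof.
elim: w => [|w IH]; first by rewrite big_ord0.
rewrite mulSn mulSnr big_split_ord /= addnC -IH; congr (_ + _).
  by apply: eq_bigr => i _; rewrite modnDl.
by apply: eq_bigr => i _; rewrite modn_small.
Qed.

Lemma card_periodic g w (Q : nat -> nat -> bool) : g * w.+1 = n ->
  #|[set z : vruns a n | (iter g (@rotz a n) z == z) && Q (vsum z) (npos z)]|
  = #|[set u : vruns a g | Q (w.+1 * vsum u) (w.+1 * npos u)]|.
Proof.
move=> gw; have g0 : 0 < g by have := n0; rewrite -gw; lia.
have gn : g %| n by rewrite -gw dvdn_mulr.
pose R (z : vruns a n) (u : vruns a g) := forall x, ext z x = vrun u (x %% g).
have Rsum z u (F : nat -> nat) : R z u ->
    \sum_(i < n) F (vrun z i) = w.+1 * \sum_(i < g) F (vrun u i).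
  move=> Rzu; rewrite -(sum_modn _ _ (fun i => F (vrun u i))) mulnC gw.
  by apply: eq_bigr => i _; rewrite -Rzu ext_ord.
have RQ z u : R z u -> Q (vsum z) (npos z) = Q (w.+1 * vsum u) (w.+1 * npos u).
  by move=> Rzu; rewrite /vsum /npos (Rsum z u id) // (Rsum z u (fun i => 0 < i : nat)).
have fixedP z : reflect (forall x, ext z (x + g) = ext z x) (iter g (@rotz a n) z == z).
  apply: (iffP eqP) => [E x|E].
    rewrite -{1}E ext_iter_rotz // iter_rotseq -addnA -mulnS prednK //.
    exact: (per_MD (ext_per z)).
  apply: (ext_inj (a := a)) => x; rewrite ext_iter_rotz // iter_rotseq mulnC.
  exact: (@per_MD g (ext z) E).
apply: (@eq_card_rel _ _ _ _ R).
- move=> z; rewrite inE => /andP[/fixedP fz Qz].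
  pose u : vruns a g := [tuple vrun z i | i < g].
  have Rzu : R z u.
    move=> x; rewrite (vrun_mktuple _ (ltn_pmod x g0)) /=.
    rewrite -(@per_mod g (ext z) fz) /ext modn_small //.
    by apply: leq_trans (ltn_pmod x g0) (dvdn_leq n0 gn).
  by exists u => //; rewrite inE -(RQ z u).
- move=> u; rewrite inE => Qu.
  pose z : vruns a n := [tuple vrun u (i %% g) | i < n].
  have Rzu : R z u.
    move=> x; rewrite /ext (vrun_mktuple _ (ltn_pmod x n0)) /=.
    by rewrite modn_dvdm.
  exists z => //; rewrite inE (RQ _ _ Rzu) Qu andbT.
  by apply/fixedP => x; rewrite !Rzu modnDr.
- move=> z u u' Ru Ru'; apply: eq_from_tnth => i; apply: val_inj.
  rewrite !(tnth_nth ord0) /=; have := Ru i; have := Ru' i.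
  by rewrite modn_small // => ->.
by move=> z z' u Rz Rz'; apply: ext_inj => x; rewrite Rz Rz'.
Qed.

Lemma card_rotz_fixed g w k : g * w.+1 = n ->
  #|[set z : vruns a n | [&& vsum z <= a, iter g (@rotz a n) z == z
                          & npos z + (vsum z < a) == k.+1]]|
  = (if w.+1 %| k then 'C(g, k %/ w.+1) * 'C(a.-1 %/ w.+1, k %/ w.+1) else 0)
    + (if (w.+1 %| a) && (w.+1 %| k.+1)
       then 'C(g, k.+1 %/ w.+1) * 'C((a %/ w.+1).-1, (k.+1 %/ w.+1).-1) else 0).
Proof.
move=> gw; have g0 : 0 < g by have := n0; rewrite -gw; lia.
set W := w.+1.
rewrite (eq_card (B := [set z : vruns a n | (iter g (@rotz a n) z == z) &&
   ((vsum z <= a) && (npos z + (vsum z < a) == k.+1))])) => [|z]; last first.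
  by rewrite !inE andbCA.
rewrite (card_periodic (fun s c => (s <= a) && (c + (s < a) == k.+1)) gw) -/W.
(* In the first term the root has positive rank and is itself counted; in the second its rank is
   0. *)
rewrite -(cardsID [set u | W * vsum u < a]); congr (_ + _).
  case: ifP => [/dvdnP[c Ek]|ndvd]; last first.
    apply: eq_card0 => u; rewrite !inE; apply/negbTE/negP => /andP[/andP[_ /eqP E] lt].
    by move: E ndvd; rewrite lt addn1 => -[<-]; rewrite dvdn_mulr.
  rewrite Ek mulnK // -(@card_npos_vsum_le a g); last first.
    by apply: leq_trans (leq_div _ _) _; lia.
  apply: eq_card => u; rewrite !inE leq_divRL //.
  case: ltnP => lt; last by rewrite andbF; apply/esym/negbTE; rewrite mulnC; lia.
  rewrite andbT addn1 eqSS mulnC [c * _]mulnC eqn_pmul2l // mulnC.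
  by congr (_ && _); lia.
have [/andP[/dvdnP[s Ea] /dvdnP[c Ek]]|ndvd] := ifP; last first.
  apply: eq_card0 => u; rewrite !inE; apply/negbTE/negP => /andP[nlt /andP[le /eqP E]].
  have Es : W * vsum u = a by lia.
  have Wa : W %| a by apply/dvdnP; exists (vsum u); rewrite mulnC.
  move: ndvd; rewrite Wa -E (_ : (_ < a) = false) ?addn0 ?dvdn_mulr //.
  by apply/negbTE; rewrite -leqNgt Es.
have -> : a %/ W = s by rewrite Ea mulnK.
have -> : k.+1 %/ W = c by rewrite Ek mulnK.
case: c Ek => // c Ek; rewrite -(@card_npos_vsum_eq a); last first.
  have s0 : 0 < s by case: s Ea a0 => // ->.
  by rewrite s0 /=; have := leq_pmulr s (ltn0Sn w); rewrite -/W -Ea.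
apply: eq_card => u; rewrite !inE; apply/idP/andP => [/andP[nlt /andP[le /eqP E]]|[/eqP Eu /eqP Ec]].
  have Es : W * vsum u = s * W by lia.
  move: E; rewrite (_ : (_ < a) = false) ?addn0 ?Ek; last by apply/negbTE; lia.
  by move: Es; rewrite ![_ * W]mulnC => /eqP + /eqP; rewrite !eqn_pmul2l.
have Es : W * vsum u = a by rewrite Eu Ea mulnC.
have H : (W * vsum u < a) = false by rewrite Es ltnn.
by rewrite H Es leqnn addn0 Ec mulnC -Ek eqxx.
Qed.

End Periodic.

(** * Gaussian binomials *)

Section QBinomial.

Local Open Scope ring_scope.

Implicit Types n k m w : nat.

Fixpoint gbin n k : {poly int} :=
  if k is j.+1 then
    if n is m.+1 then gbin m j + 'X^(j.+1) * gbin m j.+1 else 0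
  else 1.

Lemma gbin0 n : gbin n 0 = 1. Proof. by case: n. Qed.

Lemma gbinS n k : gbin n.+1 k.+1 = gbin n k + 'X^(k.+1) * gbin n k.+1.
Proof. by []. Qed.

Lemma gbin_small n k : (n < k)%N -> gbin n k = 0.
Proof.
elim: n k => [|n IH] [|k] //; rewrite ltnS => nk.
by rewrite gbinS !IH ?mulr0 ?addr0 // ltnW.
Qed.

Lemma gbinn n : gbin n n = 1.
Proof. by elim: n => // n IH; rewrite gbinS IH gbin_small // mulr0 addr0. Qed.

Lemma qintD m n : qint (m + n) = qint m + 'X^m * qint n.
Proof.
rewrite /qint big_split_ord /= mulr_sumr; congr (_ + _).
by apply: eq_bigr => i _; rewrite exprD.
Qed.

Lemma qintSX n : qint n.+1 = 1 + 'X * qint n.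
Proof. by rewrite -add1n qintD /qint big_ord1. Qed.

Lemma qint_mulX n : (1 - 'X) * qint n = 1 - 'X^n.
Proof.
elim: n => [|n IH]; first by rewrite /qint big_ord0 mulr0 subrr.
by rewrite qintSX mulrDr mulrCA IH exprS; ring.
Qed.

Lemma qfactS n : qfact n.+1 = qfact n * qint n.+1.
Proof. by rewrite /qfact big_nat_recr. Qed.

Lemma qfact0 : qfact 0 = 1. Proof. by rewrite /qfact big_nil. Qed.

Lemma gbin_fact n k : (k <= n)%N -> gbin n k * (qfact k * qfact (n - k)) = qfact n.
Proof.
elim: n k => [|n IH] [|k] //; rewrite ?gbin0 ?qfact0 ?subn0 ?mul1r //.
rewrite ltnS subSS => kn; rewrite gbinS mulrDl.
have -> : gbin n k * (qfact k.+1 * qfact (n - k)) = qfact n * qint k.+1.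
  by rewrite -(IH k kn) qfactS; ring.
have [->|ne] := eqVneq k n; first by rewrite gbin_small // mulr0 mul0r addr0 qfactS.
have kn' : (k < n)%N by rewrite ltn_neqAle ne.
have -> : 'X^(k.+1) * gbin n k.+1 * (qfact k.+1 * qfact (n - k))
    = qfact n * ('X^(k.+1) * qint (n - k)).
  by rewrite -(IH k.+1 kn') -(subnSK kn') [qfact (n - k.+1).+1]qfactS; ring.
by rewrite -mulrDr -qintD qfactS; congr (_ * qint _); lia.
Qed.

Lemma qint_neq0 n : (0 < n)%N -> qint n != 0.
Proof.
move=> n0; apply/eqP => /(congr1 (fun p : {poly int} => p.[0])).
by case: n n0 => // n _; rewrite qintSX !hornerE.
Qed.

Lemma qfact_neq0 n : qfact n != 0.
Proof.
elim: n => [|n IH]; first by rewrite qfact0 oner_neq0.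
by rewrite qfactS mulf_neq0 // qint_neq0.
Qed.

Lemma qbinomE n k : qbinom n k = FracField.tofrac (gbin n k).
Proof.
rewrite /qbinom; case: leqP => kn; last by rewrite gbin_small ?tofrac0.
rewrite -(gbin_fact kn) -tofracM [X in X / _]tofracM mulfK //.
by rewrite tofrac_eq0 mulf_neq0 ?qfact_neq0.
Qed.

Lemma qint_gbin n k : (0 < n)%N -> (0 < k)%N ->
  qint n * gbin n.-1 k.-1 = qint k * gbin n k.
Proof.
case: n k => [|n] [|k] //= _ _; have [nk|kn] := ltnP n k.
  by rewrite -gbinS !gbin_small ?mulr0.
have nz : qfact k * qfact (n - k) != 0 by rewrite mulf_neq0 ?qfact_neq0.
apply: (mulIf nz); rewrite -gbinS.
have := gbin_fact (k := k.+1) (n := n.+1) kn; rewrite subSS qfactS => E.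
transitivity (qfact n.+1); last by rewrite -E; ring.
by rewrite -mulrA gbin_fact // qfactS mulrC.
Qed.

Section RootOfUnity.

Variables (w : nat) (zeta : algC).
Hypothesis prim : w.-primitive_root zeta.

Definition evz (p : {poly int}) : algC := (map_poly intr p).[zeta].

Lemma evzD p q : evz (p + q) = evz p + evz q.
Proof. by rewrite /evz rmorphD hornerD. Qed.

Lemma evzM p q : evz (p * q) = evz p * evz q.
Proof. by rewrite /evz rmorphM hornerM. Qed.

Lemma evz1 : evz 1 = 1. Proof. by rewrite /evz rmorph1 hornerC. Qed.

Lemma evz0 : evz 0 = 0. Proof. by rewrite /evz rmorph0 horner0. Qed.

Lemma evzXn m : evz 'X^m = zeta ^+ m.
Proof. by rewrite /evz map_polyXn hornerXn. Qed.

Let w0 : (0 < w)%N. Proof. exact: prim_order_gt0 prim. Qed.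

Lemma evz_qint m : (1 - zeta) * evz (qint m) = 1 - zeta ^+ m.
Proof.
have := congr1 evz (qint_mulX m); rewrite evzM !(evzD, rmorphN) /=.
have evN p : evz (- p) = - evz p by rewrite /evz rmorphN hornerN.
by rewrite !evN evz1 (evzXn 1) !evzXn.
Qed.

Lemma evz_qint_eq0 m : (0 < m <= w)%N -> (1 < w)%N -> (evz (qint m) == 0) = (m == w).
Proof.
move=> Hm w1; have z1 : 1 - zeta != 0.
  rewrite subr_eq0 eq_sym -(expr1 zeta) -(prim_order_dvd prim) dvdn1; lia.
have -> : (evz (qint m) == 0) = ((1 - zeta) * evz (qint m) == 0).
  by rewrite mulf_eq0 (negPf z1).
rewrite evz_qint subr_eq0 eq_sym -(prim_order_dvd prim).
by apply/idP/eqP => [/dvdn_leq|->]; [lia|exact: dvdnn].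
Qed.

Lemma evz_qint_modn m r : (1 < w)%N -> evz (qint (m * w + r)) = evz (qint r).
Proof.
move=> w1; have z1 : 1 - zeta != 0.
  rewrite subr_eq0 eq_sym -(expr1 zeta) -(prim_order_dvd prim) dvdn1; lia.
by apply: (mulfI z1); rewrite !evz_qint exprD mulnC exprM (prim_expr_order prim) expr1n mul1r.
Qed.

(** [w]! vanishes at [zeta], while [r]! and [w-r]! do not. *)
Lemma evz_gbin_order r : (0 < r < w)%N -> evz (gbin w r) = 0.
Proof.
move=> Hr; have w1 : (1 < w)%N by lia.
have fact_neq0 m : (m < w)%N -> evz (qfact m) != 0.
  elim: m => [|m IH] mw; first by rewrite qfact0 evz1 oner_neq0.
  by rewrite qfactS evzM mulf_neq0 ?IH ?evz_qint_eq0 //; lia.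
have := congr1 evz (@gbin_fact w r ltac:(lia)); rewrite evzM.
have -> : evz (qfact w) = 0.
  rewrite -(prednK w0) qfactS evzM prednK //.
  by have /eqP -> : evz (qint w) == 0; rewrite ?mulr0 // evz_qint_eq0 ?eqxx //; lia.
move/eqP; rewrite evzM !mulf_eq0 => /or3P[/eqP //|/negPn|/negPn].
  by rewrite fact_neq0 //; lia.
by rewrite fact_neq0 //; lia.
Qed.

Lemma evz_gbinS n k :
  evz (gbin n.+1 k.+1) = evz (gbin n k) + zeta ^+ k.+1 * evz (gbin n k.+1).
Proof. by rewrite gbinS evzD evzM evzXn. Qed.

Lemma q_lucas n k :
  evz (gbin n k) = 'C(n %/ w, k %/ w)%:R * evz (gbin (n %% w) (k %% w)).
Proof.
elim: n k => [|n IH] k.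
  rewrite div0n mod0n; have [kw|wk] := ltnP k w; first by rewrite divn_small // modn_small // mul1r.
  rewrite gbin_small ?evz0; last by lia.
  have kw0 : (0 < k %/ w)%N by rewrite divn_gt0.
  by rewrite bin0n eqn0Ngt kw0 mul0r.
case: k => [|k]; first by rewrite div0n mod0n bin0 !gbin0 mul1r.
have succ_mod m : ~~ (w %| m.+1)%N -> ((m %% w).+1 < w)%N.
  move=> nw; rewrite ltn_neqAle ltn_pmod // andbT; apply: contra nw => /eqP E.
  by rewrite (divn_eq m w) -addnS E dvdn_addr ?dvdnn // dvdn_mull.
have pred_mod m : (w %| m.+1)%N -> (m %% w = w.-1)%N.
  rewrite {1}(divn_eq m w) -addnS dvdn_addr ?dvdn_mull // => /dvdn_leq.
  by have := ltn_pmod m w0; lia.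
rewrite evz_gbinS !IH !(divnS _ w0) !modnS.
have nw := ltn_pmod n w0; have kw := ltn_pmod k w0.
have [wk|wk] := boolP (w %| k.+1)%N.
  have -> : zeta ^+ k.+1 = 1 by apply/eqP; rewrite -(prim_order_dvd prim).
  rewrite gbin0 evz1 mulr1 mul1r (pred_mod k wk).
  have [wn|wn] := boolP (w %| n.+1)%N.
    by rewrite (pred_mod n wn) gbinn gbin0 evz1 !mulr1 !add1n binS natrD addrC.
  have ltn : (n %% w < w.-1)%N by have := succ_mod n wn; lia.
  by rewrite gbin_small // evz0 mulr0 add0r !add0n !gbin0 evz1 mulr1.
have -> : zeta ^+ k.+1 = zeta ^+ (k %% w).+1.
  by rewrite {1}(divn_eq k w) -addnS exprD mulnC exprM (prim_expr_order prim) expr1n mul1r.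
rewrite !add0n mulrCA -mulrDr -evz_gbinS.
have [wn|wn] := boolP (w %| n.+1)%N; last by [].
(* Only [n.+1] wraps around modulo [w]: the recursion assembles [gbin w r] with 0 < r < w, which
   vanishes at [zeta]. *)
rewrite (pred_mod n wn) prednK // evz_gbin_order ?succ_mod //.
by rewrite [gbin 0 _]gbin_small // evz0 !mulr0.
Qed.

End RootOfUnity.

Lemma qint_mull x m : exists s, qint (x * m) = s * qint m.
Proof.
elim: x => [|x [s IH]]; first by exists 0; rewrite mul0n /qint big_ord0 mul0r.
by exists (s + 'X^(x * m)); rewrite mulSnr qintD IH mulrDl.
Qed.

(** From x m = y n + 1 one gets [x m] - q [y n] = 1, and [m] divides [x m], [n] divides [y n]. *)
Lemma qint_bezout m n : (0 < m)%N -> coprime m n ->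
  exists u v, u * qint m + v * qint n = 1.
Proof.
move=> m0 /eqP cop; case: (egcdnP n m0) => x y E _; rewrite cop in E.
have [s Es] := qint_mull x m; have [t Et] := qint_mull y n.
exists s, (- ('X * t)); rewrite -Es E addn1 qintSX Et; ring.
Qed.

Lemma qnarayana_exists a b k : (0 < a)%N -> (0 < b)%N -> (0 < k)%N -> coprime a b ->
  exists g, [/\ qint a * g = gbin a k * gbin b.-1 k.-1,
    qint b * g = gbin b k * gbin a.-1 k.-1 &
    qint k * g = gbin a.-1 k.-1 * gbin b.-1 k.-1].
Proof.
move=> a0 b0 k0 cop; have [u [v uv]] := qint_bezout a0 cop.
have Ea := qint_gbin a0 k0; have Eb := qint_gbin b0 k0; have kn0 := qint_neq0 k0.
(* A quotient [g] must equal [(u * qint a + v * qint b) * g], whose two products are known. *)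
exists (u * (gbin a k * gbin b.-1 k.-1) + v * (gbin b k * gbin a.-1 k.-1)).
set A := gbin a k; set B := gbin b k in Eb *; set A' := gbin a.-1 _ in Ea *.
set B' := gbin b.-1 _ in Eb *; rewrite -/A in Ea.
have Ek : qint k * (u * (A * B') + v * (B * A')) = A' * B'.
  rewrite -[RHS]mul1r -uv.
  transitivity (u * (qint k * A) * B' + v * (qint k * B) * A'); first by ring.
  by rewrite -Ea -Eb; ring.
split=> //; apply: (mulfI kn0); rewrite mulrCA Ek.
  by rewrite !mulrA Ea.
by rewrite [A' * B']mulrC !mulrA Eb.
Qed.

Lemma qNarE a b k g : (0 < a)%N ->
  qint a * g = gbin a k * gbin b.-1 k.-1 -> qNar a b k = FracField.tofrac g.
Proof.
move=> a0 E; rewrite /qNar !qbinomE -mulrA -tofracM -E tofracM mulKf //.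
by rewrite tofrac_eq0 qint_neq0.
Qed.

End QBinomial.

(** * Unimodality *)

Section Unimodality.

Local Open Scope ring_scope.

Lemma leq_card_kernel (A B : finType) (K : A -> B -> rat) :
  (forall f : A -> rat, (forall y, \sum_x f x * K x y = 0) -> forall x, f x = 0) ->
  (#|A| <= #|B|)%N.
Proof.
move=> inj; pose M : 'M[rat]_(#|A|, #|B|) := \matrix_(i, j) K (enum_val i) (enum_val j).
suff /eqP <- : \rank M == #|A| by exact: rank_leq_col.
rewrite -/(row_free M) -kermx_eq0; apply/eqP/row_matrixP => i; rewrite row0.
apply/rowP => j; rewrite [LHS]mxE [RHS]mxE.
pose f x := kermx M i (enum_rank x).
suff f0 : forall x, f x = 0 by have := f0 (enum_val j); rewrite /f enum_valK.
apply: inj => y.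
have : (kermx M *m M) i (enum_rank y) = 0 by rewrite mulmx_ker mxE.
rewrite mxE (reindex_onto enum_rank enum_val) /= => [E|k _]; last exact: enum_valK.
rewrite -[RHS]E; apply: eq_big => [x|x _]; first by rewrite enum_rankK eqxx.
by congr (_ * _); rewrite mxE !enum_rankK.
Qed.

Section Sl2.

Variables (T : finType) (lower raise : (T -> rat) -> T -> rat).
Hypothesis lower_ext : forall f g, f =1 g -> lower f =1 lower g.
Hypothesis raise_ext : forall f g, f =1 g -> raise f =1 raise g.
Hypothesis lowerZ : forall c f x, lower (fun y => c * f y) x = c * lower f x.

(* A nonzero [f] would be a highest weight vector of negative weight [2 r - N],
   which no finite-dimensional representation has. *)
Lemma sl2_injective (r N : int) f : 2 * r < N ->
  raise f =1 (fun=> 0) ->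
  (forall j x, raise (iter j.+1 lower f) x =
     lower (raise (iter j lower f)) x + ((2 * r - 2 * j%:Z - N)%:~R) * iter j lower f x) ->
  (exists M, iter M lower f =1 (fun=> 0)) -> f =1 (fun=> 0).
Proof.
move=> rN f0 comm [M HM].
have H j : exists2 c : int, c < 0 &
    forall x, raise (iter j.+1 lower f) x = c%:~R * iter j lower f x.
  elim: j => [|j [c c0 IH]].
    exists (2 * r - N) => [|x]; first by lia.
    rewrite comm (lower_ext f0) /= subr0.
    have -> : lower (fun=> 0) x = 0.
      rewrite -[RHS](mul0r (lower (fun=> 0) x)) -lowerZ; apply: lower_ext => y.
      by rewrite mulr0.
    by rewrite add0r.
  exists (c + (2 * r - 2 * j.+1%:Z - N)) => [|x]; first by lia.
  rewrite comm (lower_ext IH) lowerZ; move: (_ - N) => e.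
  by rewrite intrD mulrDl.
have raise0 x : raise (fun=> 0) x = 0.
  have [c c0 E] := H M.
  have := E x; rewrite HM mulr0 => E0; rewrite -[RHS]E0; apply: raise_ext => y /=.
  rewrite -[LHS](mul0r (lower (fun=> 0) y)) -lowerZ.
  by apply: lower_ext => z; rewrite HM mulr0.
elim: M HM => // M IH HM; apply: IH => x; have [c c0 E] := H M.
have := E x; rewrite (raise_ext HM) raise0 => /esym/eqP.
by rewrite mulf_eq0 intr_eq0 lt_eqF //= => /eqP.
Qed.

End Sl2.

(** * Raising and lowering operators on functions graded by rank *)

Section Graded.

Variables (T : finType) (Y : pred T) (rk : T -> nat) (N : int) (h : T -> int).
Variables (KL KR : T -> T -> rat).

Implicit Types (K : T -> T -> rat) (f g : T -> rat) (x y : T).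

Definition act (K : T -> T -> rat) (f : T -> rat) (x : T) : rat := \sum_y f y * K x y.

Hypothesis KLrk : forall x y, KL x y != 0 -> Y y -> Y x /\ rk y = (rk x).+1.
Hypothesis KRrk : forall x y, KR x y != 0 -> Y y -> Y x /\ rk x = (rk y).+1.
Hypothesis comm : forall f x, act KR (act KL f) x =
  act KL (act KR f) x + (h x)%:~R * f x.
Hypothesis hY : forall x, Y x -> h x = 2 * (rk x)%:Z - N.

Definition level r := [set x | Y x && (rk x == r)].

Definition supp (f : T -> rat) (r : nat) := forall x, f x != 0 -> Y x /\ rk x = r.

Lemma act_neq0 K f x : act K f x != 0 -> exists y, f y != 0 /\ K x y != 0.
Proof.
move=> H; have /existsP[y /andP[? ?]] : [exists y, (f y != 0) && (K x y != 0)].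
  apply: contraNT H; rewrite negb_exists => /forallP H; rewrite /act big1 // => y _.
  by apply/eqP; rewrite mulf_eq0 -[_ || _]negbK negb_or H.
by exists y.
Qed.

Lemma act_ext K f g : f =1 g -> act K f =1 act K g.
Proof. by move=> E x; apply: eq_bigr => y _; rewrite E. Qed.

Lemma actZ K c f x : act K (fun y => c * f y) x = c * act K f x.
Proof. by rewrite /act mulr_sumr; apply: eq_bigr => y _; rewrite mulrA. Qed.

Lemma supp_raise f r : supp f r -> supp (act KR f) r.+1.
Proof.
move=> sf x /act_neq0[y [fy Kxy]]; have [Yy ry] := sf y fy.
by have [Yx ->] := KRrk Kxy Yy; rewrite ry.
Qed.

Lemma supp_lower f r : supp f r.+1 -> supp (act KL f) r.
Proof.
move=> sf x /act_neq0[y [fy Kxy]]; have [Yy ry] := sf y fy.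
by have [Yx] := KLrk Kxy Yy; rewrite ry => -[].
Qed.

Lemma lower_bottom f : supp f 0 -> act KL f =1 (fun=> 0).
Proof.
move=> sf x; apply/eqP; apply: contraT => /act_neq0[y [fy Kxy]].
by have [Yy ry] := sf y fy; have [_] := KLrk Kxy Yy; rewrite ry.
Qed.

Lemma act0 K x : act K (fun=> 0) x = 0.
Proof. by rewrite /act big1 // => y _; rewrite mul0r. Qed.

Lemma supp_iter_lower f r j : supp f r -> (j <= r)%N ->
  supp (iter j (act KL) f) (r - j).
Proof.
move=> sf; elim: j => [|j IH] jr; first by rewrite subn0.
by rewrite iterS; apply: supp_lower; rewrite subnSK //; apply: IH; apply: ltnW.
Qed.

Lemma iter_lower_top f r j : supp f r -> iter (r.+1 + j) (act KL) f =1 (fun=> 0).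
Proof.
move=> sf; elim: j => [|j IH] x.
  rewrite addn0 iterS lower_bottom //.
  by have := supp_iter_lower sf (leqnn r); rewrite subnn.
by rewrite addnS iterS (act_ext _ IH) act0.
Qed.

Lemma supp_iter_raise f r j : supp f r -> supp (iter j (act KR) f) (r + j).
Proof.
move=> sf; elim: j => [|j IH]; first by rewrite addn0.
by rewrite iterS addnS; apply: supp_raise.
Qed.

Lemma raise_injective f r : supp f r -> 2 * r%:Z < N -> act KR f =1 (fun=> 0) ->
  f =1 (fun=> 0).
Proof.
move=> sf rN f0.
apply: (@sl2_injective T (act KL) (act KR) (@act_ext KL) (@act_ext KR) (@actZ KL) r N)
  => //.
  move=> j x; rewrite iterS comm; congr (_ + _).
  have [E|ne] := eqVneq (iter j (act KL) f x) 0; first by rewrite E !mulr0.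
  congr (_%:~R * _); have [jr|rj] := leqP j r.
    by have [/hY -> ->] := supp_iter_lower sf jr ne; lia.
  by move: ne; rewrite -(subnKC rj) iter_lower_top ?eqxx.
by exists (r.+1 + 0)%N; apply: iter_lower_top.
Qed.

Lemma lower_injective f r : supp f r -> N < 2 * r%:Z -> act KL f =1 (fun=> 0) ->
  f =1 (fun=> 0).
Proof.
move=> sf rN f0.
(* Exchanging the two operators negates the weights, so level [r] plays the part of [N - r].
   Nilpotency now comes from the bound on ranks in a finite type. *)
apply: (@sl2_injective T (act KR) (act KL) (@act_ext KR) (@act_ext KL) (@actZ KR)
  (N - r%:Z) N) => //; first by lia.
  move=> j x; rewrite iterS comm -addrA -mulrDl.
  have [E|ne] := eqVneq (iter j (act KR) f x) 0; first by rewrite E !mulr0 addr0.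
  have [/hY -> ->] := supp_iter_raise (j := j) sf ne.
  by rewrite -rmorphD /= (_ : (_ + _)%R = 0) ?mul0r ?addr0 //; lia.
exists (\max_(x : T) rk x).+1%N => x; apply/eqP; apply: contraT => ne.
have [_ E] := supp_iter_raise (j := (\max_(x : T) rk x).+1) sf ne.
by have := leq_bigmax (F := rk) x; rewrite E; lia.
Qed.

Lemma level_le (K : T -> T -> rat) r s :
  (forall f, supp f r -> supp (act K f) s) ->
  (forall f, supp f r -> act K f =1 (fun=> 0) -> f =1 (fun=> 0)) ->
  (#|level r| <= #|level s|)%N.
Proof.
move=> sK inj; have -> : #|level r| = #|{: {x | x \in level r}}| by rewrite card_sig.
have -> : #|level s| = #|{: {x | x \in level s}}| by rewrite card_sig.
pose K' (x : {x | x \in level r}) (y : {x | x \in level s}) := K (val y) (val x).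
apply: (@leq_card_kernel _ _ K') => f Hf x.
pose g y := if insub y is Some u then f u else 0 : rat.
have gE u : g (val u) = f u by rewrite /g valK.
have sg : supp g r.
  by move=> y; rewrite /g; case: insubP => [u|]; rewrite ?eqxx // inE => /andP[Yy /eqP ry] _ _.
rewrite -gE (inj g) // => y; apply/eqP; apply: contraT => ne.
have yl : y \in level s by have [Yy ry] := sK _ sg _ ne; rewrite inE Yy ry eqxx.
move: ne; rewrite -(Hf (Sub y yl)) /act.
rewrite (bigID (fun x => x \in level r)) /= [X in _ + X]big1 ?addr0 => [|z]; last first.
  by rewrite /g; case: insubP => [u -> //|_ _]; rewrite mul0r.
by rewrite big_sub => /eqP[]; apply: eq_bigr => u _; rewrite gE.
Qed.

Lemma level_up r : 2 * r%:Z < N -> (#|level r| <= #|level r.+1|)%N.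
Proof.
move=> rN; apply: (level_le (K := KR)) => f sf; first exact: supp_raise.
exact: raise_injective sf rN.
Qed.

Lemma level_down r : N < 2 * (r.+1)%:Z -> (#|level r.+1| <= #|level r|)%N.
Proof.
move=> rN; apply: (level_le (K := KL)) => f sf; first exact: supp_lower.
exact: lower_injective sf rN.
Qed.

End Graded.

End Unimodality.

(** * The sl2-action on subsets of chains *)

Section Chains.

Local Open Scope ring_scope.

Section Moves.

Variables (T I : finType) (s : I -> T -> T) (cR cL : I -> T -> rat).

Definition kernel (c : I -> T -> rat) (x y : T) : rat := \sum_i c i x * (y == s i x)%:R.

Lemma act_kernel c f x : act (kernel c) f x = \sum_i c i x * f (s i x).
Proof.
rewrite /act /kernel; under eq_bigr do rewrite mulr_sumr; rewrite exchange_big /=.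
apply: eq_bigr => i _; rewrite (bigD1 (s i x)) //= eqxx big1 => [|y /negPf ->].
  by rewrite mulr1 addr0 mulrC.
by rewrite !mulr0.
Qed.

Lemma kernel_neq0 c x y : kernel c x y != 0 -> exists2 i, c i x != 0 & y = s i x.
Proof.
move=> H; have /existsP[i /andP[ci /eqP Ey]] : [exists i, (c i x != 0) && (y == s i x)].
  apply: contraNT H; rewrite negb_exists => /forallP H; rewrite /kernel big1 // => i _.
  have := H i; rewrite negb_and negbK; have [_|_] := eqVneq y (s i x); last by rewrite mulr0.
  rewrite orbF => /eqP ->.
  by rewrite mul0r.
by exists i.
Qed.

Hypothesis commute : forall i j x, i != j ->
  cR i x * cL j (s i x) = cL j x * cR i (s j x) /\
  (cR i x * cL j (s i x) != 0 -> s j (s i x) = s i (s j x)).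
Hypothesis involutive_move : forall i x, s i (s i x) = x.

(** Terms with [i != j] cancel by [commute]; those with [i = j] return to [x] because moves are
    involutive, and leave a scalar. *)
Lemma kernel_comm f x :
  act (kernel cR) (act (kernel cL) f) x = act (kernel cL) (act (kernel cR) f) x +
  (\sum_i (cR i x * cL i (s i x) - cL i x * cR i (s i x))) * f x.
Proof.
rewrite !act_kernel.
under eq_bigr do rewrite act_kernel mulr_sumr.
under [in X in _ = X + _]eq_bigr do rewrite act_kernel mulr_sumr.
rewrite [X in _ = X + _]exchange_big /= mulr_suml -big_split /=.
apply: eq_bigr => i _; rewrite (bigD1 i) //= [in RHS](bigD1 i) //= !involutive_move.
rewrite addrAC mulrBl !mulrA addrCA subrr addr0; congr (_ + _).
apply: eq_bigr => j ji; rewrite !mulrA.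
have [E H] := commute x (i := i) (j := j) ltac:(by rewrite eq_sym).
have [E0|ne] := eqVneq (cR i x * cL j (s i x)) 0; first by rewrite -E E0 !mul0r.
by rewrite -E H.
Qed.

End Moves.

Section Bits.

Variable p : nat.
Implicit Types (x : p.-tuple bool) (i j : nat).

Definition bit x j := nth false x j.

Definition twist i j := if j == i then i.+1 else if j == i.+1 then i else j.

Definition swap i x : p.-tuple bool := [tuple bit x (twist i j) | j < p].

Lemma twistK i : involutive (twist i).
Proof. by move=> j; rewrite /twist; do !case: eqP => //=; lia. Qed.

Lemma twistl i : twist i i = i.+1.
Proof. by rewrite /twist eqxx. Qed.

Lemma twistr i : twist i i.+1 = i.
Proof. by rewrite /twist eqxx ifF //; apply/eqP; lia. Qed.

Lemma twist_id i j : j != i -> j != i.+1 -> twist i j = j.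
Proof. by rewrite /twist => /negPf -> /negPf ->. Qed.

Lemma twist_lt i j : (i.+1 < p)%N -> (twist i j < p)%N = (j < p)%N.
Proof. by move=> ip; rewrite /twist; case: eqP => [->|_]; [|case: eqP => [->|_] //]; lia. Qed.

Lemma bit_over x j : (p <= j)%N -> bit x j = false.
Proof. by move=> pj; rewrite /bit nth_default // size_tuple. Qed.

Lemma bit_swap i x j : (i.+1 < p)%N -> bit (swap i x) j = bit x (twist i j).
Proof.
move=> ip; have [jp|pj] := ltnP j p.
  by rewrite {1}/bit (nth_mktuple _ _ (Ordinal jp)).
by rewrite !bit_over // leqNgt twist_lt // -leqNgt.
Qed.

Lemma bit_inj x y : (forall j, bit x j = bit y j) -> x = y.
Proof. by move=> E; apply: eq_from_tnth => j; rewrite !(tnth_nth false); apply: E. Qed.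

Lemma swapK i x : (i.+1 < p)%N -> swap i (swap i x) = x.
Proof. by move=> ip; apply: bit_inj => j; rewrite !bit_swap // twistK. Qed.

Definition cnt x := (\sum_(j < p) bit x j)%N.
Definition possum x := (\sum_(j < p) j * bit x j)%N.

Lemma sum_swap i x (F : nat -> nat) : (i.+1 < p)%N ->
  (\sum_(j < p) F j * bit (swap i x) j + F i * bit x i + F i.+1 * bit x i.+1 =
   \sum_(j < p) F j * bit x j + F i * bit x i.+1 + F i.+1 * bit x i)%N.
Proof.
move=> ip; pose a := Ordinal (ltnW ip); pose b := Ordinal ip.
have ab : b != a by rewrite -val_eqE /=; lia.
rewrite (bigD1 a) // (bigD1 b) //= [in RHS](bigD1 a) // [in RHS](bigD1 b) //=.
rewrite !bit_swap // /twist eqxx (_ : i.+1 == i = false); last by lia.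
rewrite eqxx (eq_bigr (fun j : 'I_p => F j * bit x j)%N) => [|j /andP[ja jb]]; first by lia.
rewrite bit_swap // /twist; move: ja jb; rewrite -!val_eqE /= => /negPf -> /negPf ->.
by [].
Qed.

(* A subset of a chain of [p] points stands for a wedge of weight vectors of the
   irreducible representation of dimension [p]; [wt i] is the product of the
   two matrix entries of sl2 between the weight vectors [i] and [i.+1]. *)
Definition wt i : rat := i.+1%:R * (p.-1 - i)%:R.

(** [cup] reads at [x] the value at [swap i x], so it moves an occupied point from [i] up to [i.+1].
    The whole factor [wt i] sits here and [cdown] has coefficient 1. No sign of the wedge appears,
    since an occupied point only trades places with an adjacent free one. *)
Definition cup (i : 'I_p.-1) x : rat := wt i * (~~ bit x i && bit x i.+1)%:R.
Definition cdown (i : 'I_p.-1) x : rat := (bit x i && ~~ bit x i.+1)%:R.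

(** For neighbouring [i] and [j] both products vanish, as the shared point would have to be both
    free and occupied; otherwise the moves act on disjoint pairs. *)
Lemma chain_commute (i j : 'I_p.-1) x : i != j ->
  cup i x * cdown j (swap i x) = cdown j x * cup i (swap j x) /\
  (cup i x * cdown j (swap i x) != 0 -> swap j (swap i x) = swap i (swap j x)).
Proof.
rewrite -val_eqE /= => ij.
have ip : (i.+1 < p)%N by have := ltn_ord i; lia.
have jp : (j.+1 < p)%N by have := ltn_ord j; lia.
rewrite /cup /cdown !bit_swap //.
have [E|ne1] := eqVneq (j : nat) i.+1.
  rewrite E twistr (twist_id (i := i) (j := i.+2)) ?(twist_id (i := i.+1) (j := i)) ?twistl; try lia.
  by case: (bit x i); case: (bit x i.+1); case: (bit x i.+2); rewrite /= ?(mulr0, mul0r) ?eqxx.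
have [E|ne2] := eqVneq (i : nat) j.+1.
  rewrite E twistl (twist_id (i := j.+1) (j := j)) ?(twist_id (i := j) (j := j.+2)) ?twistr; try lia.
  by case: (bit x j); case: (bit x j.+1); case: (bit x j.+2); rewrite /= ?(mulr0, mul0r) ?eqxx.
rewrite !twist_id; try lia.
split=> [|_]; first by rewrite mulrC.
apply: bit_inj => u; rewrite !bit_swap //; congr (bit x _); rewrite /twist.
by do !case: eqP => //=; lia.
Qed.

Lemma cup_swap (i : 'I_p.-1) x : (i.+1 < p)%N ->
  cup i x * cdown i (swap i x) - cdown i x * cup i (swap i x) =
  wt i * ((bit x i.+1)%:R - (bit x i)%:R).
Proof.
move=> ip; rewrite /cup /cdown !bit_swap // twistl twistr.
by case: (bit x i); case: (bit x i.+1); rewrite /=; ring.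
Qed.


(** By summation by parts, an occupied point [j] contributes j (p-j) - (j+1) (p-1-j) = 2 j -
    (p-1). *)
Lemma chain_weight x :
  \sum_(i < p.-1) (cup i x * cdown i (swap i x) - cdown i x * cup i (swap i x)) =
  (2 * (possum x)%:Z - (p.-1 * cnt x)%N%:Z)%:~R.
Proof.
rewrite (eq_bigr (fun i : 'I_p.-1 => wt i * ((bit x i.+1)%:R - (bit x i)%:R))); last first.
  by move=> i _; apply: cup_swap; have := ltn_ord i; lia.
have -> : ((2 * (possum x)%:Z - (p.-1 * cnt x)%N%:Z)%:~R : rat) =
    \sum_(j < p) ((2 * j)%:R - p.-1%:R) * (bit x j)%:R.
  rewrite /possum /cnt intrB intrM -!pmulrn natrM !natr_sum !mulr_sumr -sumrB.
  by apply: eq_bigr => j _; rewrite !natrM; ring.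
rewrite /wt; move: (bit x) => c; case: p => [|m] /=; first by rewrite !big_ord0.
under eq_bigr do rewrite mulrBr.
rewrite sumrB.
have -> : \sum_(i < m) i.+1%:R * (m - i)%:R * (c i.+1)%:R =
    \sum_(j < m.+1) j%:R * (m.+1 - j)%:R * (c j)%:R :> rat.
  rewrite big_ord_recl /= !mul0r add0r; apply: eq_bigr => i _.
  by rewrite /bump /= add1n subSS.
have -> : \sum_(i < m) i.+1%:R * (m - i)%:R * (c i)%:R =
    \sum_(j < m.+1) j.+1%:R * (m - j)%:R * (c j)%:R :> rat.
  by rewrite [RHS]big_ord_recr /= subnn mulr0 mul0r addr0.
rewrite -sumrB; apply: eq_bigr => j _; have jm : (j <= m)%N by rewrite -ltnS.
rewrite -mulrBl; congr (_ * _); rewrite subSn // natrM; move: (nat_of_ord j) jm => i im.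
by rewrite -!natr1 natrB //; ring.
Qed.

End Bits.

(** * Two chains, for a product of two Gaussian binomials *)

Section Pairs.

Variables (p1 p2 c1 c2 : nat).

Local Notation T := (p1.-tuple bool * p2.-tuple bool)%type.
Local Notation I := ('I_p1.-1 + 'I_p2.-1)%type.

Let lt_pred p (i : 'I_p.-1) : (i.+1 < p)%N.
Proof. by have := ltn_ord i; lia. Qed.

Definition move2 (i : I) (x : T) : T :=
  match i with inl j => (swap j x.1, x.2) | inr j => (x.1, swap j x.2) end.
Definition up2 (i : I) (x : T) : rat :=
  match i with inl j => cup j x.1 | inr j => cup j x.2 end.
Definition down2 (i : I) (x : T) : rat :=
  match i with inl j => cdown j x.1 | inr j => cdown j x.2 end.

Definition counted (x : T) := (cnt x.1 == c1) && (cnt x.2 == c2).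
Definition rank2 (x : T) := (possum x.1 + possum x.2)%N.

Lemma cdown_swap p (i : 'I_p.-1) (x : p.-tuple bool) : cdown i x != 0 ->
  cnt (swap i x) = cnt x /\ possum (swap i x) = (possum x).+1.
Proof.
rewrite /cdown; case Ei : (bit x i); case Ei' : (bit x i.+1); rewrite ?eqxx //= => _.
have cntE (u : p.-tuple bool) : cnt u = (\sum_(j < p) 1 * bit u j)%N.
  by apply: eq_bigr => j _; rewrite mul1n.
have := sum_swap x (fun=> 1%N) (lt_pred i); have := sum_swap x id (lt_pred i).
rewrite -!cntE -!/(possum _) Ei Ei'; lia.
Qed.

Lemma cup_swapE p (i : 'I_p.-1) (x : p.-tuple bool) : cup i x != 0 ->
  cdown i (swap i x) != 0.
Proof.
rewrite /cup /cdown !bit_swap // twistl twistr.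
by case: (bit x i); case: (bit x i.+1); rewrite /= ?mulr0 ?eqxx ?oner_neq0.
Qed.

Lemma down2_rank i x : down2 i x != 0 -> counted (move2 i x) = counted x /\
  rank2 (move2 i x) = (rank2 x).+1.
Proof.
by case: i => i /= /cdown_swap[E1 E2]; rewrite /counted /rank2 /= E1 E2 ?addSn ?addnS.
Qed.

Lemma move2K i x : move2 i (move2 i x) = x.
Proof. by case: x => x y; case: i => i /=; rewrite swapK. Qed.

Lemma up2_down2 i x : up2 i x != 0 -> down2 i (move2 i x) != 0.
Proof. by case: i => i /=; apply: cup_swapE. Qed.

Lemma move2_commute i j x : i != j ->
  up2 i x * down2 j (move2 i x) = down2 j x * up2 i (move2 j x) /\
  (up2 i x * down2 j (move2 i x) != 0 -> move2 j (move2 i x) = move2 i (move2 j x)).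
Proof.
case: x => x y; case: i j => [i|i] [j|j] //= ij.
- have [|E H] := @chain_commute p1 i j x; first by apply: contra ij => /eqP ->.
  by split=> // /H ->.
- by split=> //; rewrite mulrC.
- by split=> //; rewrite mulrC.
have [|E H] := @chain_commute p2 i j y; first by apply: contra ij => /eqP ->.
by split=> // /H ->.
Qed.

Definition weight2 (x : T) : int :=
  2 * (rank2 x)%:Z - (p1.-1 * cnt x.1 + p2.-1 * cnt x.2)%N%:Z.

Lemma move2_comm f x :
  act (kernel move2 up2) (act (kernel move2 down2) f) x =
  act (kernel move2 down2) (act (kernel move2 up2) f) x + (weight2 x)%:~R * f x.
Proof.
rewrite (kernel_comm move2_commute move2K); congr (_ + _ * _).
rewrite big_sumType /= !chain_weight -intrD; congr (_%:~R).
by rewrite /weight2 /rank2; lia.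
Qed.

Definition center2 : int := (p1.-1 * c1 + p2.-1 * c2)%N%:Z.

Lemma counted_weight x : counted x -> weight2 x = 2 * (rank2 x)%:Z - center2.
Proof. by rewrite /weight2 => /andP[/eqP -> /eqP ->]. Qed.

Lemma down_rank x y : kernel move2 down2 x y != 0 -> counted y ->
  counted x /\ rank2 y = (rank2 x).+1.
Proof. by case/kernel_neq0 => i /down2_rank[E1 E2] ->; rewrite E1 E2. Qed.

Lemma up_rank x y : kernel move2 up2 x y != 0 -> counted y ->
  counted x /\ rank2 x = (rank2 y).+1.
Proof.
by case/kernel_neq0 => i /up2_down2 /down2_rank[]; rewrite move2K => E1 E2 ->; rewrite E1 E2.
Qed.

Lemma level2_up r : 2 * r%:Z < center2 ->
  (#|level counted rank2 r| <= #|level counted rank2 r.+1|)%N.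
Proof. exact: (level_up down_rank up_rank move2_comm counted_weight). Qed.

Lemma level2_down r : center2 < 2 * (r.+1)%:Z ->
  (#|level counted rank2 r.+1| <= #|level counted rank2 r|)%N.
Proof. exact: (level_down down_rank up_rank move2_comm counted_weight). Qed.

End Pairs.

Lemma cnt_cons p (b : bool) (t : p.-tuple bool) : cnt (cons_tuple b t) = (b + cnt t)%N.
Proof. by rewrite /cnt big_ord_recl. Qed.

Lemma possum_cons p (b : bool) (t : p.-tuple bool) :
  possum (cons_tuple b t) = (possum t + cnt t)%N.
Proof.
rewrite /possum /cnt big_ord_recl /= add0n -big_split /=; apply: eq_bigr => j _.
by rewrite /bump /= mulnDl mul1n addnC.
Qed.

(** The exponent ['C(c, 2)] is the smallest sum of [c] distinct positions, 0 + 1 + ... + (c-1). *)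
Lemma gbin_possum p c :
  \sum_(x : p.-tuple bool | cnt x == c) 'X^(possum x) = 'X^'C(c, 2) * gbin p c :> {poly int}.
Proof.
elim: p c => [|p IH] c.
  have all0 (x : 0.-tuple bool) : cnt x = 0%N /\ possum x = 0%N by rewrite /cnt /possum !big_ord0.
  rewrite (eq_big (fun=> c == 0%N) (fun=> 1)) => [|x|x _]; last 2 first.
  - by have [-> _] := all0 x; rewrite eq_sym.
  - by have [_ ->] := all0 x; rewrite expr0.
  case: c => [|c] /=; last by rewrite big_pred0_eq mulr0.
  by rewrite sumr_const card_tuple expn0 mulr1n bin0n expr0 mulr1.
rewrite big_mkcond big_tupleS big_bool /= -!big_mkcond /=.
rewrite (eq_big (fun t : p.-tuple bool => (cnt t).+1 == c) (fun t => 'X^(possum t + cnt t)));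
  last 2 first.
- by move=> t; rewrite cnt_cons.
- by move=> t _; rewrite possum_cons.
rewrite [X in _ + X](eq_big (fun t : p.-tuple bool => cnt t == c) (fun t => 'X^(possum t + cnt t)));
  last 2 first.
- by move=> t; rewrite cnt_cons.
- by move=> t _; rewrite possum_cons.
have shift c' : \sum_(t : p.-tuple bool | cnt t == c') 'X^(possum t + cnt t) =
    'X^c' * ('X^'C(c', 2) * gbin p c') :> {poly int}.
  by rewrite -IH mulr_sumr; apply: eq_bigr => t /eqP ->; rewrite addnC exprD.
rewrite shift; case: c => [|c].
  by rewrite big_pred0 // add0r bin0n !gbin0 expr0 !mulr1.
under eq_bigl do rewrite eqSS.
by rewrite shift binS bin1 !exprD; ring.
Qed.

Section Positivity.

Variables (p1 p2 c1 c2 : nat).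

Local Notation lev := (level (@counted p1 p2 c1 c2) (@rank2 p1 p2)).
Local Notation shift := ('C(c1, 2) + 'C(c2, 2))%N.
Local Notation F := (gbin p1 c1 * gbin p2 c2).

Lemma coef_gbinM i : F`_i = #|lev (i + shift)%N|%:R.
Proof.
have E : 'X^shift * F = \sum_(x | @counted p1 p2 c1 c2 x) 'X^(rank2 x).
  transitivity (('X^'C(c1, 2) * gbin p1 c1) * ('X^'C(c2, 2) * gbin p2 c2)).
    by rewrite exprD; ring.
  rewrite -!gbin_possum big_distrlr pair_big /=.
  by apply: eq_bigr => x _; rewrite -exprD.
have := congr1 (fun q : {poly int} => q`_(i + shift)%N) E.
rewrite /= coefXnM ltnNge leq_addl /= addnK => ->.
rewrite coef_sum -sum1_card natr_sum big_mkcond [RHS]big_mkcond /=.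
apply: eq_bigr => x _; rewrite inE coefXn eq_sym.
by case: (counted _ _ x); case: (_ == _).
Qed.

(** This is c1 (p1-c1) + c2 (p2-c2), the degree of the product when c1 <= p1 and c2 <= p2, so N/2 is
    its centre. *)
Local Notation N := (center2 p1 p2 c1 c2 - 2 * shift%:Z).

Lemma gbinM_up i : 2 * i%:Z < N -> F`_i <= F`_i.+1.
Proof.
move=> iN; rewrite !coef_gbinM ler_nat addSn; apply: level2_up; lia.
Qed.

Lemma gbinM_down i : N < 2 * i.+1%:Z -> F`_i.+1 <= F`_i.
Proof.
move=> iN; rewrite !coef_gbinM ler_nat addSn; apply: level2_down; lia.
Qed.

Lemma gbinM_ge0 i : 0 <= F`_i. Proof. by rewrite coef_gbinM ler0n. Qed.

(** Compare coefficients in (1 - q^k) g = (1 - q) F. Up to N/2, g_n is g_(n-k) plus a nonnegative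
    increment of F. Beyond N/2, g_n is g_(n+k) plus a nonnegative decrement of F, and the induction
    starts past the size of [g]. *)
Lemma div_qint_ge0 k (g : {poly int}) : (0 < k)%N -> qint k * g = F -> forall i, 0 <= g`_i.
Proof.
move=> k0 Eg.
have rec n : g`_n - (if (n < k)%N then 0 else g`_(n - k)) =
    F`_n - (if n is m.+1 then F`_m else 0).
  have : (1 - 'X^k) * g = (1 - 'X) * F by rewrite -qint_mulX -Eg mulrA.
  move/(congr1 (fun q : {poly int} => q`_n)); rewrite /= !mulrBl !mul1r !coefB coefXnM coefXM.
  by case: n.
have up n : 2 * n%:Z <= N -> 0 <= g`_n.
  elim/ltn_ind: n => n IH nN; have := rec n.
  have g0 : 0 <= (if (n < k)%N then 0 else g`_(n - k)).
    by case: ltnP => // kn; apply: IH; lia.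
  case: n nN g0 {IH} => [|m] nN g0; first by have := gbinM_ge0 0; lia.
  by have := @gbinM_up m ltac:(lia); lia.
have down t n : N < 2 * n%:Z -> (size g <= n + t)%N -> 0 <= g`_n.
  elim: t n => [|t IH] n nN sz; first by rewrite addn0 in sz; rewrite nth_default.
  have := rec (n + k)%N; rewrite ltnNge leq_addl /= addnK.
  have := IH (n + k)%N ltac:(lia) ltac:(lia).
  have -> : (n + k = (n + k.-1).+1)%N by lia.
  by rewrite /=; have := @gbinM_down (n + k.-1)%N ltac:(lia); lra.
move=> i; have [iN|Ni] := lerP (2 * i%:Z) N; first exact: up.
by apply: (down (size g)) => //; lia.
Qed.

End Positivity.

End Chains.

(** * The sieving phenomenon *)

Section Evaluation.

Definition fixed_count a g w k :=
  (if w %| k then 'C(g, k %/ w) * 'C(a.-1 %/ w, k %/ w) else 0)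
    + (if (w %| a) && (w %| k.+1)
       then 'C(g, k.+1 %/ w) * 'C((a %/ w).-1, (k.+1 %/ w).-1) else 0).

Lemma modn_pred m w : w %| m.+1 -> m %% w = w.-1.
Proof.
have [->|w0] := posnP w; first by rewrite dvd0n.
rewrite {1}(divn_eq m w) -addnS dvdn_addr ?dvdn_mull // => /dvdn_leq.
by have := ltn_pmod m w0; lia.
Qed.

Local Open Scope ring_scope.

(** The factor on the left is the value of [n+1] at [zeta]. For w > 1, [n.+1] is 1 modulo [w], so in
    the q-Lucas formula only [k.+1] congruent to 0 or 1 modulo [w] survives: these are the two terms
    of [fixed_count]. *)
Lemma evz_narayana a g w k n (zeta : algC) (p : {poly int}) : (0 < a)%N ->
  w.-primitive_root zeta -> (g * w)%N = n ->
  qint n.+1 * p = gbin n.+1 k.+1 * gbin a.-1 k ->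
  (if w == 1%N then n.+1%:R else 1) * evz zeta p = (fixed_count a g w k)%:R.
Proof.
move=> a0 prim gw /(congr1 (evz zeta)); rewrite !evzM.
have w0 := prim_order_gt0 prim.
have [w1|w1] := eqVneq w 1%N.
  have z1 : zeta = 1 by move: prim; rewrite w1 => /prim_expr_order; rewrite expr1.
  have -> : evz zeta (qint n.+1) = n.+1%:R.
    rewrite /evz /qint rmorph_sum /= horner_sum (eq_bigr (fun=> 1)) => [|i _].
      by rewrite sumr_const card_ord.
    by rewrite map_polyXn hornerXn z1 expr1n.
  move=> ->; rewrite (q_lucas prim n.+1 k.+1) (q_lucas prim a.-1 k) w1.
  rewrite !divn1 !modn1 !gbin0 evz1 !mulr1 -natrM.
  congr (_%:R); rewrite /fixed_count !dvd1n !divn1 /= -gw w1 muln1 binS mulnDl addnC.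
  by [].
have w2 : (1 < w)%N by lia.
have -> : evz zeta (qint n.+1) = 1.
  rewrite -gw -addn1 (evz_qint_modn prim) // /qint big_ord1.
  by rewrite expr0 evz1.
rewrite !mul1r => ->; rewrite (q_lucas prim n.+1 k.+1) (q_lucas prim a.-1 k).
have -> : (n.+1 %/ w = g)%N.
  by rewrite -gw divnS // mulnK // /dvdn -addn1 modnMDl modn_small // addn0.
have -> : (n.+1 %% w = 1)%N by rewrite -gw -addn1 modnMDl modn_small.
rewrite /fixed_count divnS // modnS.
have [wk|wk] := boolP (w %| k.+1)%N.
  have -> : (w %| k)%N = false.
    by apply/negbTE; rewrite /dvdn (modn_pred wk); lia.
  rewrite gbin0 evz1 mulr1 add0n andbT add1n /= (modn_pred wk).
  have [wa|wa] := boolP (w %| a)%N; last first.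
    rewrite gbin_small ?evz0 ?mulr0 // ltn_neqAle.
    have : (a.-1 %% w < w)%N by rewrite ltn_pmod.
    rewrite -{2}(prednK w0) ltnS => ->; rewrite andbT; apply: contra wa => /eqP E.
    by rewrite -(prednK a0) (divn_eq a.-1 w) -addnS E prednK // dvdn_addr ?dvdnn // dvdn_mull.
  have wa' : (w %| a.-1.+1)%N by rewrite prednK.
  rewrite (modn_pred wa') gbinn evz1 mulr1 -natrM; congr ((_ * 'C(_, _))%:R).
  by rewrite -[in RHS](prednK a0) divnS // wa'.
rewrite andbF addn0 add0n.
have [wk'|wk'] := boolP (w %| k)%N.
  have -> : (k %% w = 0)%N by apply/eqP.
  by rewrite gbinn gbin0 evz1 !mulr1 natrM.
rewrite [gbin 1 _]gbin_small ?evz0 ?mulr0 ?mul0r //.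
by move: wk'; rewrite /dvdn; lia.
Qed.

End Evaluation.

Lemma iter_gcd (T : Type) (f : T -> T) x d n : iter n f x = x ->
  iter d f x = x <-> iter (gcdn d n) f x = x.
Proof.
move=> fn; split=> [fd|fg]; last first.
  by have /dvdnP[q ->] := dvdn_gcdl d n; apply: iter_fixed.
have [->|d0] := posnP d; first by rewrite gcd0n.
case: (egcdnP n d0) => u v E _.
have := iter_fixed u fd; rewrite E addnC iterD.
by rewrite (iter_fixed v fn).
Qed.

Section Main.

Variables a n : nat.
Hypotheses (a0 : 0 < a) (n0 : 0 < n) (cop : coprime a n.+1).

Implicit Types D : vruns a n.+1.

Lemma npos_rho D : dyck (walk D) n -> npos (rho D) = npos D.
Proof.
move=> HD; have sle := sigma_le a0 n0 cop HD.
pose s (k : 'I_n.+1) : 'I_n.+1 := inord (sigma D k).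
have sE k : s k = sigma D k :> nat by rewrite inordK // ltnS sle ?leq_ord.
have sinj : injective s.
  move=> k k' /(congr1 val); rewrite /= !sE.
  by move/(sigma_inj a0 n0 cop HD (leq_ord k) (leq_ord k'))/val_inj.
rewrite /npos (reindex_inj sinj) /=; apply: eq_bigr => k _.
by rewrite sE (vrun_sigma a0 n0 cop HD) ?leq_ord.
Qed.

Lemma num_blocks_npos D : dyck (walk D) n -> num_blocks (Defs.pi D) = npos D.
Proof.
move=> HD; rewrite (num_blocks_pi a0 n0 cop HD) -sum1_card big_mkcond /npos.
by apply: eq_bigr => k _; rewrite inE; case: ifP.
Qed.

Lemma iter_pi_rho d D : dyck (walk D) n ->
  iter d (@rotate_pair a n.+1) (Defs.pi D) = Defs.pi (iter d (@rho a n) D).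
Proof.
move=> HD; elim: d => //= d ->.
by rewrite (pi_rho a0 n0 cop) //; apply: iter_rho_dyck.
Qed.

Lemma iter_rho_n D : dyck (walk D) n -> iter n (@rho a n) D = D.
Proof.
by move=> HD; rewrite -(iter_rho2_fst n D 0) (iter_rho2_n a0 n0 cop HD).
Qed.

Lemma in_NCk k x : reflect (exists2 D, dyck (walk D) n /\ npos D = k & x = Defs.pi D)
  (x \in NCk a n.+1 k).
Proof.
rewrite inE; apply: (iffP andP) => [[/imsetP[D]]|[D [HD nD] ->]].
  rewrite inE => /(is_dyckP a0 n0 cop) HD -> /eqP; rewrite num_blocks_npos // => nD.
  by exists D.
rewrite num_blocks_npos // nD eqxx; split=> //; apply: imset_f; rewrite inE.
exact/(is_dyckP a0 n0 cop).
Qed.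

Lemma rotation_action k : cyclic_action (NCk a n.+1 k) n (@rotate_pair a n.+1).
Proof.
split=> x /in_NCk[D [HD nD] ->].
  apply/in_NCk; exists (rho D); first by rewrite npos_rho //; split=> //; exact: rho_dyck.
  by rewrite (pi_rho a0 n0 cop).
by rewrite iter_pi_rho // iter_rho_n.
Qed.

Lemma card_fixed_NCk k d :
  #|[set x in NCk a n.+1 k | iter d (@rotate_pair a n.+1) x == x]|
  = #|[set D : vruns a n.+1 | [&& is_dyck D, iter (gcdn d n) (@rho a n) D == D & npos D == k]]|.
Proof.
set S := (X in _ = #|X|).
have SD D : D \in S -> dyck (walk D) n by rewrite inE => /and3P[/(is_dyckP a0 n0 cop)].
rewrite -(card_in_imset (f := @Defs.pi a n.+1) (D := S)); last first.
  by move=> D D' /SD HD /SD HD'; apply: (pi_inj a0 n0 cop); apply/(is_dyckP a0 n0 cop).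
apply: eq_card => x; rewrite inE; apply/andP/imsetP.
  case=> /in_NCk[D [HD nD] ->]; rewrite iter_pi_rho // => /eqP E; exists D => //.
  have Dy := introT (is_dyckP a0 n0 cop D) HD.
  rewrite inE Dy nD eqxx andbT /=; apply/eqP; apply: (proj1 (iter_gcd d (iter_rho_n HD))).
  apply: (pi_inj a0 n0 cop); [|exact: Dy|exact: E].
  by apply/(is_dyckP a0 n0 cop); apply: iter_rho_dyck.
case=> D DS ->; have HD := SD D DS; move: DS; rewrite inE => /and3P[_ /eqP E /eqP nD].
split; first by apply/in_NCk; exists D.
rewrite iter_pi_rho //; apply/eqP; congr (Defs.pi _).
exact: (proj2 (iter_gcd d (iter_rho_n HD))) E.
Qed.

Lemma card_fixed_count k g w : g * w.+1 = n ->
  #|[set D : vruns a n.+1 | [&& is_dyck D, iter g (@rho a n) D == D & npos D == k.+1]]|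
    * (if w.+1 == 1 then n.+1 else 1) = fixed_count a g w.+1 k.
Proof.
move=> gw; have := card_rotz_fixed a0 n0 k gw.
rewrite -/(fixed_count a g w.+1 k) => <-.
case: w gw => [|w] gw.
  rewrite muln1 in gw.
  have -> : [set D : vruns a n.+1 | [&& is_dyck D, iter g (@rho a n) D == D & npos D == k.+1]]
      = [set D : vruns a n.+1 | is_dyck D && (npos D == k.+1)].
    apply/setP => D; rewrite !inE; case: (boolP (is_dyck D)) => //= Dy.
    by rewrite gw iter_rho_n ?eqxx //; apply/(is_dyckP a0 n0 cop).
  rewrite (card_paths a0 n0 cop); apply: eq_card => z; rewrite !inE.
  congr (_ && _); rewrite (_ : iter g _ z = z) ?eqxx //.
  apply: ext_inj => x; rewrite ext_iter_rotz // gw.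
  have := @iter_rotseq_n n 1 (ext z) (ext_per z) x; rewrite mul1n; exact.
by rewrite muln1 (card_fixed_paths a0 n0 cop _ gw).
Qed.

End Main.

Theorem theorem6p2 (a b k : nat) (ha : (0 < a)%N) (hb : (2 <= b)%N)
    (hab : coprime a b) (hk : (1 <= k <= a)%N) :
  exists2 f : {poly nat},
    poly_nat_frac f = qNar a b k &
    cyclic_sieving (NCk a b k) b.-1 (@rotate_pair a b) f.
Proof.
case: b hb hab => [|n] //= n0 cop; rewrite ltnS in n0.
case: k hk => [|k] //= hk.
have [g [Ea Eb Ek]] := @qnarayana_exists a n.+1 k.+1 ha isT isT cop.
have g0 := div_qint_ge0 (ltn0Sn k) Ek.
pose f : {poly nat} := map_poly absz g.
have fE (R : nzRingType) : map_poly (fun m : nat => m%:R)%R f = map_poly intr g :> {poly R}.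
  by apply/polyP => i; rewrite !coef_map_id0 // pmulrn gez0_abs.
exists f.
  rewrite (qNarE ha Ea) /poly_nat_frac fE; congr FracField.tofrac.
  by apply/polyP => i; rewrite coef_map_id0 ?intz.
split; first exact: rotation_action.
move=> zeta d prim; rewrite fE -/(evz (zeta ^+ d)%R g).
have w0 : (0 < n %/ gcdn d n)%N by rewrite divn_gt0 ?gcdn_gt0 ?n0 ?orbT // dvdn_leq ?dvdn_gcdr.
have gw : (gcdn d n * (n %/ gcdn d n))%N = n by rewrite mulnC divnK ?dvdn_gcdr.
have Ev := evz_narayana ha (exp_prim_root prim d) gw Eb.
rewrite -(prednK w0) in gw Ev.
have := congr1 (fun m => m%:R : algC)%R (card_fixed_count ha n0 cop k gw).
(* Both counts carry the same nonzero factor, [n.+1] or 1, which is then cancelled. *)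
rewrite -card_fixed_NCk // -Ev natrM mulrC (fun_if (fun m => m%:R : algC)%R) => E.
by apply/esym/(mulfI _ E); case: ifP; rewrite ?oner_neq0 ?pnatr_eq0.
Qed.
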